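(* Let $K$ be a Bara\'nski carpet. Then (a) the following are equivalent: $K$ satisfies $\textbf{u.f.A}$; $\dim_{\mathrm B}K=\dim_{\mathrm A}K$; $\dim_{\mathrm H}K=\dim_{\mathrm A}K$; (b) the following are equivalent: $K$ satisfies $\textbf{u.f.L}$; $\dim_{\mathrm L}K=\dim_{\mathrm H}K$; $\dim_{\mathrm L}K=\dim_{\mathrm A}K$; $K$ is Ahlfors regular.
   Context: **Bara\'nski carpets.** Let $r,s,d\ge 2$ be integers with $d\le rs$. For $1\le i\le r$, $1\le j\le s$ let $0<a_i,b_j<1$ with $\sum_{i=1}^r a_i=1$, $\sum_{j=1}^s b_j=1$. Let $\mathcal{J}=\{(i_1,j_1),\dots,(i_d,j_d)\}\subseteq\{1,\dots,r\}\times\{1,\dots,s\}$ be a set of $d$ pairs. For $l=1,\dots,d$ let $\psi_l(x,y)=\big(a_{i_l}x+\sum_{i<i_l}a_i,\; b_{j_l}y+\sum_{j<j_l}b_j\big)$. The Bara\'nski carpet $K$ is the attractor of $\{\psi_1,\dots,\psi_d\}$, i.e. the unique non-empty compact set with $K=\bigcup_{l=1}^d\psi_l(K)$. Standing assumption, made for every Bara\'nski carpet: there is $l$ with $a_{i_l}\ne b_{j_l}$, and $K$ is not contained in any vertical or horizontal line. **Types.** $K$ is of horizontal type if $a_{i_l}\ge b_{j_l}$ for all $l$; of vertical type if $a_{i_l}\le b_{j_l}$ for all $l$; of mixed type otherwise. **Notation.** $I_i=\{l: i_l=i\}$, $J_j=\{l: j_l=j\}$, $\mathcal{J}_1=\{i: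 I_i\ne\emptyset\}$, $\mathcal{J}_2=\{j: J_j\ne\emptyset\}$. $t_1,t_2$ are the unique reals with $\sum_{i\in\mathcal{J}_1}a_i^{t_1}=1$, $\sum_{j\in\mathcal{J}_2}b_j^{t_2}=1$. For $l=1,\dots,d$, $S_{1,l},S_{2,l}$ are the unique solutions of $\sum_{m\in I_{i_l}}b_{j_m}^{S_{1,l}}=1$ and $\sum_{m\in J_{j_l}}a_{i_m}^{S_{2,l}}=1$. Define $E_1,E_2,F_1,F_2$ by: - horizontal type: $E_1=t_1+\max_l S_{1,l}$, $E_2=-1$, $F_1=t_1+\min_l S_{1,l}$, $F_2=3$; - vertical type: $E_1=-1$, $E_2=t_2+\max_l S_{2,l}$, $F_1=3$, $F_2=t_2+\min_l S_{2,l}$; - mixed type: $E_1=t_1+\max_l S_{1,l}$, $E_2=t_2+\max_l S_{2,l}$, $F_1=t_1+\min_l S_{1,l}$, $F_2=t_2+\min_l S_{2,l}$. (It is known, by Fraser, that $\dim_{\mathrm A}K=\max\{E_1,E_2\}$ and $\dim_{\mathrm L}K=\min\{F_1,F_2\}$.) **Fibre conditions.** $K$ has uniform vertical fibres if there is $t\ge0$ with $\sum_{l\in I_i}b_{j_l}^t=1$ for all $i\in\mathcal{J}_1$; uniform horizontal fibres if there is $t\ge 0$ with $\sum_{l\in J_j}a_{i_l}^t=1$ for all $j\in\mathcal{J}_2$. $\textbf{u.f.A}$: $K$ has uniform vertical fibres if $E_1>E_2$; uniform horizontal fibres if $E_1<E_2$; uniform vertical or uniform horizontal fibres if $E_1=E_2$.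 $\textbf{u.f.L}$: $K$ has uniform vertical fibres if $K$ is of horizontal type; uniform horizontal fibres if $K$ is of vertical type; both uniform vertical and uniform horizontal fibres, and $F_1=F_2$, if $K$ is of mixed type. **Dimensions and regularity.** $\dim_{\mathrm H},\dim_{\mathrm B},\dim_{\mathrm A},\dim_{\mathrm L}$ are the Hausdorff, box, Assouad and lower dimensions. (With $N_\rho(E)$ the least number of sets of diameter at most $\rho$ covering $E$, and $|K|$ the diameter of $K$: $\dim_{\mathrm A}K$ is the infimum of $\alpha\geq 0$ for which there is $C>0$ with $N_\rho(B(x,R)\cap K)\le C(R/\rho)^\alpha$ for all $x\in K$, $0<\rho<R\le|K|$; $\dim_{\mathrm L}K$ is the supremum of $\alpha\ge 0$ for which there is $C>0$ with $N_\rho(B(x,R)\cap K)\ge C(R/\rho)^\alpha$ for all such $x,\rho,R$.) $K$ is Ahlfors regular if there is $c>0$ with $c^{-1}\rho^{\dim_{\mathrm H}K}\le\mathcal{H}^{\dim_{\mathrm H}K}(B(x,\rho)\cap K)\le c\,\rho^{\dim_{\mathrm H}K}$ for all $x\in K$, $0<\rho\le|K|$, where $B(x,\rho)$ is the closed ball. *)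

(* Defs.v *)
From HB Require Import structures.
From mathcomp Require Import all_boot all_order all_algebra.
From mathcomp Require Import all_classical all_reals all_analysis.

Set Implicit Arguments.
Unset Strict Implicit.
Unset Printing Implicit Defensive.

Import Order.TTheory GRing.Theory Num.Theory.
Import numFieldNormedType.Exports.

Local Open Scope classical_set_scope.
Local Open Scope ring_scope.

Section Dimensions.
Context {R : realType}.
Implicit Types (E : set (R * R)) (x p q : R * R).

(* The library norm on [R * R] is the max norm; the plane is Euclidean here. *)
Definition edist p q : R :=
  Num.sqrt ((p.1 - q.1) ^+ 2 + (p.2 - q.2) ^+ 2).

Definition eball x (rad : R) : set (R * R) := [set y | edist x y <= rad].

(* [0] is added so that the empty set has diameter [0] rather than [-oo]. *)
Definition diam E : \bar R :=
  ereal_sup (0%E |` [set (edist z.1 z.2)%:E | z in E `*` E]).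

Definition covers (rho : R) E (n : nat) : Prop :=
  exists U : 'I_n -> set (R * R),
    (forall i, (diam (U i) <= rho%:E)%E) /\ E `<=` \bigcup_i U i.

(* [+oo] when there is no finite cover. *)
Definition covering_number (rho : R) E : \bar R :=
  ereal_inf [set n%:R%:E | n in [set n | covers rho E n]].

(* The empty set weighs [0] for every exponent, [s = 0] included, whereas
   [0 `^ 0 = 1] is the weight of a point. *)
Definition diam_pow (s : R) E : \bar R :=
  if E == set0 then 0%E else (diam E `^ s)%E.

Definition hausdorff_content (s delta : R) E : \bar R :=
  ereal_inf [set (\sum_(0 <= k <oo) diam_pow s (U k))%E |
    U in [set U : nat -> set (R * R) |
      (forall k, (diam (U k) <= delta%:E)%E) /\ E `<=` \bigcup_k U k]].

(* The supremum is the limit as [delta] tends to [0], by monotonicity. *)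
Definition hausdorff_measure (s : R) E : \bar R :=
  ereal_sup [set hausdorff_content s delta E | delta in [set delta | 0 < delta]].

Definition hausdorff_dim E : \bar R :=
  ereal_inf [set s%:E | s in [set s | 0 <= s /\ hausdorff_measure s E = 0%E]].

(* "The box dimension of [E] exists and equals [D]." *)
Definition box_dim_is E (D : \bar R) : Prop :=
  (lne (covering_number rho E) * ((- ln rho)^-1)%:E)%E @[rho --> 0^'+] --> D.

Definition assouad_dim E : \bar R :=
  ereal_inf [set alpha%:E | alpha in [set alpha | 0 <= alpha /\
    exists2 C : R, 0 < C & forall x (rho rad : R),
      E x -> 0 < rho -> rho < rad -> (rad%:E <= diam E)%E ->
      (covering_number rho (eball x rad `&` E)
         <= (C * (rad / rho) `^ alpha)%:E)%E]].

Definition lower_dim E : \bar R :=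
  ereal_sup [set alpha%:E | alpha in [set alpha | 0 <= alpha /\
    exists2 C : R, 0 < C & forall x (rho rad : R),
      E x -> 0 < rho -> rho < rad -> (rad%:E <= diam E)%E ->
      ((C * (rad / rho) `^ alpha)%:E
         <= covering_number rho (eball x rad `&` E))%E]].

Definition ahlfors_regular E : Prop :=
  exists2 h : R, hausdorff_dim E = h%:E &
  exists2 c : R, 0 < c & forall x (rho : R),
    E x -> 0 < rho -> (rho%:E <= diam E)%E ->
    ((c^-1 * rho `^ h)%:E <= hausdorff_measure h (eball x rho `&` E))%E /\
    (hausdorff_measure h (eball x rho `&` E) <= (c * rho `^ h)%:E)%E.

End Dimensions.

Section Baranski.
Context {R : realType} {r s d : nat}.
(* [ij l] is the pair (i_l, j_l). *)
Variables (a : 'I_r -> R) (b : 'I_s -> R) (ij : 'I_d -> 'I_r * 'I_s).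

Definition psi (l : 'I_d) (p : R * R) : R * R :=
  (a (ij l).1 * p.1 + \sum_(i < r | (i < (ij l).1)%N) a i,
   b (ij l).2 * p.2 + \sum_(j < s | (j < (ij l).2)%N) b j).

Definition attractor (K : set (R * R)) : Prop :=
  [/\ K !=set0, compact K & K = \bigcup_l (psi l @` K)].

Definition horizontal_type : bool := [forall l, b (ij l).2 <= a (ij l).1].
Definition vertical_type : bool := [forall l, a (ij l).1 <= b (ij l).2].
Definition mixed_type : bool := ~~ horizontal_type && ~~ vertical_type.

Definition fibI (i : 'I_r) : {set 'I_d} := [set l | (ij l).1 == i]%SET.
Definition fibJ (j : 'I_s) : {set 'I_d} := [set l | (ij l).2 == j]%SET.
Definition J1 : {set 'I_r} := [set i | fibI i != finset.set0]%SET.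
Definition J2 : {set 'I_s} := [set j | fibJ j != finset.set0]%SET.

(* Each of the four equations below has exactly one solution, which [xget]
   selects; its default value [0] is never used for an actual carpet. *)
Definition t1 : R := xget 0 [set t : R | \sum_(i in J1) a i `^ t = 1].
Definition t2 : R := xget 0 [set t : R | \sum_(j in J2) b j `^ t = 1].
Definition S1 (l : 'I_d) : R :=
  xget 0 [set t : R | \sum_(m in fibI (ij l).1) b (ij m).2 `^ t = 1].
Definition S2 (l : 'I_d) : R :=
  xget 0 [set t : R | \sum_(m in fibJ (ij l).2) a (ij m).1 `^ t = 1].

(* [sup] and [inf] of finite nonempty sets of reals: maximum and minimum. *)
Definition E1 : R := if vertical_type then -1 else t1 + sup (range S1).
Definition E2 : R := if horizontal_type then -1 else t2 + sup (range S2).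
Definition F1 : R := if vertical_type then 3 else t1 + inf (range S1).
Definition F2 : R := if horizontal_type then 3 else t2 + inf (range S2).

Definition uniform_vertical_fibres : Prop :=
  exists2 t : R, 0 <= t &
    forall i, i \in J1 -> \sum_(l in fibI i) b (ij l).2 `^ t = 1.

Definition uniform_horizontal_fibres : Prop :=
  exists2 t : R, 0 <= t &
    forall j, j \in J2 -> \sum_(l in fibJ j) a (ij l).1 `^ t = 1.

Definition ufA : Prop :=
  [/\ E2 < E1 -> uniform_vertical_fibres,
      E1 < E2 -> uniform_horizontal_fibres
    & E1 = E2 -> uniform_vertical_fibres \/ uniform_horizontal_fibres].

Definition ufL : Prop :=
  [/\ horizontal_type -> uniform_vertical_fibres,
      vertical_type -> uniform_horizontal_fibres
    & mixed_type -> [/\ uniform_vertical_fibres,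
                        uniform_horizontal_fibres & F1 = F2]].

End Baranski.

(* Main.v *)
Require Import Defs.
From mathcomp Require Import all_boot all_order all_algebra.
From mathcomp Require Import all_classical all_reals all_analysis.
From mathcomp Require Import ring lra zify.

(* A cell of scale rho is a pair (u, v) of a column word and a row word, both
   stopped as soon as their contraction is at most rho; a set of diameter rho
   meets boundedly many of them.

   Upper bounds count cells.  The cells (u', v') with |v'| <= |u'| inside a cell
   (u, v) obey a Kraft inequality with weights a_{u'}^{t_1} b_{v'}^{sigma}, valid
   as soon as every column satisfies sum b^sigma <= 1 (only their a^{t_1}-weighted
   sum is needed when (u, v) is the whole carpet); since a row consists of letters
   of distinct columns, its sum of a^{t_1} is at most 1, so that (u, v) itself may
   be of either type and no crossing between types has to be followed.
   Exchanging the coordinates handles |u'| <= |v'|.  This gives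
   dim_A <= max(E_1, E_2), and an upper box dimension below E_i when the fibres
   are not uniform.

   Lower bounds for dim_H use the Bernoulli weights a^{t_1} b^{S_1}: every cell has
   mass at most rho^{t_1 + min S_1}, and typical ones much less if S_1 is not
   constant.  The mass distribution principle is applied to finite covers and
   words of a fixed large length, so that no measure on the code space is needed.

   If b < a for some letter, a long power of that letter followed by a long run in
   one column exhibits places with R/rho unbounded where the carpet has about
   (R/rho)^{t_1 + S_1} cells; the columns with extremal S_1 bound dim_A from below
   by E_1 and dim_L from above by F_1.  All equivalences follow by comparing these
   bounds. *)
Import Defs.

Set Implicit Arguments.
Unset Strict Implicit.
Unset Printing Implicit Defensive.

Import Order.TTheory GRing.Theory Num.Theory.
Import numFieldNormedType.Exports.

Local Open Scope classical_set_scope.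
Local Open Scope ring_scope.

(** * Real powers and Moran equations *)

(** No formula for the Hausdorff or the box dimension enters: one-sided bounds suffice, provided
    that they are strict whenever the fibres are not uniform. With uniform fibres
    [min S_1 = max S_1], so the lower bound for [dim_H] meets the upper bound for [dim_A]; without
    them the strict bounds keep the dimensions apart.

    The special places work for the following reason. A power of a letter with [b < a] is a
    rectangle much wider than high. A run in one column brings the width down to the height, but
    leaves the rows of the run free. The resulting near-square shows a single column vertically,
    with exponent [S_1], and all columns horizontally, with exponent [t_1]; the two choices are
    independent, hence the exponents add. In vertical type there is no such letter, which is why
    [E_1] and [F_1] drop out.

    Working with finite words costs a length bound [N] in every enumeration. Since all ratios are
    bounded away from 1, it is harmless once [N] is large for the scale at hand. Every one-sided
    bound is proved for columns only; the reflection in the diagonal supplies the rows. *)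

Section RealPowers.
Context {R : realType}.
Implicit Types x y c s t e : R.

Lemma exprn_le_eps x e : 0 <= x < 1 -> 0 < e -> exists n, x ^+ n <= e.
Proof.
move=> /andP[x0 x1] e0.
have : x ^+ n @[n --> \oo] --> (0 : R) by apply: cvg_expr; rewrite ger0_norm.
move=> /cvgr0Pnorm_le /(_ _ e0) [N _ /(_ N (leqnn N))] /=.
by rewrite ger0_norm ?exprn_ge0 // => h; exists N.
Qed.

Lemma eq_ler x y : x = y -> x <= y.
Proof. by move=> ->. Qed.

Lemma sumr_const_seq (I : Type) (l : seq I) x : \sum_(i <- l) x = (size l)%:R * x.
Proof.
elim: l => [|i l IH]; first by rewrite big_nil mul0r.
by rewrite big_cons IH /= -addn1 natrD mulrDl mul1r addrC.
Qed.

Lemma powR_addr x s t : 0 < x -> x `^ (s + t) = x `^ s * x `^ t.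
Proof. by move=> x0; rewrite powRD // (gt_eqF x0) implybT. Qed.

Lemma powR_lt1_mono x s t : 0 < x < 1 -> s < t -> x `^ t < x `^ s.
Proof.
move=> /andP[x0 x1] st; rewrite /powR (gt_eqF x0) ltr_expR.
by rewrite ltr_nM2r // ln_lt0 // x0.
Qed.

Lemma powR_le1_mono x s t : 0 < x <= 1 -> s <= t -> x `^ t <= x `^ s.
Proof. by move=> hx; apply: ger_powR. Qed.

Lemma powR_le_l x y t : 0 <= t -> 0 <= x -> x <= y -> x `^ t <= y `^ t.
Proof.
move=> t0 x0 xy; apply: (ge0_ler_powR t0); rewrite // nnegrE //.
exact: le_trans xy.
Qed.

Lemma powR_le1 x t : 0 <= t -> 0 <= x <= 1 -> x `^ t <= 1.
Proof.
by move=> t0 /andP[x0 x1]; apply: le_trans (powR_le_l t0 x0 x1) _; rewrite powR1.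
Qed.

Lemma powR_inv_l x t : 0 <= x -> x^-1 `^ t = (x `^ t)^-1.
Proof. by move=> x0; rewrite -powR_inv1 // powRAC powR_inv1 // powR_ge0. Qed.

Lemma powR_div x y t : 0 <= x -> 0 <= y -> (x / y) `^ t = x `^ t / y `^ t.
Proof. by move=> x0 y0; rewrite powRM ?invr_ge0 // powR_inv_l. Qed.

Lemma powR_expn x t n : 0 <= x -> (x ^+ n) `^ t = (x `^ t) ^+ n.
Proof.
move=> x0; elim: n => [|n IH]; first by rewrite !expr0 powR1.
by rewrite !exprS powRM ?exprn_ge0 // IH.
Qed.

Lemma powR_prod (I : Type) (l : seq I) (P : pred I) (F : I -> R) t :
  (forall i, 0 <= F i) ->
  (\prod_(i <- l | P i) F i) `^ t = \prod_(i <- l | P i) F i `^ t.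
Proof.
move=> F0; elim: l => [|i l IH]; first by rewrite !big_nil powR1.
rewrite !big_cons; case: ifP => // _.
by rewrite powRM ?IH //; apply: prodr_ge0.
Qed.

Lemma powR_rootK x t : 0 <= x -> t != 0 -> (x `^ t^-1) `^ t = x.
Proof. by move=> x0 t0; rewrite -powRrM mulVf // powRr1. Qed.

(** Turns a gain by a factor into a gain in the exponent; in its uses [c] is a lower bound for all
    contraction ratios. *)
Lemma powR_of_base x c : 0 < c < 1 -> 0 < x -> c `^ (ln x / ln c) = x.
Proof.
move=> /andP[c0 c1] x0; rewrite /powR (gt_eqF c0) divfK ?lnK //.
by rewrite lt_eqF // ln_lt0 // c0.
Qed.

End RealPowers.

Section Moran.
Context {R : realType} {I : finType}.
Implicit Types (A : {set I}) (c : I -> R) (s t : R).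

Let finset0 := @finset.set0 I.

Lemma sum_powR_lt A c s t : A != finset0 -> (forall i, 0 < c i < 1) -> s < t ->
  \sum_(i in A) c i `^ t < \sum_(i in A) c i `^ s.
Proof.
case/set0Pn => i iA c01 st; rewrite (bigD1 i) //= [ltRHS](bigD1 i) //=.
rewrite ltr_leD // ?powR_lt1_mono //; apply: ler_sum => j _.
by apply/ltW/powR_lt1_mono.
Qed.

Lemma sum_powR_inj A c s t : A != finset0 -> (forall i, 0 < c i < 1) ->
  \sum_(i in A) c i `^ s = \sum_(i in A) c i `^ t -> s = t.
Proof.
move=> A0 c01 E; case: (ltgtP s t) => // h.
- by have := sum_powR_lt A0 c01 h; rewrite E ltxx.
- by have := sum_powR_lt A0 c01 h; rewrite E ltxx.
Qed.

(** Intermediate values: at 0 the sum is the number of terms, and at an integer [n] with every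
    [c i ^+ n] at most [1 / #|A|] it has fallen to at most 1. *)
Lemma moran_exists A c : A != finset0 -> (forall i, 0 < c i < 1) ->
  exists t, \sum_(i in A) c i `^ t = 1.
Proof.
move=> A0 c01.
have cpos i : 0 < c i by case/andP: (c01 i).
have [n hn] : exists n, forall i, c i ^+ n <= #|A|%:R^-1.
  have A1 : 0 < (#|A|%:R : R)^-1 by rewrite invr_gt0 ltr0n card_gt0.
  have H i : exists n, c i ^+ n <= #|A|%:R^-1.
    by apply: exprn_le_eps => //; case/andP: (c01 i) => /ltW -> ->.
  have [f hf] := choice H; exists (\max_i f i)%N => i.
  apply: le_trans (hf i); apply: ler_wiXn2l; rewrite ?(ltW (cpos i)) //.
    by case/andP: (c01 i) => _ /ltW.
  exact: leq_bigmax.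
pose f t := \sum_(i in A) c i `^ t.
have f0 : 1 <= f 0.
  rewrite /f (eq_bigr (fun=> 1)) => [|i _]; last by rewrite powRr0.
  by rewrite sumr_const -[1 *+ _]/(_%:R) ler1n card_gt0.
have fn : f n%:R <= 1.
  apply: (@le_trans _ _ (\sum_(i in A) #|A|%:R^-1)).
    by apply: ler_sum => i _; rewrite powR_mulrn ?hn // ltW.
  by rewrite sumr_const -[_ *+ _]mulr_natl divff // pnatr_eq0 -lt0n card_gt0.
have [|||t _ ft] := @IVT R f 0 n%:R 1; last by exists t.
- by rewrite ler0n.
- apply: continuous_subspaceT; rewrite /f; elim: (index_enum I) => [|i l IH] t.
    by under eq_fun do rewrite big_nil; exact: cvg_cst.
  under eq_fun do rewrite big_cons; case: (i \in A); last exact: IH.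
  apply: cvgD; last exact: IH.
  rewrite (_ : powR (c i) = fun t => expR (t * ln (c i))); last first.
    by apply/funext => u; rewrite /powR (gt_eqF (cpos i)).
  apply: (@continuous_comp _ _ _ (fun u : R => u * ln (c i)) expR).
    exact: mulrr_continuous.
  exact: continuous_expR.
- by rewrite ge_min fn orbT /= le_max f0.
Qed.

Lemma moran_ge0 A c t : A != finset0 -> (forall i, 0 < c i < 1) ->
  \sum_(i in A) c i `^ t = 1 -> 0 <= t.
Proof.
move=> A0 c01 E; rewrite leNgt; apply/negP => /(sum_powR_lt A0 c01).
rewrite E (eq_bigr (fun=> 1)) => [|i _]; last by rewrite powRr0.
by rewrite sumr_const -[1 *+ _]/(_%:R) ltNge ler1n card_gt0 A0.
Qed.

Lemma moran_xget A c : A != finset0 -> (forall i, 0 < c i < 1) ->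
  let t := xget 0 [set t : R | \sum_(i in A) c i `^ t = 1] in
  \sum_(i in A) c i `^ t = 1.
Proof.
move=> A0 c01 /=.
by have /(xgetPex 0) : exists t, [set t : R | \sum_(i in A) c i `^ t = 1] t
  := moran_exists A0 c01.
Qed.

Lemma moran_le A c s t : (forall i, 0 < c i < 1) ->
  \sum_(i in A) c i `^ s = 1 -> s <= t -> \sum_(i in A) c i `^ t <= 1.
Proof.
move=> c01 <- st; apply: ler_sum => i _; apply: powR_le1_mono => //.
by case/andP: (c01 i) => -> /ltW.
Qed.

End Moran.

(** * Words and stopping times *)

Section Words.
Context {R : realType} {T : eqType}.
Variable c : T -> R.
Implicit Types (u v z : seq T) (rho x : R).

Definition wt u : R := \prod_(i <- u) c i.

(** The threshold is rescaled along the word, which suits induction. For [rho < 1] these are the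
    words of weight at most [rho] all of whose proper prefixes weigh more; for [1 <= rho] only the
    empty word is stopped. *)
Fixpoint stopped rho u : bool :=
  if u is i :: u' then (rho < 1) && stopped (rho / c i) u' else 1 <= rho.

(** A word too heavy to reach the threshold is returned whole, so the result is stopped only if
    [wt u <= rho]. *)
Fixpoint cut rho u : seq T :=
  if rho < 1 then (if u is i :: u' then i :: cut (rho / c i) u' else [::])
  else [::].

Lemma wt_nil : wt [::] = 1.
Proof. by rewrite /wt big_nil. Qed.

Lemma wt_cons i u : wt (i :: u) = c i * wt u.
Proof. by rewrite /wt big_cons. Qed.

Lemma wt_cat u v : wt (u ++ v) = wt u * wt v.
Proof. by rewrite /wt big_cat. Qed.

Lemma wt_nseq n i : wt (nseq n i) = c i ^+ n.
Proof. by elim: n => [|n IH]; rewrite ?wt_nil // wt_cons IH exprS. Qed.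

Hypothesis c01 : forall i, 0 < c i < 1.

Let c_gt0 i : 0 < c i. Proof. by case/andP: (c01 i). Qed.
Let c_lt1 i : c i < 1. Proof. by case/andP: (c01 i). Qed.

Lemma wt_gt0 u : 0 < wt u.
Proof. by apply: prodr_gt0 => i _. Qed.

Lemma wt_le1 u : wt u <= 1.
Proof.
elim: u => [|i u IH]; first by rewrite wt_nil.
by rewrite wt_cons mulr_ile1 // ltW // wt_gt0.
Qed.

Lemma wt_le_expr x u : (forall i, i \in u -> c i <= x) -> wt u <= x ^+ size u.
Proof.
elim: u => [|i u IH] h; first by rewrite wt_nil expr0.
have x0 : 0 <= x by apply: le_trans (h i (mem_head _ _)); apply: ltW.
rewrite wt_cons exprS ler_pM ?(ltW (wt_gt0 _)) ?(ltW (c_gt0 _)) ?h ?mem_head //.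
by apply: IH => j ju; apply: h; rewrite inE ju orbT.
Qed.

Lemma wt_ge_expr x u : 0 <= x -> (forall i, x <= c i) -> x ^+ size u <= wt u.
Proof.
move=> x0 h; elim: u => [|i u IH]; first by rewrite wt_nil expr0.
by rewrite wt_cons exprS ler_pM ?exprn_ge0.
Qed.

Lemma stopped_wt rho u : stopped rho u -> wt u <= rho.
Proof.
elim: u rho => [|i u IH] rho /=; first by rewrite wt_nil.
by case/andP=> _ /IH; rewrite wt_cons ler_pdivlMr // mulrC.
Qed.

(** Before its last letter the weight still exceeded [rho], so at most one factor [cm] is lost;
    [cm <= 1] takes care of the empty word. *)
Lemma stopped_wt_ge cm rho u : 0 < cm <= 1 -> (forall i, cm <= c i) ->
  rho <= 1 -> stopped rho u -> cm * rho <= wt u.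
Proof.
move=> /andP[cm0 cm1] hcm; elim: u rho => [|i u IH] rho r1 /=.
  by move=> r1'; rewrite wt_nil mulr_ile1 ?(ltW cm0) // (le_trans ler01).
case/andP=> r1' st; rewrite wt_cons.
case: (lerP (rho / c i) 1) => h; last first.
  have -> : u = [::] by case: u st {IH} => //= j u; rewrite ltNge (ltW h).
  by rewrite wt_nil mulr1; apply: le_trans (hcm i); rewrite ler_piMr ?(ltW cm0).
have := IH _ h st; rewrite mulrA ler_pdivrMr //.
by rewrite (mulrC (wt u)).
Qed.

Lemma cut_prefix rho u : prefix (cut rho u) u.
Proof.
elim: u rho => [|i u IH] rho /=; first by case: ifP.
by case: ifP => _ //=; rewrite eqxx IH.
Qed.

Lemma cut_stopped rho u : wt u <= rho -> stopped rho (cut rho u).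
Proof.
elim: u rho => [|i u IH] rho /=.
  by rewrite wt_nil; case: ifP.
rewrite wt_cons => h; case: ltP => r1 /=; last by [].
by rewrite r1 IH // ler_pdivlMr // mulrC.
Qed.

Lemma stopped_cat rho u v : rho < wt u ->
  stopped rho (u ++ v) = stopped (rho / wt u) v.
Proof.
elim: u rho => [|i u IH] rho /=; first by rewrite wt_nil divr1.
rewrite wt_cons => h.
have -> : rho < 1.
  by apply: lt_le_trans h _; rewrite mulr_ile1 ?wt_le1 // ltW ?wt_gt0.
rewrite /= IH; first by rewrite invfM mulrA.
by rewrite ltr_pdivrMr // mulrC.
Qed.

(** [N] is fuel: words still unfinished when it runs out are dropped. Upper bounds on sums therefore
    hold for every [N], while lower bounds need [x ^+ N <= rho] with [x] above all ratios. *)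
Fixpoint stops (S : seq T) (N : nat) rho : seq (seq T) :=
  if 1 <= rho then [:: [::]]
  else if N is N'.+1 then
    flatten [seq [seq i :: u | u <- stops S N' (rho / c i)] | i <- S]
  else [::].

Lemma stops_stopped S N rho u : u \in stops S N rho -> stopped rho u.
Proof.
elim: N rho u => [|N IH] rho u /=; case: (leP 1 rho) => h //; rewrite ?inE.
- by move/eqP->.
- by move/eqP->.
by case/flatten_mapP => i iS /mapP[u' /IH hu ->] /=; rewrite h hu.
Qed.

Lemma stops_all S N rho u : u \in stops S N rho -> {subset u <= S}.
Proof.
elim: N rho u => [|N IH] rho u /=; case: (leP 1 rho) => h //; rewrite ?inE.
- by move/eqP->.
- by move/eqP->.
case/flatten_mapP => i iS /mapP[u' /IH hu ->] j; rewrite inE.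
by case/orP=> [/eqP->//|/hu].
Qed.

Lemma stops_size S N rho u : u \in stops S N rho -> (size u <= N)%N.
Proof.
elim: N rho u => [|N IH] rho u /=; case: (leP 1 rho) => h //; rewrite ?inE.
- by move/eqP->.
- by move/eqP->.
by case/flatten_mapP => i iS /mapP[u' /IH hu ->].
Qed.

Lemma mem_stops S N rho u : stopped rho u -> {subset u <= S} -> (size u <= N)%N ->
  u \in stops S N rho.
Proof.
elim: N rho u => [|N IH] rho [|i u] //=.
- by move=> ->.
- by move=> ->.
case/andP=> r1 st sub sz; rewrite leNgt r1 /=; apply/flatten_mapP; exists i.
  by apply: sub; rewrite mem_head.
apply: map_f; apply: IH => // j ju; apply: sub; by rewrite inE ju orbT.
Qed.

Lemma uniq_stops S N rho : uniq S -> uniq (stops S N rho).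
Proof.
move=> uS; elim: N rho => [|N IH] rho /=; case: leP => // h.
apply: (@allpairs_uniq_dep _ _ _ (fun i u => i :: u) S (fun i => stops S N (rho / c i))).
- exact: uS.
- by move=> i _; exact: IH.
- by move=> [i u] [j v] _ _ /= [-> ->].
Qed.

Lemma stops_mass S N rho (p : T -> R) :
  (forall i, 0 <= p i) -> \sum_(i <- S) p i <= 1 ->
  \sum_(u <- stops S N rho) \prod_(i <- u) p i <= 1.
Proof.
move=> p0 pS; elim: N rho => [|N IH] rho /=; case: (leP 1 rho) => h;
  rewrite ?big_seq1 ?big_nil ?ler01 //.
rewrite big_flatten big_map; apply: le_trans pS; apply: ler_sum => i _.
rewrite big_map; under eq_bigr do rewrite big_cons.
by rewrite -big_distrr /= ler_piMr.
Qed.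

Lemma stops_mass_eq S N rho x (p : T -> R) :
  (forall i, i \in S -> c i <= x) -> x ^+ N <= rho -> \sum_(i <- S) p i = 1 ->
  \sum_(u <- stops S N rho) \prod_(i <- u) p i = 1.
Proof.
move=> hx; elim: N rho => [|N IH] rho /=.
  by rewrite expr0 => -> _; rewrite big_seq1 big_nil.
move=> xN pS; case: (leP 1 rho) => h; first by rewrite big_seq1 big_nil.
rewrite big_flatten big_map -[RHS]pS big_seq_cond [RHS]big_seq_cond.
apply: eq_bigr => i; rewrite andbT => iS.
rewrite big_map; under eq_bigr do rewrite big_cons.
rewrite -big_distrr /= IH ?mulr1 // ler_pdivlMr //.
apply: le_trans xN; rewrite exprSr ler_pM2l ?hx //.
by apply: exprn_gt0; apply: lt_le_trans (hx i iS).
Qed.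

(** Kraft's inequality: the weights [c^t] of the stopped words sum to at most 1 and each is at least
    [(cm * rho)^t]. In [size_stops_ge] the sum is 1 and each weight is at most [rho^t]. *)
Lemma size_stops_le S N rho t cm : 0 < cm <= 1 -> (forall i, cm <= c i) ->
  0 <= t -> 0 < rho <= 1 -> \sum_(i <- S) c i `^ t <= 1 ->
  (size (stops S N rho))%:R <= (cm * rho) `^ (- t).
Proof.
move=> cm01 hcm t0 /andP[r0 r1] St; have [cm0 _] := andP cm01.
rewrite powRN -[leRHS]mul1r ler_pdivlMr ?powR_gt0 ?mulr_gt0 //.
apply: le_trans (stops_mass N rho (fun i => powR_ge0 (c i) t) St).
rewrite -sumr_const_seq.
rewrite big_seq [leRHS]big_seq; apply: ler_sum => u uS.
rewrite -powR_prod => [|i]; last exact: ltW.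
apply: powR_le_l => //; first by rewrite mulr_ge0 ?ltW.
exact: stopped_wt_ge (stops_stopped uS).
Qed.

Lemma size_stops_ge S N rho t x :
  (forall i, i \in S -> c i <= x) -> x ^+ N <= rho ->
  0 <= t -> 0 < rho -> \sum_(i <- S) c i `^ t = 1 ->
  rho `^ (- t) <= (size (stops S N rho))%:R.
Proof.
move=> hx xN t0 r0 St.
rewrite powRN -[leLHS]mul1r ler_pdivrMr ?powR_gt0 //.
rewrite -[leLHS](stops_mass_eq hx xN St).
rewrite -sumr_const_seq.
rewrite big_seq [leRHS]big_seq; apply: ler_sum => u uS.
rewrite -powR_prod => [|i]; last exact: ltW.
apply: powR_le_l => //; first by rewrite ltW // wt_gt0.
exact: stopped_wt (stops_stopped uS).
Qed.

End Words.

(** * Coding of the unit interval *)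

Section Intervals.
Context {R : realType} {n : nat}.
Variable c : 'I_n -> R.
Implicit Types (u v : seq 'I_n) (rho x z L : R).

Definition off (i : 'I_n) : R := \sum_(k < n | (k < i)%N) c k.

Fixpoint pos u : R := if u is i :: u' then off i + c i * pos u' else 0.

Hypothesis c01 : forall i, 0 < c i < 1.
Hypothesis c_sum : \sum_(i < n) c i = 1.

Let c_gt0 i : 0 < c i. Proof. by case/andP: (c01 i). Qed.

Lemma off_ge0 i : 0 <= off i.
Proof. by apply: sumr_ge0 => k _; apply: ltW. Qed.

Lemma off_lt (i j : 'I_n) : (i < j)%N -> off i + c i <= off j.
Proof.
move=> ij; rewrite /off [leRHS](bigD1 i) //= [leRHS]addrC lerD2r.
rewrite [leLHS]big_mkcond [leRHS]big_mkcond /=; apply: ler_sum => k _.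
case: ifP => ki; last by case: ifP => // _; apply: ltW.
by rewrite (ltn_trans ki ij) /= -val_eqE /= (ltn_eqF ki).
Qed.

Lemma off_le1 i : off i + c i <= 1.
Proof.
rewrite /off -c_sum [leRHS](bigD1 i) //= [leRHS]addrC lerD2r.
rewrite [leLHS]big_mkcond [leRHS]big_mkcond /=; apply: ler_sum => k _.
case: ifP => ki; last by case: ifP => // _; apply: ltW.
by rewrite -val_eqE /= (ltn_eqF ki).
Qed.

Lemma pos_ge0 u : 0 <= pos u.
Proof. by elim: u => //= i u IH; rewrite addr_ge0 ?off_ge0 // mulr_ge0 // ltW. Qed.

Lemma pos_le1 u : pos u + wt c u <= 1.
Proof.
elim: u => [|i u IH] /=; first by rewrite wt_nil add0r.
rewrite wt_cons -addrA -mulrDr; apply: le_trans (off_le1 i); rewrite lerD2l.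
by rewrite ler_piMr // ltW.
Qed.

Lemma pos_cat u v : pos (u ++ v) = pos u + wt c u * pos v.
Proof.
elim: u => [|i u IH] /=; first by rewrite wt_nil mul1r add0r.
by rewrite IH wt_cons mulrDr mulrA addrA.
Qed.

Definition inside u x := pos u <= x <= pos u + wt c u.

Lemma inside_nil x : inside [::] x = (0 <= x <= 1).
Proof. by rewrite /inside /= wt_nil add0r. Qed.

Lemma inside_cat u v x : inside (u ++ v) (pos u + wt c u * x) = inside v x.
Proof.
rewrite /inside pos_cat wt_cat -addrA -mulrDr !lerD2l !ler_pM2l //;
  exact: wt_gt0.
Qed.

Lemma inside_pos u x : 0 <= x <= 1 -> inside u (pos u + wt c u * x).
Proof. by rewrite -{1}(cats0 u) inside_cat inside_nil. Qed.

Lemma inside_prefix u v x : prefix u v -> inside v x -> inside u x.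
Proof.
case/prefixP => w ->; rewrite /inside pos_cat wt_cat => /andP[h1 h2].
have w0 := wt_gt0 c01 u; have p0 := pos_ge0 w; have p1 := pos_le1 w.
apply/andP; split; first by apply: le_trans h1; rewrite lerDl mulr_ge0 // ltW.
by apply: (le_trans h2); rewrite -addrA -mulrDr lerD2l ler_piMr // ltW.
Qed.

Lemma pos_sep_cons (i j : 'I_n) u v : (i < j)%N ->
  pos (i :: u) + wt c (i :: u) <= pos (j :: v).
Proof.
move=> ij /=; rewrite wt_cons -addrA -mulrDr.
apply: (@le_trans _ _ (off i + c i)).
  by rewrite lerD2l ler_piMr ?pos_le1 // ltW.
apply: le_trans (off_lt ij) _; rewrite lerDl mulr_ge0 ?pos_ge0 // ltW //.
Qed.

(** No stopped word is a proper prefix of another one at the same scale, so the two words differ at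
    some letter. *)
Lemma stopped_sep rho u v : stopped c rho u -> stopped c rho v -> u != v ->
  pos u + wt c u <= pos v \/ pos v + wt c v <= pos u.
Proof.
elim: u v rho => [|i u IH] [|j v] rho //=.
- by move=> r1; rewrite ltNge r1.
- by rewrite leNgt => /andP[-> _].
move=> /andP[r1 su] /andP[_ sv] uv.
case: (ltngtP i j) => ij.
- by left; apply: pos_sep_cons.
- by right; apply: pos_sep_cons.
move/val_inj: ij => ij; subst j.
have {}uv : u != v by apply: contraNneq uv => ->.
rewrite !wt_cons -!addrA -!mulrDr !lerD2l !ler_pM2l //.
exact: IH su sv uv.
Qed.

(** Closed intervals of neighbouring words share an end point, so only interior points determine
    their code. *)
Lemma interior_unique u v x : size u = size v ->
  pos u < x < pos u + wt c u -> inside v x -> u = v.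
Proof.
elim: u v x => [|i u IH] [|j v] x //= [sz] /andP[h1 h2] /andP[h3 h4].
case: (ltngtP i j) => ij.
- have := le_lt_trans (le_trans (pos_sep_cons u v ij) h3) h2.
  by rewrite ltxx.
- have := le_lt_trans (le_trans h4 (pos_sep_cons v u ij)) h1.
  by rewrite ltxx.
move/val_inj: ij => ij; subst j; congr (_ :: _).
have E (y : R) : y = off i + c i * ((y - off i) / c i).
  by rewrite mulrCA divff ?gt_eqF // mulr1 addrC subrK.
move: h1 h2 h3 h4; rewrite !wt_cons -!addrA -!mulrDr /= (E x).
rewrite !ltrD2l !lerD2l !ltr_pM2l // !ler_pM2l // => h1 h2 h3 h4.
by apply: (IH _ ((x - off i) / c i)) => //; apply/andP.
Qed.

Lemma stopped_count cm L rho z (s : seq (seq 'I_n)) : 0 < cm <= 1 ->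
  (forall i, cm <= c i) -> 0 < rho <= 1 -> 0 <= L -> uniq s ->
  (forall u, u \in s -> stopped c rho u /\ `|pos u - z| <= L * rho) ->
  (size s <= (Num.truncn (2 * L / cm)).+1)%N.
Proof.
move=> cm01 hcm /andP[r0 r1] L0 us hs; have /andP[cm0 _] := cm01.
have cr0 : 0 < cm * rho by rewrite mulr_gt0.
(* Left ends of different stopped intervals are at least [cm * rho] apart, so the integer part of
   the position in units of [cm * rho] tells the words apart. *)
pose g u := (pos u - z + L * rho) / (cm * rho).
have g0 u : u \in s -> 0 <= g u <= 2 * L / cm.
  move=> /hs[_]; rewrite ler_norml => /andP[h1 h2].
  rewrite /g ler_pdivlMr // mul0r -lerBlDr sub0r h1 /= ler_pdivrMr //.
  have -> : 2 * L / cm * (cm * rho) = 2 * (L * rho) by field; rewrite gt_eqF.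
  by lra.
pose f u := Num.truncn (g u).
have fi : {in s &, injective f}.
  move=> u v us' vs' E; apply/eqP/negPn/negP => uv.
  have [[su _] [sv _]] := (hs _ us', hs _ vs').
  have /andP[gu _] := g0 _ us'; have /andP[gv _] := g0 _ vs'.
  have /andP[a1 a2] := truncn_itv gu; have /andP[b1 b2] := truncn_itv gv.
  have D w : g w * (cm * rho) = pos w - z + L * rho by rewrite divfK // gt_eqF.
  have wu := stopped_wt_ge c01 cm01 hcm r1 su.
  have wv := stopped_wt_ge c01 cm01 hcm r1 sv.
  rewrite -/(f u) -/(f v) E in a1 a2 b1 b2.
  rewrite -natr1 in a2 b2.
  have e1 : g u * (cm * rho) < (g v + 1) * (cm * rho) by rewrite ltr_pM2r //; lra.
  have e2 : g v * (cm * rho) < (g u + 1) * (cm * rho) by rewrite ltr_pM2r //; lra.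
  rewrite !mulrDl !D mul1r in e1 e2.
  by case: (stopped_sep su sv uv); lra.
rewrite -(size_map f s) -(size_iota 0 (Num.truncn (2 * L / cm)).+1); apply: uniq_leq_size.
  by rewrite map_inj_in_uniq.
move=> k /mapP[u /g0 /andP[gu gl] ->]; rewrite mem_iota leq0n add0n ltnS.
by apply: le_truncn.
Qed.

End Intervals.

(** * Bernoulli weights and counting of cells *)

Section WordList.
Context {R : realType} {d : nat}.
Implicit Types (w : seq 'I_d) (N : nat).

Fixpoint words N : seq (seq 'I_d) :=
  if N is N'.+1 then [seq l :: w | l <- enum 'I_d, w <- words N'] else [:: [::]].

Lemma mem_words N w : (w \in words N) = (size w == N).
Proof.
elim: N w => [|N IH] w /=; first by rewrite inE size_eq0.
apply/allpairsP/idP => [[[l w'] /= [_ + ->]]|]; first by rewrite IH.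
case: w => // l w; rewrite /= eqSS => h; exists (l, w).
by split; rewrite ?mem_enum ?IH.
Qed.

Lemma big_words N (F : seq 'I_d -> R) :
  \sum_(w <- words N.+1) F w = \sum_l \sum_(w <- words N) F (l :: w).
Proof. by rewrite /= big_allpairs_dep /= enumT. Qed.

Lemma words_mass N (p : 'I_d -> R) :
  \sum_(w <- words N) wt p w = (\sum_l p l) ^+ N.
Proof.
elim: N => [|N IH]; first by rewrite big_seq1 wt_nil expr0.
rewrite big_words exprS -IH big_distrl /=; apply: eq_bigr => l _.
by rewrite big_distrr /=; apply: eq_bigr => w _; rewrite wt_cons.
Qed.

End WordList.

Section Symbolic.
Context {R : realType} {r s d : nat}.
Variables (a : 'I_r -> R) (b : 'I_s -> R) (ij : 'I_d -> 'I_r * 'I_s).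
Implicit Types (u : seq 'I_r) (v : seq 'I_s) (w z : seq 'I_d) (l : 'I_d).
Implicit Types (p e : 'I_d -> R) (rho t sg : R).

Definition iw w := [seq (ij l).1 | l <- w].
Definition jw w := [seq (ij l).2 | l <- w].

(** The Bernoulli measure of the words whose column word begins with [u] and whose row word begins
    with [v]: full letters while both last, then whole columns or whole rows. *)
Fixpoint mass p u v : R :=
  match u, v with
  | i :: u', j :: v' => (\sum_(l | ij l == (i, j)) p l) * mass p u' v'
  | i :: u', [::] => (\sum_(l | (ij l).1 == i) p l) * mass p u' [::]
  | [::], _ => \prod_(j <- v) \sum_(l | (ij l).2 == j) p l
  end.

Lemma mass_sum p N u v : \sum_l p l = 1 -> (size u <= N)%N -> (size v <= N)%N ->
  \sum_(w <- words N | prefix u (iw w) && prefix v (jw w)) wt p w = mass p u v.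
Proof.
move=> p1; elim: N u v => [|N IH] u v.
  rewrite !leqn0 !size_eq0 => /eqP-> /eqP->; rewrite big_mkcond big_seq1 /=.
  by rewrite wt_nil big_nil.
move=> hu hv; rewrite big_mkcond big_words.
have E l : \sum_(w <- words N) (if prefix u (iw (l :: w)) && prefix v (jw (l :: w))
      then wt p (l :: w) else 0)
  = (if (if u is i :: _ then (ij l).1 == i else true) &&
       (if v is j :: _ then (ij l).2 == j else true) then
      p l * \sum_(w <- words N | prefix (behead u) (iw w) && prefix (behead v) (jw w))
              wt p w else 0).
  rewrite [in RHS]big_mkcond /= big_distrr /=.
  case: u {hu} => [|i u]; case: v {hv} => [|j v] /=.
  - by apply: eq_bigr => w _; rewrite ?prefix0s wt_cons.
  - case: (eqVneq (ij l).2 j) => _ /=; last by rewrite big1.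
    by apply: eq_bigr => w _; rewrite wt_cons ?prefix0s /=; case: ifP; rewrite ?mulr0.
  - case: (eqVneq (ij l).1 i) => _ /=; last by rewrite big1.
    by apply: eq_bigr => w _; rewrite wt_cons ?prefix0s /=; case: ifP; rewrite ?mulr0.
  - case: (eqVneq (ij l).1 i) => _ /=; last by rewrite big1.
    case: (eqVneq (ij l).2 j) => _ /=; last by rewrite big1 // => w _; rewrite andbF.
    by apply: eq_bigr => w _; rewrite wt_cons /=; case: ifP; rewrite ?mulr0.
rewrite (eq_bigr _ (fun l _ => E l)) -big_mkcond /=.
rewrite -big_distrl IH /=; [|by case: u hu {E}|by case: v hv {E}].
case: u {hu E} => [|i u]; case: v {hv} => [|j v] //=.
- by rewrite p1 mul1r.
- by rewrite big_cons.
- by congr (_ * _); apply: eq_bigl => l; rewrite andbT.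
Qed.

Hypothesis a01 : forall i, 0 < a i < 1.
Hypothesis b01 : forall j, 0 < b j < 1.
Hypothesis ij_inj : injective ij.

Let a_gt0 i : 0 < a i. Proof. by case/andP: (a01 i). Qed.
Let b_gt0 j : 0 < b j. Proof. by case/andP: (b01 j). Qed.

Lemma sum_letter (F : 'I_d -> R) l : \sum_(m | ij m == ij l) F m = F l.
Proof.
rewrite (bigD1 l) //= big1 ?addr0 // => m /andP[/eqP/ij_inj->].
by rewrite eqxx.
Qed.

Lemma sum_letter_le1 (i : 'I_r) (j : 'I_s) :
  \sum_(l | ((ij l).1 == i) && ((ij l).2 == j)) (1 : R) <= 1.
Proof.
case: (pickP (fun l => ((ij l).1 == i) && ((ij l).2 == j))) => [l|h]; last first.
  by rewrite big_pred0.
case/andP=> /eqP il /eqP jl; rewrite (eq_bigl (fun m => ij m == ij l)) ?sum_letter //.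
by move=> m; rewrite -il -jl; case: (ij m) (ij l) => [x y] [x' y'].
Qed.

Let inJ1 l : (ij l).1 \in J1 ij.
Proof. by rewrite inE; apply/set0Pn; exists l; rewrite inE. Qed.

Lemma sum_row_le t (j : 'I_s) : \sum_(i in J1 ij) a i `^ t = 1 ->
  \sum_(l | (ij l).2 == j) a (ij l).1 `^ t <= 1.
Proof.
move=> <-; have -> : \sum_(l | (ij l).2 == j) a (ij l).1 `^ t =
    \sum_(i in [set (ij l).1 | l in [set l | (ij l).2 == j]]%SET) a i `^ t.
  rewrite big_imset /=; first by apply: eq_bigl => l; rewrite inE.
  move=> l m; rewrite !inE => /eqP hl /eqP hm h; apply: ij_inj.
  by move: hl hm h; case: (ij l) (ij m) => [x y] [x' y'] /= -> -> ->.
rewrite [leLHS]big_mkcond [leRHS]big_mkcond /=; apply: ler_sum => i _.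
case: ifP => [/imsetP[l _ ->]|_]; first by rewrite inJ1.
by case: ifP; rewrite ?powR_ge0.
Qed.

(** * Bernoulli weights adapted to the columns *)

Section ColumnWeights.
Variables (t smin : R) (e : 'I_d -> R).
Hypothesis t_eq : \sum_(i in J1 ij) a i `^ t = 1.
Hypothesis e_col : forall l, \sum_(m | (ij m).1 == (ij l).1) b (ij m).2 `^ e m = 1.
Hypothesis e_ge : forall l, smin <= e l.

Definition colw l : R := a (ij l).1 `^ t * b (ij l).2 `^ e l.

Lemma colw_ge0 l : 0 <= colw l.
Proof. by rewrite mulr_ge0 ?powR_ge0. Qed.

Lemma sum_colw_col l : \sum_(m | (ij m).1 == (ij l).1) colw m = a (ij l).1 `^ t.
Proof.
rewrite -[RHS]mulr1 -(e_col l) big_distrr /=; apply: eq_bigr => m /eqP il.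
by rewrite /colw il.
Qed.

Lemma sum_colw : \sum_l colw l = 1.
Proof.
rewrite -t_eq (partition_big (fun l => (ij l).1) (fun i => i \in J1 ij)) //=.
  apply: eq_bigr => i; rewrite inE => /set0Pn[l]; rewrite inE => /eqP <-.
  exact: sum_colw_col.
Qed.

(** A common letter contributes exactly [a^t b^e], a further letter of [u] the column sum [a^t], and
    a further letter of [v] a row sum, at most [b^smin] by [sum_row_le]. The last product records
    the excess [e l - smin] over the common part; the strict bound for the Hausdorff dimension comes
    from it. *)
Lemma mass_colw_le w u v : prefix u (iw w) -> prefix v (jw w) ->
  mass colw u v <= wt a u `^ t * wt b v `^ smin *
    \prod_(l <- take (minn (size u) (size v)) w) b (ij l).2 `^ (e l - smin).
Proof.
have row j : \sum_(l | (ij l).2 == j) colw l <= b j `^ smin.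
  apply: (@le_trans _ _ (\sum_(l | (ij l).2 == j) a (ij l).1 `^ t * b j `^ smin)).
    apply: ler_sum => l /eqP<-; rewrite ler_wpM2l ?powR_ge0 //.
    by apply: powR_le1_mono => //; case/andP: (b01 (ij l).2) => -> /ltW.
  by rewrite -big_distrl /= ler_piMl ?powR_ge0 // sum_row_le.
elim: w u v => [|l w IH] [|i u] [|j v] //=.
- by rewrite big_nil !wt_nil !powR1 !mul1r big_nil.
- by rewrite big_nil !wt_nil !powR1 !mul1r ?take0 big_nil.
- move=> _ _; rewrite wt_nil powR1 mul1r ?min0n big_nil mulr1.
  rewrite /wt powR_prod => [|k]; last exact: ltW.
  apply: ler_prod => k _; rewrite row andbT.
  by apply: sumr_ge0 => m _; apply: colw_ge0.
- move=> /andP[/eqP-> hu] _; rewrite sum_colw_col ?minn0 ?take0 big_nil mulr1.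
  have := IH u [::] hu (prefix0s _); rewrite ?minn0 ?take0 big_nil.
  rewrite !wt_nil !powR1 !mulr1 wt_cons powRM ?(ltW (a_gt0 _)) ?(ltW (wt_gt0 a01 _)) //.
  by move=> h; rewrite ler_wpM2l ?powR_ge0.
- move=> /andP[/eqP-> hu] /andP[/eqP-> hv]; rewrite minnSS /= big_cons.
  rewrite -surjective_pairing sum_letter; have := IH u v hu hv.
  rewrite !wt_cons !powRM ?(ltW (a_gt0 _)) ?(ltW (b_gt0 _)) ?(ltW (wt_gt0 a01 _)) ?(ltW (wt_gt0 b01 _)) // /colw => h.
  have -> : b (ij l).2 `^ e l = b (ij l).2 `^ smin * b (ij l).2 `^ (e l - smin).
    by rewrite -powR_addr // addrC subrK.
  set x := _ `^ t; set y := _ `^ smin; set q := _ `^ (_ - _).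
  apply: (@le_trans _ _ (x * (y * q) * (wt a u `^ t * wt b v `^ smin *
    \prod_(l <- take (minn (size u) (size v)) w) b (ij l).2 `^ (e l - smin)))).
    by rewrite ler_wpM2l // !mulr_ge0 ?powR_ge0.
  by apply: eq_ler; rewrite /x /y /q; ring.
Qed.

(** With [size v <= size u] no row sum occurs, and with constant [e] no excess, so nothing is
    lost. *)
Lemma mass_colw_ge w u v : (forall l, e l = smin) ->
  prefix u (iw w) -> prefix v (jw w) -> (size v <= size u)%N ->
  mass colw u v = wt a u `^ t * wt b v `^ smin.
Proof.
move=> eE; elim: w u v => [|l w IH] [|i u] [|j v] //=.
- by rewrite big_nil !wt_nil !powR1 !mul1r.
- by rewrite big_nil !wt_nil !powR1 !mul1r.
- move=> /andP[/eqP-> hu] _ _; rewrite sum_colw_col (IH u [::]) ?prefix0s //.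
  by rewrite wt_cons powRM ?(ltW (a_gt0 _)) ?(ltW (b_gt0 _)) ?(ltW (wt_gt0 a01 _)) ?(ltW (wt_gt0 b01 _)) // mulrA.
- move=> /andP[/eqP-> hu] /andP[/eqP-> hv] h; rewrite IH //.
  rewrite -surjective_pairing sum_letter.
  by rewrite !wt_cons !powRM ?(ltW (a_gt0 _)) ?(ltW (b_gt0 _)) ?(ltW (wt_gt0 a01 _)) ?(ltW (wt_gt0 b01 _)) // /colw eE; ring.
Qed.

End ColumnWeights.

(** * Kraft inequality for the cells inside a cell *)

Section Kraft.
Variables (t sg : R).
Hypothesis t_eq : \sum_(i in J1 ij) a i `^ t = 1.
Hypothesis sg_le : \sum_l a (ij l).1 `^ t * b (ij l).2 `^ sg <= 1.

Let compat (T : eqType) (x : seq T) (i : T) := if x is i0 :: _ then i == i0 else true.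

(* The cells (u', v') with |v'| <= |u'| of scale (rhoa, rhob) inside the cell
   (u, v): full letters are read until the vertical word stops, then only
   columns are. *)
Fixpoint subcells N rhoa rhob u v : seq (seq 'I_r * seq 'I_s) :=
  if 1 <= rhob then
    if 1 <= rhoa then [:: ([::], [::])] else
    if N is N'.+1 then
      [seq (i :: q.1, q.2) | i <- [seq i <- enum (J1 ij) | compat u i],
         q <- subcells N' (rhoa / a i) rhob (behead u) (behead v)]
    else [::]
  else if 1 <= rhoa then [::] else
    if N is N'.+1 then
      [seq ((ij l).1 :: q.1, (ij l).2 :: q.2) |
         l <- [seq l <- enum 'I_d | compat u (ij l).1 && compat v (ij l).2],
         q <- subcells N' (rhoa / a (ij l).1) (rhob / b (ij l).2) (behead u) (behead v)]
    else [::].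

Lemma subcellsP N rhoa rhob u v q : q \in subcells N rhoa rhob u v ->
  [/\ stopped a rhoa q.1, stopped b rhob q.2,
      prefix u q.1 || prefix q.1 u & prefix v q.2 || prefix q.2 v].
Proof.
elim: N rhoa rhob u v q => [|N IH] rhoa rhob u v q /=;
  case: (leP 1 rhob) => hb; case: (leP 1 rhoa) => ha //.
- by rewrite inE => /eqP-> /=; rewrite !prefix0s !orbT.
- by rewrite inE => /eqP-> /=; rewrite !prefix0s !orbT.
- case/allpairsPdep=> i [q' [+ /IH[h1 h2 h3 h4] ->]] /=.
  rewrite mem_filter => /andP[hc _]; rewrite ha h1 /=; split => //.
    by case: u hc h3 => //= i0 u /eqP->; rewrite eqxx.
  have -> : q'.2 = [::] by case: (q'.2) h2 => //= ? ? /andP[]; rewrite ltNge hb.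
  by rewrite prefix0s orbT.
- case/allpairsPdep=> l [q' [+ /IH[h1 h2 h3 h4] ->]] /=.
  rewrite mem_filter => /andP[/andP[hc hd] _]; rewrite ha hb h1 h2 /=; split => //.
    by case: u hc h3 => //= i0 u /eqP->; rewrite eqxx.
  by case: v hd h4 => //= j0 v /eqP->; rewrite eqxx.
Qed.

Lemma subcells_cover z rhoa rhob u v :
  prefix u (iw z) -> prefix v (jw z) -> wt a (iw z) <= rhoa -> wt b (jw z) <= rhob ->
  (size (cut b rhob (jw z)) <= size (cut a rhoa (iw z)))%N ->
  (cut a rhoa (iw z), cut b rhob (jw z)) \in subcells (size z) rhoa rhob u v.
Proof.
elim: z rhoa rhob u v => [|l z IH] rhoa rhob u v /=.
  by rewrite !wt_nil => _ _ -> ->; rewrite !if_same inE.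
rewrite !wt_cons => hu hv ha hb.
have hu' : prefix (behead u) (iw z) by case: u hu => [|? ?] /=; rewrite ?prefix0s // => /andP[].
have hv' : prefix (behead v) (jw z) by case: v hv => [|? ?] /=; rewrite ?prefix0s // => /andP[].
have hc : compat u (ij l).1 by case: u hu {hu'} => //= ? ? /andP[/eqP->].
have hd : compat v (ij l).2 by case: v hv {hv'} => //= ? ? /andP[/eqP->].
have ha' : wt a (iw z) <= rhoa / a (ij l).1 by rewrite ler_pdivlMr // mulrC.
have hb' : wt b (jw z) <= rhob / b (ij l).2 by rewrite ler_pdivlMr // mulrC.
case: (ltP rhob 1) => rb; case: (ltP rhoa 1) => ra //= sz.
- apply/allpairsPdep; exists l, (cut a (rhoa / a (ij l).1) (iw z), cut b (rhob / b (ij l).2) (jw z)); split => //.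
    by rewrite mem_filter hc hd mem_enum.
  exact: IH.
- have E : cut b rhob (jw z) = [::] by case: (jw z) => /= *; rewrite ltNge rb.
  apply/allpairsPdep; exists (ij l).1, (cut a (rhoa / a (ij l).1) (iw z), [::]); split => //.
    by rewrite mem_filter hc mem_enum inJ1.
  rewrite -E; apply: IH => //; last by rewrite E.
  exact: le_trans (wt_le1 b01 _) rb.
Qed.

(** [drop] makes the weights relative to the cell [(u, v)]. In the induction the first full letter
    is summed according to which given word is exhausted: both, by [sg_le]; only [u], by a row sum
    of [a^t]; only [v], by a column sum of [b^sg], where the second alternative is used; neither,
    because a pair of indices is at most one letter. Once the vertical word has stopped, only
    columns are summed and [t_eq] bounds them. *)
Lemma subcells_kraft N rhoa rhob u v :
  u = [::] \/ (forall i, \sum_(l | (ij l).1 == i) b (ij l).2 `^ sg <= 1) ->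
  \sum_(q <- subcells N rhoa rhob u v)
     wt a (drop (size u) q.1) `^ t * wt b (drop (size v) q.2) `^ sg <= 1.
Proof.
elim: N rhoa rhob u v => [|N IH] rhoa rhob u v hu /=.
  by case: ifP; case: ifP; rewrite ?big_nil ?big_seq1 ?ler01 //= ?wt_nil ?powR1 ?mulr1.
have hu' : behead u = [::] \/ (forall i, \sum_(l | (ij l).1 == i) b (ij l).2 `^ sg <= 1).
  by case: hu => [->|]; [left|right].
case: (leP 1 rhob) => hb; case: (leP 1 rhoa) => ha;
  rewrite ?big_nil ?big_seq1 ?ler01 //= ?wt_nil ?powR1 ?mulr1 //.
- have E0 i q : q \in subcells N (rhoa / a i) rhob (behead u) (behead v) -> q.2 = [::].
    by case/subcellsP => _; case: (q.2) => //= ? ? /andP[]; rewrite ltNge hb.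
  rewrite big_allpairs_dep /=.
  pose f i := if u is [::] then a i `^ t else 1.
  have f0 i : 0 <= f i by rewrite /f; case: (u) => *; rewrite ?powR_ge0 ?ler01.
  apply: (@le_trans _ _ (\sum_(i <- [seq i <- enum (J1 ij) | compat u i]) f i)).
    apply: ler_sum => i _; rewrite -[leRHS]mulr1.
    apply: le_trans (ler_wpM2l (f0 i) (IH (rhoa / a i) rhob _ (behead v) hu')).
    rewrite big_distrr /= big_seq [leRHS]big_seq; apply: ler_sum => q /E0->.
    rewrite /f; case: (u) => [|i0 u0] /=; last by rewrite mul1r.
    by rewrite !drop0 wt_cons powRM ?(ltW (a_gt0 _)) ?(ltW (wt_gt0 a01 _)) // mulrA.
  rewrite big_filter /f; case: (u) => [|i0 u0] /=; first by rewrite big_enum /= t_eq.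
  rewrite big_enum_cond /=.
  apply: (@le_trans _ _ (\sum_(i | i == i0) 1)); last by rewrite big_pred1_eq.
  rewrite [leLHS]big_mkcond [leRHS]big_mkcond; apply: ler_sum => i _.
  by case: (i \in J1 ij); case: (i == i0); rewrite /= ?ler01.
- rewrite big_allpairs_dep /=.
  pose f l := (if u is [::] then a (ij l).1 `^ t else 1) *
              (if v is [::] then b (ij l).2 `^ sg else 1).
  have f0 l : 0 <= f l.
    by rewrite /f mulr_ge0 //; case: (u) (v) => [|? ?] [|? ?]; rewrite ?powR_ge0 ?ler01.
  apply: (@le_trans _ _ (\sum_(l <- [seq l <- enum 'I_d |
        compat u (ij l).1 && compat v (ij l).2]) f l)).
    apply: ler_sum => l _; rewrite -[leRHS]mulr1.
    apply: le_trans (ler_wpM2l (f0 l) (IH (rhoa / a (ij l).1) (rhob / b (ij l).2)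
       _ (behead v) hu')).
    rewrite big_distrr /=; apply: ler_sum => q _.
    rewrite /f; case: (u) (v) => [|i0 u0] [|j0 v0] /=;
      rewrite ?drop0 ?wt_cons ?powRM ?(ltW (a_gt0 _)) ?(ltW (b_gt0 _))
         ?(ltW (wt_gt0 a01 _)) ?(ltW (wt_gt0 b01 _)) // ?mul1r ?mulr1 //.
    - by apply: eq_ler; ring.
    - by rewrite mulrA.
    - by rewrite mulrCA.
  rewrite big_filter big_enum_cond /= /f.
  case: (u) hu => [|i0 u0] hu; case: (v) => [|j0 v0] /=.
  - exact: sg_le.
  - apply: le_trans (sum_row_le j0 t_eq).
    by apply: eq_ler; apply: eq_bigr => l _; rewrite mulr1.
  - case: hu => // /(_ i0); apply: le_trans; apply: eq_ler.
    by apply: eq_big => l; rewrite ?andbT ?mul1r.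
  - apply: le_trans (sum_letter_le1 i0 j0); apply: eq_ler.
    by apply: eq_bigr => l _; rewrite mul1r.
Qed.

Lemma size_subcells N rho rad cm u v :
  u = [::] \/ (forall i, \sum_(l | (ij l).1 == i) b (ij l).2 `^ sg <= 1) ->
  0 <= t -> 0 <= sg -> 0 < cm <= 1 -> (forall i, cm <= a i) -> (forall j, cm <= b j) ->
  0 < rho <= rad -> rho <= 1 -> wt a u <= rad -> wt b v <= rad ->
  (size (subcells N rho rho u v))%:R <= (rad / (cm * rho)) `^ (t + sg).
Proof.
move=> hu t0 sg0 cm01 cma cmb /andP[r0 rR] r1 uR vR.
have /andP[cm0 cm1] := cm01.
have R0 : 0 < rad := lt_le_trans r0 rR.
have x0 : 0 < cm * rho / rad by rewrite divr_gt0 // mulr_gt0.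
have -> : rad / (cm * rho) = (cm * rho / rad)^-1 by rewrite invf_div.
rewrite powR_inv_l ?(ltW x0) // -[leRHS]mul1r ler_pdivlMr ?powR_gt0 //.
apply: le_trans (subcells_kraft N rho rho v hu).
rewrite -sumr_const_seq big_seq [leRHS]big_seq; apply: ler_sum => q /subcellsP[h1 h2 h3 h4].
(* Either [y] extends [x], and the relative weight is a quotient of weights, or [y] ends inside [x],
   and it is 1. *)
have low (T : eqType) (c : T -> R) (x y : seq T) : (forall i, 0 < c i < 1) ->
    (forall i, cm <= c i) -> wt c x <= rad -> stopped c rho y ->
    prefix x y || prefix y x -> cm * rho / rad <= wt c (drop (size x) y).
  move=> c01 hc xR st /orP[/prefixP[y' E]|/prefixP[x' ->]]; last first.
    rewrite drop_oversize; last by rewrite size_cat leq_addr.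
    rewrite wt_nil ler_pdivrMr // mul1r; apply: le_trans rR.
    by rewrite ler_piMl // ltW.
  rewrite E drop_size_cat // ler_pdivrMr //.
  have := stopped_wt_ge c01 cm01 hc r1 st; rewrite E wt_cat => h.
  by apply: le_trans h _; rewrite mulrC ler_wpM2l // ltW // wt_gt0.
rewrite powR_addr // ler_pM ?powR_ge0 //.
- by apply: powR_le_l => //; [exact: ltW | exact: low].
- by apply: powR_le_l => //; [exact: ltW | exact: low].
Qed.

End Kraft.

End Symbolic.

(** * The Euclidean plane *)

Section PlaneMetric.
Context {R : realType}.
Implicit Types (E F : set (R * R)) (p q x y : R * R) (rho rad D : R).

Lemma edist_sym p q : edist p q = edist q p.
Proof. by rewrite /edist -(opprB q.1) -(opprB q.2) !sqrrN. Qed.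

Lemma edist_ge1 p q : `|p.1 - q.1| <= edist p q.
Proof. by rewrite -sqrtr_sqr ler_wsqrtr // lerDl sqr_ge0. Qed.

Lemma edist_ge2 p q : `|p.2 - q.2| <= edist p q.
Proof. by rewrite -sqrtr_sqr ler_wsqrtr // lerDr sqr_ge0. Qed.

Lemma edist_le p q : edist p q <= `|p.1 - q.1| + `|p.2 - q.2|.
Proof.
rewrite -[leRHS]ger0_norm ?addr_ge0 // -sqrtr_sqr ler_wsqrtr //.
rewrite [leRHS]sqrrD !real_normK ?num_real // -addrA lerD2l lerDr.
by rewrite mulrn_wge0 // mulr_ge0.
Qed.

Lemma diam_ge0 E : (0 <= diam E)%E.
Proof. by apply: ereal_sup_ubound; left. Qed.

Lemma diam_ub E x y : E x -> E y -> ((edist x y)%:E <= diam E)%E.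
Proof. by move=> Ex Ey; apply: ereal_sup_ubound; right; exists (x, y). Qed.

Lemma diam_le E D : 0 <= D -> (forall x y, E x -> E y -> edist x y <= D) ->
  (diam E <= D%:E)%E.
Proof.
move=> D0 h; apply/ereal_supP => _ [->|[[x y] /= [Ex Ey] <-]]; rewrite lee_fin //.
exact: h.
Qed.

Lemma covering_number_le rho E n : covers rho E n ->
  (covering_number rho E <= n%:R%:E)%E.
Proof. by move=> h; apply: ereal_inf_lbound; exists n. Qed.

Lemma covering_number_ge rho E D : (forall n, covers rho E n -> D <= n%:R) ->
  (D%:E <= covering_number rho E)%E.
Proof. by move=> h; apply/ereal_infP => _ [n /h hn <-]; rewrite lee_fin. Qed.

Lemma covers_seq (T : eqType) (L : seq T) (f : T -> set (R * R)) rho E :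
  (forall i, i \in L -> (diam (f i) <= rho%:E)%E) ->
  (forall p, E p -> exists2 i, i \in L & f i p) ->
  covers rho E (size L).
Proof.
move=> hd hE; exists (fun i => f (tnth (in_tuple L) i)); split=> [i|p /hE[i iL fi]].
  by apply: hd; exact: mem_tnth.
have h : (index i L < size L)%N by rewrite index_mem.
by exists (Ordinal h) => //=; rewrite (tnth_nth i) /= nth_index.
Qed.

(** Reflection in the diagonal. It preserves the Euclidean distance, hence covering numbers,
    measures and dimensions, and exchanges the roles of columns and rows. *)
Definition swp E : set (R * R) := [set p | E (p.2, p.1)].

Lemma swpK E : swp (swp E) = E.
Proof. by apply/seteqP; split=> [[p q]|[p q]]. Qed.

Lemma edist_swap p q : edist (p.2, p.1) (q.2, q.1) = edist p q.
Proof. by rewrite /edist /= addrC. Qed.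

Lemma diam_swp E : diam (swp E) = diam E.
Proof.
have h F : (diam (swp F) <= diam F)%E.
  apply/ereal_supP => _ [->|[[x y] /= [Ex Ey] <-]]; first exact: diam_ge0.
  by rewrite -edist_swap; apply: diam_ub.
by apply/le_anti; rewrite h /= -{1}(swpK E) h.
Qed.

Lemma covers_swp rho E n : covers rho (swp E) n = covers rho E n.
Proof.
have h F : covers rho F n -> covers rho (swp F) n.
  move=> [U [h1 h2]]; exists (swp \o U); split=> [i|p /h2 [i _ ?]].
    by rewrite /= diam_swp.
  by exists i.
by apply/propext; split=> /h //; rewrite swpK.
Qed.

Lemma covering_number_swp rho E : covering_number rho (swp E) = covering_number rho E.
Proof.
by congr (ereal_inf [set _ | n in _]); apply/funext => n; exact: covers_swp.
Qed.

Lemma eball_swp x rad E :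
  eball x rad `&` swp E = swp (eball (x.2, x.1) rad `&` E).
Proof.
apply/seteqP; split=> p [h1 h2]; split=> //.
  by rewrite /eball /= edist_swap.
by move: h1; rewrite /eball /= (edist_swap x p).
Qed.

Lemma assouad_dim_swp E : assouad_dim (swp E) = assouad_dim E.
Proof.
have h F : (assouad_dim F <= assouad_dim (swp F))%E.
  apply/ereal_infP => _ [al [al0 [C C0 hC]] <-]; apply: ereal_inf_lbound.
  exists al => //; split=> //; exists C => // x rho rad Fx r0 rr rd.
  have := hC (x.2, x.1) rho rad; rewrite eball_swp covering_number_swp diam_swp /=.
  by rewrite -surjective_pairing => -> //; case: x Fx.
by apply/le_anti; rewrite h andbT -{2}(swpK E) h.
Qed.

Lemma lower_dim_swp E : lower_dim (swp E) = lower_dim E.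
Proof.
have h F : (lower_dim (swp F) <= lower_dim F)%E.
  apply/ereal_supP => _ [al [al0 [C C0 hC]] <-]; apply: ereal_sup_ubound.
  exists al => //; split=> //; exists C => // x rho rad Fx r0 rr rd.
  have := hC (x.2, x.1) rho rad; rewrite eball_swp covering_number_swp diam_swp /=.
  by rewrite -surjective_pairing => -> //; case: x Fx.
by apply/le_anti; rewrite h /= -{1}(swpK E) h.
Qed.

Lemma diam_pow_swp t E : diam_pow t (swp E) = diam_pow t E.
Proof.
rewrite /diam_pow diam_swp; suff -> : (swp E == set0) = (E == set0) by [].
apply/eqP/eqP => h; last by rewrite h; apply/seteqP; split.
by rewrite -(swpK E) h; apply/seteqP; split.
Qed.

Lemma hausdorff_measure_swp t E : hausdorff_measure t (swp E) = hausdorff_measure t E.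
Proof.
have h F : (hausdorff_measure t (swp F) <= hausdorff_measure t F)%E.
  apply/ereal_supP => _ [de de0 <-].
  apply: (@le_trans _ _ (hausdorff_content t de F)); last first.
    by apply: ereal_sup_ubound; exists de.
  apply/ereal_infP => _ [U [hU cU] <-]; apply: ereal_inf_lbound.
  exists (swp \o U) => /=.
    by split=> [k|p /cU [k _ ?]]; [rewrite /= diam_swp | exists k].
  by apply: eq_eseriesr => k _ /=; rewrite diam_pow_swp.
by apply/le_anti; rewrite h /= -{1}(swpK E) h.
Qed.

Lemma hausdorff_dim_swp E : hausdorff_dim (swp E) = hausdorff_dim E.
Proof.
by rewrite /hausdorff_dim; congr (ereal_inf [set _ | s in _]); apply/funext => t /=;
  rewrite hausdorff_measure_swp.
Qed.

End PlaneMetric.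

(** * Geometry of the carpet *)

Lemma finite_lower_bound (R : realType) (n : nat) (c : 'I_n -> R) :
  (forall i, 0 < c i < 1) -> exists2 m, 0 < m <= 1 & forall i, m <= c i.
Proof.
move=> c01; exists (\big[Num.min/1]_i c i) => [|i]; last exact: bigmin_le_cond.
apply/andP; split; last exact: bigmin_le_id.
by apply: lt_bigmin => // i _; case/andP: (c01 i).
Qed.

Lemma finite_upper_bound (R : realType) (n : nat) (c : 'I_n -> R) :
  (forall i, 0 < c i < 1) -> exists2 m, 0 <= m < 1 & forall i, c i <= m.
Proof.
move=> c01; exists (\big[Num.max/0]_i c i) => [|i]; last exact: le_bigmax_cond.
apply/andP; split; first exact: bigmax_ge_id.
by apply: bigmax_lt => // i _; case/andP: (c01 i).
Qed.

Section Geometry.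
Context {R : realType} {r s d : nat}.
Variables (a : 'I_r -> R) (b : 'I_s -> R) (ij : 'I_d -> 'I_r * 'I_s).
Variable K : set (R * R).
Implicit Types (u : seq 'I_r) (v : seq 'I_s) (w z : seq 'I_d) (l : 'I_d).
Implicit Types (p q x : R * R) (rho rad : R) (N : nat).

Hypothesis a01 : forall i, 0 < a i < 1.
Hypothesis b01 : forall j, 0 < b j < 1.
Hypothesis a_sum : \sum_(i < r) a i = 1.
Hypothesis b_sum : \sum_(j < s) b j = 1.
Hypothesis ij_inj : injective ij.

Local Notation iw := (iw ij).
Local Notation jw := (jw ij).

Definition psiw w p := foldr (psi a b ij) p w.

Lemma psiw_cat w z p : psiw (w ++ z) p = psiw w (psiw z p).
Proof. by rewrite /psiw foldr_cat. Qed.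

Lemma psiw1 w p : (psiw w p).1 = pos a (iw w) + wt a (iw w) * p.1.
Proof.
elim: w => [|l w IH] /=; first by rewrite wt_nil mul1r add0r.
by rewrite IH wt_cons mulrDr mulrA addrC addrA.
Qed.

Lemma psiw2 w p : (psiw w p).2 = pos b (jw w) + wt b (jw w) * p.2.
Proof.
elim: w => [|l w IH] /=; first by rewrite wt_nil mul1r add0r.
by rewrite IH wt_cons mulrDr mulrA addrC addrA.
Qed.

Definition box u v : set (R * R) := [set p | inside a u p.1 && inside b v p.2].

Lemma box_diam u v rho : wt a u <= rho -> wt b v <= rho ->
  (diam (box u v) <= (2 * rho)%:E)%E.
Proof.
move=> hu hv; have u0 := wt_gt0 a01 u.
apply: diam_le => [|x y /= /andP[/andP[x1 x2] /andP[x3 x4]] /andP[/andP[y1 y2] /andP[y3 y4]]].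
  by lra.
apply: le_trans (edist_le _ _) _; rewrite mulr2n mulrDl mul1r lerD // ler_norml;
  by apply/andP; split; lra.
Qed.

Lemma ratio_bounds : exists2 m, 0 < m <= 1 & (forall i, m <= a i) /\ (forall j, m <= b j).
Proof.
have [m1 /andP[h1 h2] h3] := finite_lower_bound a01.
have [m2 /andP[h4 h5] h6] := finite_lower_bound b01.
exists (Num.min m1 m2); first by rewrite lt_min h1 h4 ge_min h2.
by split=> i; rewrite ge_min; apply/orP; [left|right].
Qed.

Lemma small_words rho : 0 < rho -> exists N0, forall w, (N0 <= size w)%N ->
  wt a (iw w) <= rho /\ wt b (jw w) <= rho.
Proof.
move=> r0; have [m1 /andP[h1 h2] h3] := finite_upper_bound a01.
have [m2 /andP[h4 h5] h6] := finite_upper_bound b01.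
have [|N1 hN1] := @exprn_le_eps _ m1 rho _ r0; first by rewrite h1.
have [|N2 hN2] := @exprn_le_eps _ m2 rho _ r0; first by rewrite h4.
exists (maxn N1 N2) => w; rewrite geq_max => /andP[w1 w2]; split.
- apply: le_trans (wt_le_expr a01 (fun i _ => h3 i)) (le_trans _ hN1).
  by rewrite size_map; apply: ler_wiXn2l => //; apply: ltW.
- apply: le_trans (wt_le_expr b01 (fun i _ => h6 i)) (le_trans _ hN2).
  by rewrite size_map; apply: ler_wiXn2l => //; apply: ltW.
Qed.

(** Each letter contracts heights at least as much as widths, so the vertical word stops first. Two
    thresholds are needed because dividing by [a] and by [b] drives them apart, in the order that
    the induction keeps. *)
Lemma horizontal_cut rho rho' z : (forall l, b (ij l).2 <= a (ij l).1) ->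
  0 < rho <= rho' -> (size (cut b rho' (jw z)) <= size (cut a rho (iw z)))%N.
Proof.
move=> ba; elim: z rho rho' => [|l z IH] rho rho' /andP[r0 rr] /=.
  by rewrite !if_same.
case: (ltP rho' 1) => h //; rewrite (le_lt_trans rr h) /= ltnS IH //.
have [/andP[a0 _] /andP[b0 _]] := (a01 (ij l).1, b01 (ij l).2).
rewrite divr_gt0 //=; apply: ler_pM; rewrite ?invr_ge0 ?(ltW r0) ?(ltW a0) //.
by rewrite lef_pV2 // posrE.
Qed.

Lemma cells_count (L : R) : 0 <= L -> exists M : nat, forall rho x
    (C : seq (seq 'I_r * seq 'I_s)), 0 < rho <= 1 -> uniq C ->
  (forall c, c \in C -> [/\ stopped a rho c.1, stopped b rho c.2 &
     exists p, [/\ box c.1 c.2 p, `|p.1 - x.1| <= L * rho & `|p.2 - x.2| <= L * rho]]) ->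
  (size C <= M)%N.
Proof.
move=> L0; have [cm cm01 [cma cmb]] := ratio_bounds.
(* A cell has sides at most [rho], so its lower left corner is within [(L + 1) * rho] of [x] in each
   coordinate; the count is the product of two one-dimensional counts. *)
pose M1 := (Num.truncn (2 * (L + 1) / cm)).+1; exists (M1 * M1)%N.
move=> rho x C r01 uC hC.
have L1 : 0 <= L + 1 by lra.
have /andP[r0 r1] := r01.
have S1 : (size (undup (unzip1 C)) <= M1)%N.
  apply: (@stopped_count _ _ a a01 a_sum cm (L + 1) rho x.1 _ cm01 cma r01 L1 (undup_uniq _)).
  move=> u; rewrite mem_undup => /mapP[c /hC[h1 h2 [p [/andP[/andP[b1 b2] _] p1 _]]] ->].
  split=> //; move: p1; have := stopped_wt a01 h1.
  by rewrite !ler_norml => ? /andP[? ?]; apply/andP; split; lra.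
have S2 : (size (undup (unzip2 C)) <= M1)%N.
  apply: (@stopped_count _ _ b b01 b_sum cm (L + 1) rho x.2 _ cm01 cmb r01 L1 (undup_uniq _)).
  move=> u; rewrite mem_undup => /mapP[c /hC[h1 h2 [p [/andP[_ /andP[b1 b2]] _ p1]]] ->].
  split=> //; move: p1; have := stopped_wt b01 h2.
  by rewrite !ler_norml => ? /andP[? ?]; apply/andP; split; lra.
apply: leq_trans (leq_mul S1 S2); rewrite -(size_allpairs pair); apply: uniq_leq_size => //.
move=> [u v] uv; apply/allpairsP; exists (u, v); split=> //=.
  by rewrite mem_undup; apply/mapP; exists (u, v).
by rewrite mem_undup; apply/mapP; exists (u, v).
Qed.

Hypothesis attrK : attractor a b ij K.

Let K0 : K !=set0. Proof. by case: attrK. Qed.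
Let cptK : compact K. Proof. by case: attrK. Qed.
Let selfK : K = \bigcup_l (psi a b ij l @` K). Proof. by case: attrK. Qed.

Lemma psi_K l p : K p -> K (psi a b ij l p).
Proof. by move=> Kp; rewrite selfK; exists l => //; exists p. Qed.

Lemma psiw_K w p : K p -> K (psiw w p).
Proof. by move=> Kp; elim: w => //= l w; exact: psi_K. Qed.

Lemma K_code p N : K p -> exists2 z, size z = N & exists2 q, K q & p = psiw z q.
Proof.
elim: N p => [|N IH] p Kp; first by exists [::] => //; exists p.
move: (Kp); rewrite {1}selfK => -[l _ [q /IH[z sz [q' Kq' ->]] <-]].
by exists (l :: z); rewrite /= ?sz //; exists q'.
Qed.

Lemma K_bounded : exists2 M, 0 <= M & forall p, K p -> `|p.1| <= M /\ `|p.2| <= M.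
Proof.
have [M [_ hM]] := compact_bounded cptK.
have h := hM (`|M| + 1); exists (`|M| + 1); first by rewrite addr_ge0.
move=> p Kp; have : `|p| <= `|M| + 1.
  by apply: h => //; apply: le_lt_trans (ler_norm M) _; rewrite ltrDl.
by rewrite prod_normE ge_max => /andP[].
Qed.

(** The attractor is only known to be compact. Writing a point as [psiw z q] with [z] long, its
    distance from the square is at most a tiny contraction times the bound [M] for [K]. *)
Lemma K_unit p : K p -> (0 <= p.1 <= 1) /\ (0 <= p.2 <= 1).
Proof.
have [M M0 hM] := K_bounded.
have key e : 0 < e -> K p -> [/\ - e <= p.1, p.1 <= 1 + e, - e <= p.2 & p.2 <= 1 + e].
  move=> e0 Kp; have M10 : 0 < M + 1 by lra.
  have [N0 hN] := @small_words (e / (M + 1)) (divr_gt0 e0 M10).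
  have [z sz [q /hM[q1 q2] ->]] := K_code N0 Kp.
  have [|wa wb] := hN z; first by rewrite sz.
  rewrite psiw1 psiw2.
  have B (T : eqType) (c : T -> R) (u : seq T) (y : R) : (forall i, 0 < c i < 1) ->
      wt c u <= e / (M + 1) -> `|y| <= M -> `|wt c u * y| <= e.
    move=> c01 h hy; rewrite normrM gtr0_norm ?wt_gt0 //.
    apply: (@le_trans _ _ (e / (M + 1) * (M + 1))); last by rewrite divfK ?gt_eqF.
    by rewrite ler_pM ?(ltW (wt_gt0 c01 _)) //; lra.
  have := B _ _ _ _ a01 wa q1; have := B _ _ _ _ b01 wb q2.
  have := pos_ge0 a01 (iw z); have := pos_le1 a01 a_sum (iw z).
  have := pos_ge0 b01 (jw z); have := pos_le1 b01 b_sum (jw z).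
  have := wt_gt0 a01 (iw z); have := wt_gt0 b01 (jw z).
  rewrite !ler_norml => ? ? ? ? ? ? /andP[? ?] /andP[? ?].
  by split; lra.
move=> Kp; split; apply/andP; split; apply/ler_addgt0Pr => e e0;
  by have [] := key e e0 Kp; lra.
Qed.

Lemma box_psiw w q : K q -> box (iw w) (jw w) (psiw w q).
Proof.
move=> /K_unit[q1 q2]; apply/andP; rewrite psiw1 psiw2.
by split; [exact: (inside_pos a01) | exact: (inside_pos b01)].
Qed.

Lemma box_prefix u v w q : K q -> prefix u (iw w) -> prefix v (jw w) ->
  box u v (psiw w q).
Proof.
move=> Kq hu hv; have /andP[h1 h2] := box_psiw w Kq; apply/andP; split.
- exact: (inside_prefix a01 a_sum hu).
- exact: (inside_prefix b01 b_sum hv).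
Qed.

Lemma diam_K : (diam K <= 2%:E)%E.
Proof.
apply: diam_le => // x y /K_unit[/andP[? ?] /andP[? ?]] /K_unit[/andP[? ?] /andP[? ?]].
apply: le_trans (edist_le _ _) _; rewrite -[2]/(1 + 1) lerD // ler_norml;
  by apply/andP; split; lra.
Qed.

Lemma covers_cells : exists2 M : nat, (0 < M)%N & forall rho (E : set (R * R)) n
    (C : seq (seq 'I_r * seq 'I_s)), 0 < rho <= 1 -> uniq C ->
  (forall c, c \in C -> [/\ stopped a rho c.1, stopped b rho c.2 &
     exists2 p, E p & box c.1 c.2 p]) ->
  covers rho E n -> (size C <= n * M)%N.
Proof.
have [M hM] := cells_count ler01; exists M.+1 => // rho E n C r01 uC hC [U [hU EU]].
have H c : c \in C -> exists i, exists2 p, U i p & box c.1 c.2 p.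
  by case/hC => _ _ [p /EU[i _ Ui] bp]; exists i, p.
(* The values lie in ['I_n.+1], not ['I_n], because a default is needed for [c] outside [C], even
   when [n = 0]. *)
have /choice[f hf] : forall c, exists k : 'I_n.+1, c \in C ->
    exists i : 'I_n, val i = val k /\ exists2 p, U i p & box c.1 c.2 p.
  move=> c; case: (boolP (c \in C)) => cC; last by exists ord0.
  by have [i hi] := H c cC; exists (widen_ord (leqnSn n) i) => _; exists i.
have -> : size C = (\sum_(i < n) size [seq c <- C | val (f c) == val i])%N.
  transitivity (\sum_(c <- C) \sum_(i < n | val (f c) == val i) 1)%N.
    rewrite -sum1_size big_seq [RHS]big_seq; apply: eq_bigr => c /hf[i [E1 _]].
    rewrite -E1 (eq_bigl (fun k => k == i)) ?big_pred1_eq // => k.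
    by rewrite eq_sym.
  rewrite (exchange_big_dep xpredT) //=; apply: eq_bigr => i _.
  by rewrite size_filter -sum1_count.
rewrite -[n in leqRHS]card_ord -sum_nat_const; apply: leq_sum => i _.
set Ci := [seq _ <- _ | _].
have hCi c : c \in Ci -> c \in C /\ exists2 p, U i p & box c.1 c.2 p.
  rewrite mem_filter => /andP[/eqP fi cC]; split => //.
  have [k [E1 h]] := hf c cC; have -> : i = k by apply: val_inj; rewrite /= E1 fi.
  by [].
apply: leq_trans (leqnSn M).
case EC : Ci => [|c0 C'] //; rewrite -EC.
have [|_ [x Ux _]] := hCi c0; first by rewrite EC mem_head.
apply: (hM rho x) => //; first exact: filter_uniq.
move=> c /hCi[/hC[h1 h2 _] [p Up bp]]; split=> //; exists p; split=> //.
  rewrite mul1r; apply: le_trans (edist_ge1 p x) _.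
  by rewrite -lee_fin; apply: le_trans (diam_ub Up Ux) (hU i).
rewrite mul1r; apply: le_trans (edist_ge2 p x) _.
by rewrite -lee_fin; apply: le_trans (diam_ub Up Ux) (hU i).
Qed.

End Geometry.

(** * Covers by cells *)

Definition swap_ij (r s d : nat) (ij : 'I_d -> 'I_r * 'I_s) (l : 'I_d) : 'I_s * 'I_r :=
  ((ij l).2, (ij l).1).

Lemma swap_ij_inj (r s d : nat) (ij : 'I_d -> 'I_r * 'I_s) :
  injective ij -> injective (swap_ij ij).
Proof.
by move=> h l m; rewrite /swap_ij => -[E1 E2]; apply: h; move: E1 E2; case: (ij l) (ij m) => [? ?] [? ?] /= -> ->.
Qed.

Section Covers.
Context {R : realType} {r s d : nat}.

Definition moran1 (a : 'I_r -> R) (ij : 'I_d -> 'I_r * 'I_s) t :=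
  0 <= t /\ \sum_(i in J1 ij) a i `^ t = 1.

(** Exponents for which the Kraft inequality counts the cells of the whole carpet; [local_exponent]
    counts them inside any cell. Asking only [t + sg <= al] makes both upward closed. *)
Definition global_exponent (a : 'I_r -> R) (b : 'I_s -> R) (ij : 'I_d -> 'I_r * 'I_s) al :=
  exists t sg, [/\ moran1 a ij t, 0 <= sg, t + sg <= al &
    \sum_l a (ij l).1 `^ t * b (ij l).2 `^ sg <= 1].

Definition local_exponent (a : 'I_r -> R) (b : 'I_s -> R) (ij : 'I_d -> 'I_r * 'I_s) al :=
  exists t sg, [/\ moran1 a ij t, 0 <= sg, t + sg <= al &
    forall i, \sum_(l | (ij l).1 == i) b (ij l).2 `^ sg <= 1].

Lemma column_sum_le (a : 'I_r -> R) (b : 'I_s -> R) (ij : 'I_d -> 'I_r * 'I_s) t sg : moran1 a ij t ->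
  (forall i, \sum_(l | (ij l).1 == i) b (ij l).2 `^ sg <= 1) ->
  \sum_l a (ij l).1 `^ t * b (ij l).2 `^ sg <= 1.
Proof.
case=> _ tE h; rewrite -tE (partition_big (fun l => (ij l).1) (fun i => i \in J1 ij)) /=.
  apply: ler_sum => i _; rewrite (eq_bigr (fun l => a i `^ t * b (ij l).2 `^ sg)).
    by rewrite -big_distrr /= ler_piMr ?powR_ge0.
  by move=> l /eqP->.
by move=> l _; rewrite inE; apply/set0Pn; exists l; rewrite inE.
Qed.

Lemma local_global a b ij al : local_exponent a b ij al -> global_exponent a b ij al.
Proof.
by case=> t [sg [tE sg0 tal h]]; exists t, sg; split=> //; exact: column_sum_le.
Qed.

End Covers.

Section CellCovers.
Context {R : realType} {r s d : nat}.
Variables (a : 'I_r -> R) (b : 'I_s -> R) (ij : 'I_d -> 'I_r * 'I_s).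
Implicit Types (u : seq 'I_r) (v : seq 'I_s) (w z : seq 'I_d) (l : 'I_d).

Hypothesis a01 : forall i, 0 < a i < 1.
Hypothesis b01 : forall j, 0 < b j < 1.
Hypothesis ij_inj : injective ij.

Lemma half_cell_cover u v al rho rad cm N :
  global_exponent a b ij al -> u = [::] \/ local_exponent a b ij al ->
  0 < cm <= 1 -> (forall i, cm <= a i) -> (forall j, cm <= b j) ->
  0 < rho <= rad -> rho <= 1 -> wt a u <= rad -> wt b v <= rad ->
  exists C : seq (seq 'I_r * seq 'I_s), [/\ (size C)%:R <= (rad / (cm * rho)) `^ al,
    forall c, c \in C -> wt a c.1 <= rho /\ wt b c.2 <= rho &
    forall z, size z = N -> wt a (iw ij z) <= rho -> wt b (jw ij z) <= rho ->
      prefix u (iw ij z) -> prefix v (jw ij z) ->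
      (size (cut b rho (jw ij z)) <= size (cut a rho (iw ij z)))%N ->
      (cut a rho (iw ij z), cut b rho (jw ij z)) \in C].
Proof.
move=> hg hl cm01 cma cmb rr r1 uR vR.
have /andP[r0 rR] := rr; have /andP[cm0 cm1] := cm01.
have [t [sg [[t0 tE] sg0 tal sgE hu]]] : exists t sg, [/\ moran1 a ij t, 0 <= sg,
    t + sg <= al, \sum_l a (ij l).1 `^ t * b (ij l).2 `^ sg <= 1 &
    u = [::] \/ forall i, \sum_(l | (ij l).1 == i) b (ij l).2 `^ sg <= 1].
  case: hl => [u0|hl].
    by case: hg => t [sg [h1 h2 h3 h4]]; exists t, sg; split=> //; left.
  have [t [sg [h1 h2 h3 h4]]] := hl; exists t, sg; split=> //; last by right.
  exact: column_sum_le.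
exists (subcells a b ij N rho rho u v); split.
- apply: le_trans (size_subcells a01 b01 ij_inj tE sgE N hu t0 sg0 cm01 cma cmb rr r1 uR vR) _.
  apply: ler_powR => //; rewrite ler_pdivlMr ?mulr_gt0 // mul1r.
  by apply: le_trans rR; rewrite ler_piMl // ltW.
- by move=> c /(subcellsP)[h1 h2 _ _]; split; [exact: (stopped_wt a01 h1)|exact: (stopped_wt b01 h2)].
- by move=> z <- wa wb hua hvb sz; apply: (subcells_cover a01 b01).
Qed.

End CellCovers.

Section CarpetCovers.
Context {R : realType} {r s d : nat}.
Variables (a : 'I_r -> R) (b : 'I_s -> R) (ij : 'I_d -> 'I_r * 'I_s).
Variable K : set (R * R).
Implicit Types (u : seq 'I_r) (v : seq 'I_s) (w z : seq 'I_d) (l : 'I_d).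

Hypothesis a01 : forall i, 0 < a i < 1.
Hypothesis b01 : forall j, 0 < b j < 1.
Hypothesis a_sum : \sum_(i < r) a i = 1.
Hypothesis b_sum : \sum_(j < s) b j = 1.
Hypothesis ij_inj : injective ij.
Hypothesis ab_neq : exists l, a (ij l).1 <> b (ij l).2.

Local Notation ji := (swap_ij ij).

(** Two lists are joined, according to which of the stopped words is longer. In vertical type the
    horizontal word never is, so the first list may be empty, and symmetrically. [ab_neq] excludes a
    carpet of both types, for which both lists would be empty. *)
Lemma cell_cover u v al rho rad cm N :
  vertical_type a b ij \/ (global_exponent a b ij al /\
     (u = [::] \/ local_exponent a b ij al)) ->
  horizontal_type a b ij \/ (global_exponent b a ji al /\
     (v = [::] \/ local_exponent b a ji al)) ->
  0 < cm <= 1 -> (forall i, cm <= a i) -> (forall j, cm <= b j) ->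
  0 < rho <= rad -> rho <= 1 -> wt a u <= rad -> wt b v <= rad ->
  exists C : seq (seq 'I_r * seq 'I_s), [/\ (size C)%:R <= 2 * (rad / (cm * rho)) `^ al,
    forall c, c \in C -> wt a c.1 <= rho /\ wt b c.2 <= rho &
    forall z, size z = N -> wt a (iw ij z) <= rho -> wt b (jw ij z) <= rho ->
      prefix u (iw ij z) -> prefix v (jw ij z) ->
      (cut a rho (iw ij z), cut b rho (jw ij z)) \in C].
Proof.
move=> H1 H2 cm01 cma cmb rr r1 uR vR; have /andP[r0 rR] := rr.
have [C1 [S1 W1 P1]] : exists C : seq (seq 'I_r * seq 'I_s),
    [/\ (size C)%:R <= (rad / (cm * rho)) `^ al,
    forall c, c \in C -> wt a c.1 <= rho /\ wt b c.2 <= rho &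
    forall z, size z = N -> wt a (iw ij z) <= rho -> wt b (jw ij z) <= rho ->
      prefix u (iw ij z) -> prefix v (jw ij z) -> ~~ vertical_type a b ij ->
      (size (cut b rho (jw ij z)) <= size (cut a rho (iw ij z)))%N ->
      (cut a rho (iw ij z), cut b rho (jw ij z)) \in C].
  case: H1 => [H1|[H1 H1']]; first by exists [::]; rewrite H1; split; rewrite ?powR_ge0.
  have [C [h1 h2 h3]] := half_cell_cover a01 b01 ij_inj N H1 H1' cm01 cma cmb rr r1 uR vR.
  by exists C; split=> // z *; exact: h3.
have [C2 [S2 W2 P2]] : exists C : seq (seq 'I_r * seq 'I_s),
    [/\ (size C)%:R <= (rad / (cm * rho)) `^ al,
    forall c, c \in C -> wt a c.1 <= rho /\ wt b c.2 <= rho &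
    forall z, size z = N -> wt a (iw ij z) <= rho -> wt b (jw ij z) <= rho ->
      prefix u (iw ij z) -> prefix v (jw ij z) -> ~~ horizontal_type a b ij ->
      (size (cut a rho (iw ij z)) <= size (cut b rho (jw ij z)))%N ->
      (cut a rho (iw ij z), cut b rho (jw ij z)) \in C].
  case: H2 => [H2|[H2 H2']]; first by exists [::]; rewrite H2; split; rewrite ?powR_ge0.
  have [C [h1 h2 h3]] := half_cell_cover b01 a01 (swap_ij_inj ij_inj) N H2 H2' cm01 cmb cma rr r1 vR uR.
  exists [seq (c.2, c.1) | c <- C]; split=> [|c /mapP[c' /h2[? ?] ->] //|z sz wa wb hu hv _ hs].
    by rewrite size_map.
  by apply/mapP; exists (cut b rho (jw ij z), cut a rho (iw ij z)) => //; exact: h3.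
exists (C1 ++ C2); split.
- by rewrite size_cat natrD mulrDl mul1r lerD.
- by move=> c; rewrite mem_cat => /orP[/W1|/W2].
- move=> z sz wa wb hu hv; rewrite mem_cat.
  have r0' : 0 < rho <= rho by rewrite r0 lexx.
  case: (boolP (horizontal_type a b ij)) => [hor|hor].
    have ver : ~~ vertical_type a b ij.
      apply/negP => /forallP ver; case: ab_neq => l; apply; apply/le_anti.
      by rewrite ver (forallP hor l).
    by rewrite P1 // (horizontal_cut a01 b01 z (forallP hor) r0').
  case: (boolP (vertical_type a b ij)) => [ver|ver].
    by rewrite P2 ?orbT // (@horizontal_cut _ _ _ _ b a ji b01 a01 rho rho z (forallP ver) r0').
  by case: (leqP (size (cut b rho (jw ij z))) (size (cut a rho (iw ij z)))) => [le|/ltnW le];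
    [rewrite P1|rewrite P2 ?orbT].
Qed.

Hypothesis attrK : attractor a b ij K.

Lemma box_covers al :
  vertical_type a b ij \/ global_exponent a b ij al ->
  horizontal_type a b ij \/ global_exponent b a ji al ->
  exists2 C : R, 0 < C & forall rho, 0 < rho <= 1 ->
    exists2 n, covers rho K n & n%:R <= C * rho `^ (- al).
Proof.
move=> H1 H2; have [cm cm01 [cma cmb]] := ratio_bounds a01 b01.
have /andP[cm0 cm1] := cm01.
exists (2 * (2 / cm) `^ al) => [|rho /andP[r0 r1]].
  by rewrite mulr_gt0 ?powR_gt0 ?divr_gt0.
(* A cell with both sides at most [rho / 2] has diameter at most [rho]. *)
have r2 : 0 < rho / 2 <= 1 by apply/andP; split; lra.
have /andP[r20 r21] := r2.
have [N hN] := small_words ij a01 b01 r20.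
have [C [SC WC PC]] : exists C : seq (seq 'I_r * seq 'I_s),
    [/\ (size C)%:R <= 2 * (1 / (cm * (rho / 2))) `^ al,
    forall c, c \in C -> wt a c.1 <= rho / 2 /\ wt b c.2 <= rho / 2 &
    forall z, size z = N -> wt a (iw ij z) <= rho / 2 -> wt b (jw ij z) <= rho / 2 ->
      prefix [::] (iw ij z) -> prefix [::] (jw ij z) ->
      (cut a (rho / 2) (iw ij z), cut b (rho / 2) (jw ij z)) \in C].
  apply: cell_cover => //; rewrite ?wt_nil //.
  - by case: H1 => [|H1]; [left|right; split=> //; left].
  - by case: H2 => [|H2]; [left|right; split=> //; left].
exists (size C); last first.
  apply: le_trans SC _; rewrite -mulrA ler_pM2l // powRN -powR_inv_l ?(ltW r0) //.
  rewrite -powRM ?invr_ge0 ?divr_ge0 ?(ltW r0) ?(ltW cm0) //.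
  by apply: eq_ler; congr (_ `^ _); field; rewrite !gt_eqF.
apply: (covers_seq (f := fun c => box a b c.1 c.2)) => [c /WC[wa wb]|p Kp].
  have -> : rho = 2 * (rho / 2) by field.
  exact: box_diam.
have [z sz [q Kq ->]] := K_code attrK N Kp.
have [|wa wb] := hN z; first by rewrite sz.
exists (cut a (rho / 2) (iw ij z), cut b (rho / 2) (jw ij z)).
  by apply: PC; rewrite ?prefix0s.
by apply: (box_prefix a01 b01 a_sum b_sum attrK Kq); apply: cut_prefix.
Qed.

Lemma ball_covers al :
  vertical_type a b ij \/ local_exponent a b ij al ->
  horizontal_type a b ij \/ local_exponent b a ji al ->
  exists2 C : R, 0 < C & forall x rho rad, 0 < rho -> rho < rad -> rad <= 2 ->
    exists2 n, covers rho (eball x rad `&` K) n & n%:R <= C * (rad / rho) `^ al.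
Proof.
move=> H1 H2; have [cm cm01 [cma cmb]] := ratio_bounds a01 b01.
have /andP[cm0 cm1] := cm01.
have [M hM] := cells_count a01 b01 a_sum b_sum (ler0n R 2).
exists ((M.+1)%:R * (2 * (cm^-1) `^ al)) => [|x rho rad r0 rR R2].
  by rewrite !mulr_gt0 ?powR_gt0 ?invr_gt0 ?ltr0n.
have r2 : 0 < rho / 2 <= rad / 2 by apply/andP; split; lra.
have R01 : 0 < rad / 2 <= 1 by apply/andP; split; lra.
have r1 : rho / 2 <= 1 by lra.
have /andP[r20 rR2] := r2.
have [N hN] := small_words ij a01 b01 r20.
pose good z := `[< exists2 q, K q & eball x rad (psiw a b ij z q) >].
pose cell z := (cut a (rad / 2) (iw ij z), cut b (rad / 2) (jw ij z)).
(* The cells of scale [rad / 2] containing a coded point of the ball: at most [M] of them, each of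
   which is then subdivided down to scale [rho / 2]. *)
pose Q := undup [seq cell z | z <- words N & good z].
have hQ c : c \in Q -> [/\ stopped a (rad / 2) c.1, stopped b (rad / 2) c.2 &
     exists p, [/\ box a b c.1 c.2 p, `|p.1 - x.1| <= 2 * (rad / 2)
                  & `|p.2 - x.2| <= 2 * (rad / 2)]].
  rewrite mem_undup => /mapP[z]; rewrite mem_filter mem_words => /andP[/asboolP gz /eqP sz] ->.
  have [|wa wb] := hN z; first by rewrite sz.
  have [q Kq bq] := gz.
  split; try by apply: cut_stopped; rewrite ?(le_trans wa) ?(le_trans wb).
  exists (psiw a b ij z q); split.
  - by apply: (box_prefix a01 b01 a_sum b_sum attrK Kq); apply: cut_prefix.
  - rewrite mulrC divfK //; apply: le_trans bq; rewrite edist_sym; exact: edist_ge1.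
  - rewrite mulrC divfK //; apply: le_trans bq; rewrite edist_sym; exact: edist_ge2.
have sQ : (size Q <= M)%N by apply: (hM (rad / 2) x) => //; apply: undup_uniq.
have /choice[F hF] : forall c, exists C : seq (seq 'I_r * seq 'I_s), c \in Q ->
    [/\ (size C)%:R <= 2 * (rad / 2 / (cm * (rho / 2))) `^ al,
    forall c, c \in C -> wt a c.1 <= rho / 2 /\ wt b c.2 <= rho / 2 &
    forall z, size z = N -> wt a (iw ij z) <= rho / 2 -> wt b (jw ij z) <= rho / 2 ->
      prefix c.1 (iw ij z) -> prefix c.2 (jw ij z) ->
      (cut a (rho / 2) (iw ij z), cut b (rho / 2) (jw ij z)) \in C].
  move=> c; case: (boolP (c \in Q)) => cQ; last by exists [::].
  have [s1 s2 _] := hQ c cQ.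
  have [||C hC] := @cell_cover c.1 c.2 al (rho / 2) (rad / 2) cm N _ _ cm01 cma cmb r2 r1
    (stopped_wt a01 s1) (stopped_wt b01 s2); last by exists C.
  - by case: H1 => [|H1]; [left|right; split; [exact: local_global|right]].
  - by case: H2 => [|H2]; [left|right; split; [exact: local_global|right]].
exists (size (flatten [seq F c | c <- Q])); last first.
  rewrite size_flatten sumnE !big_map natr_sum.
  apply: (@le_trans _ _ (\sum_(c <- Q) (2 * (rad / 2 / (cm * (rho / 2))) `^ al))).
    by rewrite big_seq [leRHS]big_seq; apply: ler_sum => c /hF[].
  have rad0 : 0 < rad by apply: lt_trans rR.
  rewrite sumr_const_seq -!mulrA; apply: ler_pM => //.
  - by rewrite mulr_ge0 ?powR_ge0.
  - by rewrite ler_nat (leq_trans sQ).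
  rewrite ler_pM2l // -powRM ?invr_ge0 ?divr_ge0 ?(ltW r0) ?(ltW rad0) ?(ltW cm0) //.
  by apply: eq_ler; congr (_ `^ _); field; rewrite !gt_eqF.
apply: (covers_seq (f := fun c => box a b c.1 c.2)) => [c /flatten_mapP[c0 /hF[_ W _] /W[wa wb]]|p [bp Kp]].
  have -> : rho = 2 * (rho / 2) by field.
  exact: box_diam.
have [z sz [q Kq Ep]] := K_code attrK N Kp.
have [|wa wb] := hN z; first by rewrite sz.
exists (cut a (rho / 2) (iw ij z), cut b (rho / 2) (jw ij z)); last first.
  by rewrite Ep; apply: (box_prefix a01 b01 a_sum b_sum attrK Kq); apply: cut_prefix.
have zQ : cell z \in Q.
  rewrite mem_undup; apply: map_f; rewrite mem_filter mem_words sz eqxx andbT.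
  by apply/asboolP; exists q; rewrite -?Ep.
apply/flatten_mapP; exists (cell z) => //.
by have [_ _ W] := hF _ zQ; apply: W => //; apply: cut_prefix.
Qed.

End CarpetCovers.

(** * Mass distribution *)

Section Content.
Context {R : realType}.
Implicit Types (U : set (R * R)).

Lemma diam_pow_ge0 h U : (0 <= diam_pow h U)%E.
Proof. by rewrite /diam_pow; case: ifP => // _; exact: poweR_ge0. Qed.

Lemma diam_fin_num U (D : R) : (diam U <= D%:E)%E -> (diam U = (fine (diam U))%:E)%E.
Proof.
move=> h; rewrite fineK // fin_numE; apply/andP; split.
  by rewrite -ltNye; apply: lt_le_trans (diam_ge0 U).
by rewrite -ltey; apply: le_lt_trans h _; rewrite ltry.
Qed.

Lemma diam_powE h U (D : R) : (diam U <= D%:E)%E -> U !=set0 ->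
  diam_pow h U = ((fine (diam U)) `^ h)%:E.
Proof.
move=> hD /set0P U0; rewrite /diam_pow (negPf U0) (diam_fin_num hD).
by rewrite poweR_EFin.
Qed.

Lemma sum_half_powers (e : R) n : 0 <= e -> \sum_(k < n) e / 2 ^+ k.+1 <= e.
Proof.
move=> e0; suff -> : \sum_(k < n) e / 2 ^+ k.+1 = e - e / 2 ^+ n.
  by rewrite gerBl divr_ge0 // exprn_ge0.
elim: n => [|n IH]; first by rewrite big_ord0 expr0 divr1 subrr.
by rewrite big_ord_recr /= IH exprS; field; rewrite expf_neq0.
Qed.

End Content.

Section MassDistribution.
Context {R : realType} {r s d : nat}.
Variables (a : 'I_r -> R) (b : 'I_s -> R) (ij : 'I_d -> 'I_r * 'I_s).
Variable K : set (R * R).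

Hypothesis a01 : forall i, 0 < a i < 1.
Hypothesis b01 : forall j, 0 < b j < 1.
Hypothesis a_sum : \sum_(i < r) a i = 1.
Hypothesis b_sum : \sum_(j < s) b j = 1.
Hypothesis attrK : attractor a b ij K.

(** The words are grouped by their cell of scale [rho]. At most [M] cells come near [x0], and the
    mass of each is bounded through one good word lying in it. *)
Lemma mass_near (M : nat) (p : 'I_d -> R) (good : pred (seq 'I_d)) N (C h rho : R)
    (V : set (R * R)) (q0 x0 : R * R) :
  (forall rho x (C : seq (seq 'I_r * seq 'I_s)), 0 < rho <= 1 -> uniq C ->
   (forall c, c \in C -> [/\ stopped a rho c.1, stopped b rho c.2 &
     exists p, [/\ box a b c.1 c.2 p, `|p.1 - x.1| <= 3 * rho & `|p.2 - x.2| <= 3 * rho]]) ->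
   (size C <= M)%N) ->
  K q0 -> (forall l, 0 <= p l) -> \sum_l p l = 1 -> 0 <= C -> 0 < rho <= 1 ->
  (forall y, V y -> `|y.1 - x0.1| <= 3 * rho /\ `|y.2 - x0.2| <= 3 * rho) ->
  (forall w, size w = N -> wt a (iw ij w) <= rho /\ wt b (jw ij w) <= rho) ->
  (forall w, size w = N -> good w ->
     mass ij p (cut a rho (iw ij w)) (cut b rho (jw ij w)) <= C * rho `^ h) ->
  \sum_(w <- words N | good w && `[< V (psiw a b ij w q0) >]) wt p w <= M%:R * (C * rho `^ h).
Proof.
move=> hM Kq p0 p1 C0 r01 hV hN hg.
pose G w := good w && `[< V (psiw a b ij w q0) >].
pose cell w := (cut a rho (iw ij w), cut b rho (jw ij w)).
pose Q := undup [seq cell w | w <- words N & G w].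
have wp0 w : 0 <= wt p w by apply: prodr_ge0.
have memQ w : size w = N -> G w -> cell w \in Q.
  by move=> sw Gw; rewrite mem_undup map_f // mem_filter Gw mem_words sw eqxx.
have hQ c : c \in Q -> exists w, [/\ size w = N, G w & c = cell w].
  rewrite mem_undup => /mapP[w]; rewrite mem_filter mem_words => /andP[Gw /eqP sw] ->.
  by exists w.
apply: (@le_trans _ _ (\sum_(c <- Q) \sum_(w <- words N | G w && (cell w == c)) wt p w)).
  rewrite (exchange_big_dep G) /=; last by move=> c w _ /andP[].
  rewrite big_seq_cond [leRHS]big_seq_cond; apply: ler_sum => w /andP[].
  rewrite mem_words => /eqP sw; rewrite -/(G w) => Gw.
  rewrite (big_rem (cell w)) ?memQ //= Gw eqxx lerDl.
  exact: sumr_ge0.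
apply: (@le_trans _ _ (\sum_(c <- Q) C * rho `^ h)); last first.
  rewrite sumr_const_seq ler_wpM2r ?mulr_ge0 ?powR_ge0 // ler_nat.
  apply: (hM rho x0) => // [|c /hQ[w [sw /andP[gw /asboolP Vw] ->]]]; first exact: undup_uniq.
  have [wa wb] := hN w sw.
  split; [exact: cut_stopped|exact: cut_stopped|].
  have [y1 y2] := hV _ Vw; exists (psiw a b ij w q0); split=> //.
  by apply: (box_prefix a01 b01 a_sum b_sum attrK Kq); apply: cut_prefix.
rewrite big_seq [leRHS]big_seq; apply: ler_sum => c /hQ[w0 [sw0 /andP[gw0 _] ->]].
apply: le_trans (hg w0 sw0 gw0).
rewrite -(@mass_sum _ _ _ _ ij p N) //.
- rewrite [leLHS]big_mkcond [leRHS]big_mkcond /=; apply: ler_sum => w _.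
  case: ifP => [/andP[_ /eqP cw]|_]; last by case: ifP.
  by move: cw => [<- <-]; rewrite !cut_prefix.
- by rewrite -sw0 -(size_map (fun l => (ij l).1) w0); apply/size_prefix/cut_prefix.
- by rewrite -sw0 -(size_map (fun l => (ij l).2) w0); apply/size_prefix/cut_prefix.
Qed.

(** A countable cover is thickened to an open one, of which compactness keeps finitely many members;
    then [N] is taken so large that words of length [N] resolve the smallest member. [good] and [g]
    allow a restriction to typical words or to the words of one cell, and [F] may be a piece of [K].
    [c0] depends only on the cell count. *)
Lemma mass_distribution : exists2 c0 : R, 0 < c0 & forall (p : 'I_d -> R)
    (good : pred (seq 'I_d)) (F : set (R * R)) (q0 : R * R) (N1 : nat) (g h C de : R),
  K q0 -> (forall l, 0 <= p l) -> \sum_l p l = 1 ->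
  0 < h -> 0 < C -> 0 < de <= 1 -> compact F ->
  (forall N, (N1 <= N)%N -> g <= \sum_(w <- words N | good w) wt p w) ->
  (forall w, (N1 <= size w)%N -> good w -> F (psiw a b ij w q0)) ->
  (forall w rho, (N1 <= size w)%N -> good w -> 0 < rho <= de ->
     wt a (iw ij w) <= rho -> wt b (jw ij w) <= rho ->
     mass ij p (cut a rho (iw ij w)) (cut b rho (jw ij w)) <= C * rho `^ h) ->
  ((c0 * g / C)%:E <= hausdorff_measure h F)%E.
Proof.
have [M hM] := cells_count a01 b01 a_sum b_sum (ler0n R 3).
exists (M.+1)%:R^-1 => [|p good F q0 N1 g h C de Kq p0 p1 h0 C0 /andP[de0 de1] cF hg hF hm].
  by rewrite invr_gt0 ltr0n.
apply: le_trans (_ : (hausdorff_content h de F <= _)%E); last first.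
  by apply: ereal_sup_ubound; exists de.
apply/ereal_infP => _ [U [hU cU] <-]; apply/lee_addgt0Pr => e e0.
pose D k := fine (diam (U k)).
have D0 k : 0 <= D k by apply/fine_ge0/diam_ge0.
have DE k : diam (U k) = (D k)%:E by apply: diam_fin_num (hU k).
have Dde k : D k <= de by rewrite -lee_fin -DE.
(* The least thickening of the [k]-th member: at most [de], where the mass bound applies, and with
   [h]-th power at most [e / 2 ^+ k.+1], so that all thickenings together cost at most [e]. *)
pose ep k := Num.min de ((e / 2 ^+ k.+1) `^ h^-1).
have ek0 (k : nat) : 0 < e / 2 ^+ k.+1 by rewrite divr_gt0 // exprn_gt0.
have ep0 k : 0 < ep k by rewrite lt_min de0 powR_gt0.
have eph k : ep k `^ h <= e / 2 ^+ k.+1.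
  rewrite -[leRHS](@powR_rootK _ _ h) ?gt_eqF ?(ltW (ek0 k)) //.
  apply: powR_le_l; rewrite ?(ltW h0) ?(ltW (ep0 k)) //.
  by rewrite ge_min lexx orbT.
pose rh k := Num.max (D k) (ep k).
have rh0 k : 0 < rh k by rewrite lt_max ep0 orbT.
have rhde k : rh k <= de by rewrite ge_max Dde ge_min lexx.
have rhh k : rh k `^ h <= D k `^ h + e / 2 ^+ k.+1.
  rewrite /rh; case: (leP (D k) (ep k)) => _; last by rewrite lerDl ltW.
  by apply: le_trans (eph k) _; rewrite lerDr powR_ge0.
pose V k := \bigcup_(x in U k) ball x (rh k).
have oV k : open (V k) by apply: bigcup_open => x _; exact: ball_open.
have [n Fn] : exists n, forall y, F y -> exists k : 'I_n, V k y.
  have /(_ nat \oo (fun n y => exists k : 'I_n, V k y) _) H := (compact_near_coveringP F).1 cF.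
  have [|n _ hn] := H; last by exists n => y Fy; exact: (hn n (leqnn n)).
  move=> x /cU[k _ Uk].
  exists (V k, [set n | (k < n)%N]) => /=.
    split; last by exists k.+1.
    by apply: open_nbhs_nbhs; split=> //; exists x => //; exact: ballxx.
  by move=> [y n] [/= Vy kn]; exists (Ordinal kn).
have [rm rm0 hrm] : exists2 rm, 0 < rm & forall k : 'I_n, rm <= rh k.
  exists (\big[Num.min/1]_(k < n) rh k); last by move=> k; exact: bigmin_le_cond.
  by apply: lt_bigmin.
have [N0 hN0] := small_words ij a01 b01 rm0.
pose N := maxn N0 N1.
have hN w k : size w = N -> wt a (iw ij w) <= rh (k : 'I_n) /\ wt b (jw ij w) <= rh k.
  move=> sw; have [|wa wb] := hN0 w; first by rewrite sw leq_maxl.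
  by split; apply: le_trans (hrm k).
have wp0 w : 0 <= wt p w by apply: prodr_ge0.
have main : g <= \sum_(k < n) M.+1%:R * (C * fine (diam_pow h (U k) + (e / 2 ^+ k.+1)%:E)).
  apply: le_trans (hg N (leq_maxr _ _)) _.
  apply: (@le_trans _ _ (\sum_(k < n)
     \sum_(w <- words N | good w && `[< V k (psiw a b ij w q0) >]) wt p w)).
    rewrite (exchange_big_dep good) /=; last by move=> k w _ /andP[].
    rewrite big_seq_cond [leRHS]big_seq_cond; apply: ler_sum => w /andP[].
    rewrite mem_words => /eqP sw gw.
    have [|k Vk] := Fn (psiw a b ij w q0); first by apply: hF; rewrite ?sw ?leq_maxr.
    rewrite (bigD1 k) /=; last by rewrite gw; apply/asboolP.
    by rewrite lerDl sumr_ge0.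
  apply: ler_sum => k _.
  have [U0|/set0P/negP/negPn/eqP U0] := pselect (U k !=set0); last first.
    rewrite big1 ?mulr_ge0 ?(ltW C0) // ?fine_ge0 // ?adde_ge0 ?diam_pow_ge0 ?lee_fin ?(ltW (ek0 k)) //.
    by move=> w /andP[_ /asboolP[x]]; rewrite U0.
  rewrite (diam_powE h (hU k) U0) -EFinD /=.
  have [x0 Ux0] := U0.
  apply: (@le_trans _ _ (M%:R * (C * rh k `^ h))); last first.
    apply: ler_pM; rewrite ?mulr_ge0 ?powR_ge0 ?(ltW C0) //; first by rewrite ler_nat.
    by rewrite ler_pM2l.
  apply: (@mass_near M p good N C h (rh k) (V k) q0 x0) => //; rewrite ?(ltW C0) //.
  - by rewrite rh0 (le_trans (rhde k)).
  - move=> y [x Ux [b1 b2]].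
    have Dr : D k <= rh k by rewrite le_max lexx.
    have := diam_ub Ux Ux0; rewrite DE lee_fin => xx0.
    have := edist_ge1 x x0; have := edist_ge2 x x0.
    move=> h2 h1.
    have {}b1 : `|x.1 - y.1| < rh k by exact: b1.
    have {}b2 : `|x.2 - y.2| < rh k by exact: b2.
    move: h1 h2 b1 b2; rewrite !ler_norml !ltr_norml.
    move=> /andP[? ?] /andP[? ?] /andP[? ?] /andP[? ?].
    by split; apply/andP; split; lra.
  - by move=> w sw; exact: hN.
  - move=> w sw gw; have [wa wb] := hN w k sw.
    by apply: hm => //; rewrite ?sw ?leq_maxr // rh0 rhde.
have fin k : diam_pow h (U k) \is a fin_num.
  have [U0|/set0P/negP/negPn/eqP U0] := pselect (U k !=set0).
    by rewrite (diam_powE h (hU k) U0).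
  by rewrite /diam_pow U0 eqxx.
pose S := \sum_(k < n) fine (diam_pow h (U k)).
have {}main : M.+1%:R^-1 * g / C <= S + e.
  have M0 : 0 < M.+1%:R :> R by rewrite ltr0n.
  rewrite ler_pdivrMr // ler_pdivrMl //; apply: le_trans main _.
  rewrite -!big_distrr /= (mulrC C) ler_pM2l // ler_pM2r //.
  apply: (@le_trans _ _ (S + \sum_(k < n) e / 2 ^+ k.+1)).
    rewrite -big_split /=; apply: ler_sum => k _.
    by rewrite fineD ?fin.
  by rewrite lerD2l sum_half_powers // ltW.
apply: (@le_trans _ _ (S + e)%:E); first by rewrite lee_fin.
rewrite EFinD leeD2r // /S -sumEFin.
rewrite (eq_bigr (fun k : 'I_n => diam_pow h (U k))); last by move=> k _; rewrite fineK ?fin.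
rewrite -(big_mkord xpredT (fun k => diam_pow h (U k))).
by apply: nneseries_lim_ge => k _ _; exact: diam_pow_ge0.
Qed.

End MassDistribution.

(** * Lower bounds for the Hausdorff dimension *)

Section HausdorffLower.
Context {R : realType}.
Implicit Types (E : set (R * R)) (h : R).

Lemma hausdorff_measure0 E : E !=set0 -> (1 <= hausdorff_measure 0 E)%E.
Proof.
move=> [x Ex]; apply: le_trans (_ : (hausdorff_content 0 1 E <= _)%E); last first.
  by apply: ereal_sup_ubound; exists 1 => //=; exact: ltr01.
apply/ereal_infP => _ [U [hU cU] <-]; have [k _ Uk] := cU x Ex.
have k1 : (1 <= diam_pow 0 (U k))%E.
  by rewrite (diam_powE 0 (hU k)) ?powRr0 //; exists x.
apply: le_trans (_ : (\sum_(0 <= i < k.+1) diam_pow 0 (U i) <= _)%E); last first.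
  by apply: nneseries_lim_ge => i _ _; exact: diam_pow_ge0.
rewrite big_nat_recr //= -[leLHS]add0e leeD //.
by apply: sume_ge0 => i _; exact: diam_pow_ge0.
Qed.

Lemma hausdorff_dim_ge0 E : (0 <= hausdorff_dim E)%E.
Proof. by apply/ereal_infP => _ [t [t0 _] <-]; rewrite lee_fin. Qed.

(** Exponent 0 is settled by [hausdorff_measure0]; only positive exponents remain, as the mass
    distribution principle requires. *)
Lemma hausdorff_dim_ge E h : E !=set0 ->
  (forall t, 0 < t < h -> hausdorff_measure t E <> 0%E) ->
  (h%:E <= hausdorff_dim E)%E.
Proof.
move=> E0 H; apply/ereal_infP => _ [t [t0 tE] <-]; rewrite lee_fin leNgt.
apply/negP => th; case: (ltgtP t 0) => t0'; first by rewrite ltNge t0 in t0'.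
  by apply: (H t) => //; rewrite t0'.
by have := hausdorff_measure0 E0; rewrite -t0' tE lee_fin ler10.
Qed.

End HausdorffLower.

Lemma mem_iota_le m m0 N : m \in iota m0 (N.+1 - m0) -> (m <= N)%N.
Proof. by rewrite mem_iota; lia. Qed.

Section ColumnMeasure.
Context {R : realType} {r s d : nat}.
Variables (a : 'I_r -> R) (b : 'I_s -> R) (ij : 'I_d -> 'I_r * 'I_s).
Variable K : set (R * R).

Hypothesis a01 : forall i, 0 < a i < 1.
Hypothesis b01 : forall j, 0 < b j < 1.
Hypothesis a_sum : \sum_(i < r) a i = 1.
Hypothesis b_sum : \sum_(j < s) b j = 1.
Hypothesis ij_inj : injective ij.
Hypothesis attrK : attractor a b ij K.

Variables (t smin : R) (e : 'I_d -> R).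
Hypothesis t0 : 0 <= t.
Hypothesis t_eq : \sum_(i in J1 ij) a i `^ t = 1.
Hypothesis e_col : forall l, \sum_(m | (ij m).1 == (ij l).1) b (ij m).2 `^ e m = 1.
Hypothesis smin0 : 0 <= smin.
Hypothesis e_ge : forall l, smin <= e l.

Let K0 : K !=set0. Proof. by case: attrK. Qed.
Let cptK : compact K. Proof. by case: attrK. Qed.
Let b_gt0 j : 0 < b j. Proof. by case/andP: (b01 j). Qed.

Local Notation p := (colw a b ij t e).
Let theta l := b (ij l).2 `^ (e l - smin).

Let theta_ge0 l : 0 <= theta l. Proof. exact: powR_ge0. Qed.

Let theta_le1 l : theta l <= 1.
Proof.
apply: powR_le1; first by rewrite subr_ge0.
by case/andP: (b01 (ij l).2) => /ltW-> /ltW.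
Qed.

Lemma cell_mass_le w rho : 0 < rho -> wt a (iw ij w) <= rho -> wt b (jw ij w) <= rho ->
  mass ij p (cut a rho (iw ij w)) (cut b rho (jw ij w)) <= rho `^ (t + smin) *
    wt theta (take (minn (size (cut a rho (iw ij w))) (size (cut b rho (jw ij w)))) w).
Proof.
move=> r0 wa wb; have := @mass_colw_le _ _ _ _ _ _ _ a01 b01 ij_inj _ _ _ t_eq e_col e_ge
  w _ _ (cut_prefix a rho (iw ij w)) (cut_prefix b rho (jw ij w)).
move=> h; apply: le_trans h _; apply: ler_pM.
- by rewrite mulr_ge0 ?powR_ge0.
- by apply: prodr_ge0 => l _; exact: powR_ge0.
- rewrite powR_addr //; apply: ler_pM; rewrite ?powR_ge0 //.
  + apply: powR_le_l => //; first by rewrite ltW // wt_gt0.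
    exact/(stopped_wt a01)/cut_stopped.
  + apply: powR_le_l => //; first by rewrite ltW // wt_gt0.
    exact/(stopped_wt b01)/cut_stopped.
- exact: lexx.
Qed.

Lemma wt_le1_ge0 (f : 'I_d -> R) w : (forall l, 0 <= f l) -> (forall l, f l <= 1) ->
  0 <= wt f w <= 1.
Proof.
move=> f0 f1; elim: w => [|l w /andP[h1 h2]]; first by rewrite wt_nil ler01 lexx.
by rewrite wt_cons mulr_ge0 // mulr_ile1.
Qed.

Lemma cell_mass_le0 w rho : 0 < rho -> wt a (iw ij w) <= rho -> wt b (jw ij w) <= rho ->
  mass ij p (cut a rho (iw ij w)) (cut b rho (jw ij w)) <= rho `^ (t + smin).
Proof.
move=> r0 wa wb; apply: le_trans (cell_mass_le r0 wa wb) _.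
rewrite ler_piMr ?powR_ge0 //; set m := minn _ _.
by case/andP: (wt_le1_ge0 (take m w) theta_ge0 theta_le1).
Qed.

Let p_ge0 l : 0 <= p l. Proof. exact: colw_ge0. Qed.
Let p_sum : \sum_l p l = 1. Proof. exact: sum_colw. Qed.

Lemma words_mass1 N : \sum_(w <- words N) wt p w = 1.
Proof. by rewrite words_mass p_sum expr1n. Qed.

Lemma hausdorff_dim_ge_col : ((t + smin)%:E <= hausdorff_dim K)%E.
Proof.
apply: hausdorff_dim_ge K0 _ => x /andP[x0 xh] Hx.
have [q0 Kq] := K0; have [c0 c00 H] := mass_distribution a01 b01 a_sum b_sum attrK.
suff : ((c0 * 1 / 1)%:E <= 0 :> \bar R)%E.
  by rewrite lee_fin mulr1 divr1 leNgt c00.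
rewrite -Hx; apply: (H p predT K q0 0%N 1 x 1 1 Kq p_ge0 p_sum x0 ltr01 _ cptK).
- by rewrite ltr01 lexx.
- by move=> N _; rewrite words_mass1.
- by move=> w _ _; exact: psiw_K.
- move=> w rho _ _ /andP[r0 r1] wa wb; rewrite mul1r.
  apply: le_trans (cell_mass_le0 r0 wa wb) _.
  by apply: powR_le1_mono; rewrite ?r0 // ltW.
Qed.

(** Letters are independent, so the mean of a product over the first [m] letters is a power of the
    one-letter mean. *)
Lemma words_mass_take N m : (m <= N)%N ->
  \sum_(w <- words N) wt p w * wt theta (take m w) = (\sum_l p l * theta l) ^+ m.
Proof.
elim: N m => [|N IH] m; first by rewrite leqn0 => /eqP->; rewrite big_seq1 !wt_nil mulr1.
case: m => [_|m mN].
  rewrite expr0 -(words_mass1 N.+1); apply: eq_bigr => w _.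
  by rewrite take0 wt_nil mulr1.
rewrite big_words exprS -(IH m) // big_distrl /=; apply: eq_bigr => l _.
by rewrite big_distrr /=; apply: eq_bigr => w _; rewrite !wt_cons; ring.
Qed.

Lemma sum_geometric (x : R) m n : 0 <= x < 1 ->
  \sum_(k <- iota m n) x ^+ k <= x ^+ m / (1 - x).
Proof.
move=> /andP[x0 x1]; have x10 : 0 < 1 - x by rewrite subr_gt0.
elim: n m => [|n IH] m; first by rewrite big_nil divr_ge0 ?exprn_ge0 // ltW.
rewrite /= big_cons; apply: le_trans (lerD (lexx _) (IH _)) _.
by apply: eq_ler; rewrite exprS; field; rewrite gt_eqF.
Qed.

(* By Markov's inequality most words have theta-weight at most lam^m at every
   level m >= m0, where lam^2 is the mean of theta. *)
Lemma hausdorff_dim_gt_col : (exists l, smin < e l) ->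
  exists2 ga, 0 < ga & ((t + smin + ga)%:E <= hausdorff_dim K)%E.
Proof.
move=> [l0 el0].
have p_gt0 l : 0 < p l.
  by rewrite mulr_gt0 ?powR_gt0 //; case/andP: (a01 (ij l).1).
have [cm /andP[cm0 cm1] [cma cmb]] := ratio_bounds a01 b01.
have {}cm1 : cm < 1 by apply: le_lt_trans (cma (ij l0).1) _; case/andP: (a01 (ij l0).1).
pose X := \sum_l p l * theta l.
have X0 : 0 < X.
  rewrite /X (bigD1 l0) //=; apply: ltr_wpDr.
    by apply: sumr_ge0 => l _; rewrite mulr_ge0.
  by rewrite mulr_gt0 ?powR_gt0.
have X1 : X < 1.
  rewrite -p_sum /X (bigD1 l0) //= [ltRHS](bigD1 l0) //=; apply: ltr_leD.
    rewrite gtr_pMr // -(powRr0 (b (ij l0).2)); apply: powR_lt1_mono => //.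
    by rewrite subr_gt0.
  by apply: ler_sum => l _; rewrite ler_piMr.
pose lam := Num.sqrt X.
have lam0 : 0 < lam by rewrite /lam sqrtr_gt0; exact: X0.
have lamX : lam ^+ 2 = X by rewrite /lam sqr_sqrtr //; exact: ltW X0.
have lam1 : lam < 1.
  by rewrite /lam -sqrtr1 ltr_sqrt //; exact: X1.
(* With this [m0] the geometric tail from level [m0] on is at most 1/2, so the good words keep mass
   at least 1/2. *)
have [m0 hm0] : exists m, lam ^+ m <= (1 - lam) / 2.
  by apply: exprn_le_eps; [rewrite ltW | rewrite divr_gt0 // subr_gt0].
pose good w := all (fun m => wt theta (take m w) <= lam ^+ m) (iota m0 ((size w).+1 - m0)).
have goodm w m : good w -> (m0 <= m <= size w)%N -> wt theta (take m w) <= lam ^+ m.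
  move=> /allP gw /andP[h1 h2]; apply: gw; rewrite mem_iota h1 /= subnKC //.
  by apply: leq_trans h1 _; apply: leq_trans h2 _.
(* So [cm^ga = lam]. A common part of [m] letters satisfies [cm ^+ m <= rho], hence its factor
   [lam ^+ m] is at most [rho^ga]. *)
pose ga := ln lam / ln cm.
have ga0 : 0 < ga.
  by rewrite /ga nmulr_rgt0 ?invr_lt0 ln_lt0 // ?lam0 ?cm0.
exists ga => //; apply: hausdorff_dim_ge K0 _ => x /andP[x0 xh] Hx.
have [q0 Kq] := K0; have [c0 c00 H] := mass_distribution a01 b01 a_sum b_sum attrK.
(* Scales below [cm ^+ m0] force a common part of at least [m0] letters, the levels that [good]
   controls. *)
have de0 : 0 < cm ^+ m0 by rewrite exprn_gt0.
suff : ((c0 * 2^-1 / 1)%:E <= 0 :> \bar R)%E.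
  by rewrite lee_fin divr1 leNgt mulr_gt0 ?invr_gt0.
rewrite -Hx; apply: (H p good K q0 0%N 2^-1 x 1 (cm ^+ m0) Kq p_ge0 p_sum x0 ltr01 _ cptK).
- by rewrite de0 exprn_ile1 // ltW.
- move=> N _.
  suff bad : \sum_(w <- words N | ~~ good w) wt p w <= 2^-1.
    have := words_mass1 N; rewrite (bigID good) /=; move: bad; lra.
  apply: (@le_trans _ _ (\sum_(m <- iota m0 (N.+1 - m0))
      \sum_(w <- words N) wt p w * (wt theta (take m w) / lam ^+ m))).
    rewrite exchange_big /= [leLHS]big_mkcond /= big_seq [leRHS]big_seq.
    apply: ler_sum => w; rewrite mem_words => /eqP sw.
    have T0 m : 0 <= wt p w * (wt theta (take m w) / lam ^+ m).
      rewrite mulr_ge0 ?divr_ge0 ?exprn_ge0 ?(ltW lam0) //; last by apply: prodr_ge0.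
      by apply: prodr_ge0.
    case: ifP => [/allPn[m]|_]; last by apply: sumr_ge0.
    rewrite sw => mi; rewrite -ltNge => hlt.
    rewrite (big_rem m) //= -[leLHS]addr0 lerD ?sumr_ge0 //.
    rewrite ler_peMr ?prodr_ge0 // ler_pdivlMr ?exprn_gt0 // mul1r ltW //.
  apply: (@le_trans _ _ (\sum_(m <- iota m0 (N.+1 - m0)) lam ^+ m)).
    rewrite big_seq [leRHS]big_seq; apply: ler_sum => m /mem_iota_le mN.
    rewrite (eq_bigr (fun w => wt p w * wt theta (take m w) / lam ^+ m)); last first.
      by move=> w _; rewrite mulrA.
    rewrite -big_distrl /= words_mass_take // -/X -lamX -exprM mul2n -addnn exprD.
    by rewrite mulfK // gt_eqF // exprn_gt0.
  apply: le_trans (sum_geometric _ _ _) _; first by rewrite (ltW lam0) lam1.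
  rewrite ler_pdivrMr ?subr_gt0 //; apply: le_trans hm0 _; by rewrite mulrC.
- by move=> w _ _; exact: psiw_K.
- move=> w rho _ gw /andP[r0 rde] wa wb; rewrite mul1r.
  apply: le_trans (cell_mass_le r0 wa wb) _.
  set u := cut a _ _; set v := cut b _ _; set m := minn _ _.
  have wu : wt a u <= rho by exact/(stopped_wt a01)/cut_stopped.
  have wv : wt b v <= rho by exact/(stopped_wt b01)/cut_stopped.
  have cmm : cm ^+ m <= rho.
    rewrite /m; case: leqP => _.
      by apply: le_trans wu; apply: wt_ge_expr => //; apply: ltW.
    by apply: le_trans wv; apply: wt_ge_expr => //; apply: ltW.
  have m0m : (m0 <= m)%N.
    rewrite leqNgt; apply/negP => mm0.
    have : cm ^+ m0 < cm ^+ m by rewrite ltr_iXn2l.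
    by rewrite ltNge (le_trans cmm).
  have mw : (m <= size w)%N.
    rewrite /m geq_min; apply/orP; left.
    by rewrite -(size_map (fun l => (ij l).1) w); apply/size_prefix/cut_prefix.
  apply: (@le_trans _ _ (rho `^ (t + smin) * rho `^ ga)).
    rewrite ler_wpM2l ?powR_ge0 //; apply: le_trans (goodm w m gw _) _; first by rewrite m0m.
    have -> : lam = cm `^ ga by rewrite powR_of_base // cm0.
    rewrite -powR_expn ?(ltW cm0) //; apply: powR_le_l; rewrite ?(ltW ga0) //.
    by rewrite exprn_ge0 // ltW.
  rewrite -powR_addr //; apply: powR_le1_mono; last exact: ltW.
  by rewrite r0 /=; apply: le_trans rde _; rewrite exprn_ile1 // ltW.
Qed.

(** The good words are those of the cell itself. By [mass_colw_ge] their mass is exactly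
    [wt a u^t * wt b v^smin], which is comparable to [rho^(t + smin)]. *)
Lemma local_mass_bound : (forall l, e l = smin) -> 0 < t + smin ->
  exists2 c : R, 0 < c & forall rho z q0 (F : set (R * R)), 0 < rho <= 1 -> K q0 ->
    wt a (iw ij z) <= rho -> wt b (jw ij z) <= rho ->
    (size (cut b rho (jw ij z)) <= size (cut a rho (iw ij z)))%N -> compact F ->
    (forall w, prefix (cut a rho (iw ij z)) (iw ij w) ->
       prefix (cut b rho (jw ij z)) (jw ij w) -> F (psiw a b ij w q0)) ->
    ((c * rho `^ (t + smin))%:E <= hausdorff_measure (t + smin) F)%E.
Proof.
move=> eE h0; have [cm cm01 [cma cmb]] := ratio_bounds a01 b01.
have /andP[cm0 cm1] := cm01.
have [c0 c00 H] := mass_distribution a01 b01 a_sum b_sum attrK.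
exists (c0 * cm `^ (t + smin)); first by rewrite mulr_gt0 ?powR_gt0.
move=> rho z q0 F /andP[r0 r1] Kq wa wb szv cF hF.
set u := cut a _ _ in szv hF; set v := cut b _ _ in szv hF.
have su : stopped a rho u by exact: cut_stopped.
have sv : stopped b rho v by exact: cut_stopped.
pose good w := prefix u (iw ij w) && prefix v (jw ij w).
pose g := wt a u `^ t * wt b v `^ smin.
have g_ge : (cm * rho) `^ (t + smin) <= g.
  rewrite powR_addr ?mulr_gt0 //; apply: ler_pM; rewrite ?powR_ge0 //.
    apply: powR_le_l; rewrite ?mulr_ge0 ?(ltW cm0) ?(ltW r0) //.
    exact: stopped_wt_ge su.
  apply: powR_le_l; rewrite ?mulr_ge0 ?(ltW cm0) ?(ltW r0) //.
  exact: stopped_wt_ge sv.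
apply: (@le_trans _ _ (c0 * g / 1)%:E).
  rewrite lee_fin divr1 -mulrA ler_pM2l // -powRM ?(ltW cm0) ?(ltW r0) //.
apply: (H p good F q0 (maxn (size u) (size v)) g (t + smin) 1 1) => //.
- by rewrite ltr01 lexx.
- move=> N; rewrite geq_max => /andP[hu hv]; rewrite mass_sum //.
  by rewrite (@mass_colw_ge _ _ _ _ _ _ _ a01 b01 ij_inj t smin e e_col z) // cut_prefix.
- by move=> w _ /andP[]; exact: hF.
- by move=> w rho' _ _ /andP[r0' r1'] wa' wb'; rewrite mul1r; exact: cell_mass_le0.
Qed.

End ColumnMeasure.

(** * Extremal cells *)

Section Scales.
Context {R : realType}.

(** Otherwise [1 <= D * (x ^+ T)^(be - al)] for arbitrarily large [T], although the right side tends
    to 0. *)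
Lemma exponent_le (x D al be : R) : 0 < x < 1 -> 0 < D ->
  (forall T0 : nat, exists2 T, (T0 <= T)%N & (x ^+ T) `^ (- be) <= D * (x ^+ T) `^ (- al)) ->
  be <= al.
Proof.
move=> /andP[x0 x1] D0 H; rewrite leNgt; apply/negP => ab.
have y01 : 0 <= x `^ (be - al) < 1.
  by rewrite powR_ge0 -(powRr0 x) powR_lt1_mono ?x0 // subr_gt0.
have e0 : 0 < (2 * D)^-1 by rewrite invr_gt0 mulr_gt0.
have [T0 hT0] := exprn_le_eps y01 e0; have [T TT0] := H T0.
have xT0 : 0 < x ^+ T by rewrite exprn_gt0.
rewrite !powRN ler_pdivlMr ?powR_gt0 // mulrC ler_pdivrMr ?powR_gt0 //.
rewrite leNgt => /negP; apply.
rewrite -[be](subrK al) powR_addr // mulrA gtr_pMl ?powR_gt0 //.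
rewrite powR_expn ?(ltW x0) //.
have : (x `^ (be - al)) ^+ T <= (2 * D)^-1.
  apply: le_trans hT0; apply: ler_wiXn2l => //; first exact: powR_ge0.
  by case/andP: y01 => _ /ltW.
move=> h; apply: (@le_lt_trans _ _ (D * (2 * D)^-1)); first by rewrite ler_pM2l.
by rewrite invfM mulrCA divff ?gt_eqF // mulr1 invf_lt1 // ltr1n.
Qed.

(** After [q] letters a rectangle has width [a0 ^+ q] and height [b0 ^+ q]; [T] letters in a column
    of width [c] bring the width down to the height, up to a factor [c]. Here [T.+1] is the first
    exponent at which [c ^+ k] falls below [(b0 / a0) ^+ q], and a large [q] makes it large. *)
Lemma matching_scales (a0 b0 c : R) (T0 : nat) : 0 < b0 -> b0 < a0 -> 0 < c < 1 ->
  exists q T, [/\ (T0 <= q)%N, (T0 <= T)%N, b0 ^+ q <= a0 ^+ q * c ^+ T &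
    c * (a0 ^+ q * c ^+ T) < b0 ^+ q].
Proof.
move=> b00 ba /andP[c0 c1]; have a00 : 0 < a0 := lt_trans b00 ba.
have x01 : 0 <= b0 / a0 < 1 by rewrite divr_ge0 ?(ltW b00) ?(ltW a00) // ltr_pdivrMr // mul1r.
have cT0 : 0 < c ^+ T0 by rewrite exprn_gt0.
have [n hn] := exprn_le_eps x01 cT0.
pose q := maxn n T0; pose x := (b0 / a0) ^+ q.
have x0 : 0 < x by rewrite exprn_gt0 // divr_gt0.
have xc : x <= c ^+ T0.
  apply: le_trans hn; apply: ler_wiXn2l; rewrite ?leq_maxl //; first by case/andP: x01.
  by case/andP: x01 => _ /ltW.
have ex : exists k, c ^+ k < x.
  have [|k hk] := @exprn_le_eps _ c (x / 2) _ (divr_gt0 x0 (ltr0n _ 2)).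
    by rewrite (ltW c0).
  by exists k; apply: le_lt_trans hk _; lra.
case: (ex_minnP ex) => -[|T] hT minT.
  by move: hT; rewrite expr0 ltNge (le_trans xc) // exprn_ile1 // ltW.
have xE : x * a0 ^+ q = b0 ^+ q by rewrite /x -exprMn divfK // gt_eqF.
exists q, T; split.
- exact: leq_maxr.
- rewrite -ltnS; apply: contraTltn xc => h; rewrite -ltNge; apply: le_lt_trans hT.
  by apply: ler_wiXn2l; rewrite ?(ltW c0) ?(ltW c1).
- rewrite -xE mulrC ler_pM2l ?exprn_gt0 // leNgt; apply/negP => /minT.
  by rewrite ltnn.
- by rewrite mulrCA -exprS mulrC -xE ltr_pM2r ?exprn_gt0.
Qed.

End Scales.

Lemma interior_margin (R : realType) (lo hi rad x y : R) :
  `|x - y| <= rad -> lo + rad < x < hi - rad -> lo < y < hi.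
Proof. by rewrite ler_norml => /andP[? ?] /andP[? ?]; apply/andP; split; lra. Qed.

Lemma scaled_margin (R : realType) (k y w P rad : R) : 0 < w -> rad < k * w ->
  k <= y <= 1 - k -> P + rad < P + w * y < P + w - rad.
Proof. by move=> w0 h /andP[h1 h2]; apply/andP; split; nra. Qed.

Section Interior.
Context {R : realType} {n : nat}.
Variable c : 'I_n -> R.
Hypothesis c01 : forall i, 0 < c i < 1.
Hypothesis c_sum : \sum_(i < n) c i = 1.

(** The smaller letter is not the last one and the larger is not the first one, so two distinct
    letters keep the point off both ends. A repeated extreme letter would not. *)
Lemma inside_two_letters (cm y : R) (i j : 'I_n) : 0 < cm <= 1 -> (forall k, cm <= c k) ->
  i != j -> inside c [:: i; j] y -> cm ^+ 2 <= y <= 1 - cm ^+ 2.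
Proof.
move=> /andP[cm0 cm1] hc ij; rewrite /inside /= !wt_cons wt_nil => /andP[h1 h2].
have /andP[ci0 ci1] := c01 i; have /andP[cj0 cj1] := c01 j.
have hi := hc i; have hj := hc j.
have oi := off_le1 c01 c_sum i; have oj := off_le1 c01 c_sum j.
have oi0 := off_ge0 c01 i; have oj0 := off_ge0 c01 j.
case: (ltngtP i j) => [lij|lij|/val_inj/eqP]; last by rewrite (negPf ij).
- have := off_lt c01 lij => hh; rewrite expr2.
  by apply/andP; split; nra.
- have := off_lt c01 lij => hh; rewrite expr2.
  by apply/andP; split; nra.
Qed.

End Interior.

Lemma subset_map_lift (T1 T2 : eqType) (f : T1 -> T2) (S : seq T1) (v : seq T2) :
  {subset v <= map f S} -> exists2 w, {subset w <= S} & map f w = v.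
Proof.
elim: v => [|x v IH] h; first by exists [::].
have [|w wS wv] := IH; first by move=> y yv; apply: h; rewrite inE yv orbT.
have /mapP[y yS ->] := h x (mem_head _ _).
exists (y :: w); last by rewrite /= wv.
by move=> k; rewrite inE => /orP[/eqP->|/wS].
Qed.

Lemma map_const_nseq (T1 T2 : eqType) (f : T1 -> T2) (c : T2) (w : seq T1) :
  {in w, forall x, f x = c} -> map f w = nseq (size w) c.
Proof.
elim: w => //= x w IH h; rewrite h ?mem_head // IH // => y yw.
by apply: h; rewrite inE yw orbT.
Qed.

Lemma mem_prefix (T : eqType) (u v : seq T) : prefix u v -> {subset u <= v}.
Proof. by case/prefixP => w -> i iu; rewrite mem_cat iu. Qed.

Section SpecialCells.
Context {R : realType} {r s d : nat}.
Variables (a : 'I_r -> R) (b : 'I_s -> R) (ij : 'I_d -> 'I_r * 'I_s).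
Variable K : set (R * R).

Hypothesis a01 : forall i, 0 < a i < 1.
Hypothesis b01 : forall j, 0 < b j < 1.
Hypothesis a_sum : \sum_(i < r) a i = 1.
Hypothesis b_sum : \sum_(j < s) b j = 1.
Hypothesis ij_inj : injective ij.
Hypothesis attrK : attractor a b ij K.

Let K0 : K !=set0. Proof. by case: attrK. Qed.

Variables (t e dK : R) (l0 ls : 'I_d).
Hypothesis ba0 : b (ij l0).2 < a (ij l0).1.
Hypothesis dK0 : 0 < dK.
Hypothesis dKle : (dK%:E <= diam K)%E.
Hypothesis t0 : 0 <= t.
Hypothesis t_eq : \sum_(i in J1 ij) a i `^ t = 1.
Hypothesis e0 : 0 <= e.
Hypothesis e_eq : \sum_(m | (ij m).1 == (ij ls).1) b (ij m).2 `^ e = 1.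

Local Notation i0 := (ij l0).1.
Local Notation j0 := (ij l0).2.
Local Notation i1 := (ij ls).1.

Definition column (l : 'I_d) : seq 'I_s := [seq (ij m).2 | m <- enum 'I_d & (ij m).1 == (ij l).1].

Lemma uniq_column l : uniq (column l).
Proof.
rewrite map_inj_in_uniq; first exact/filter_uniq/enum_uniq.
move=> m m'.
rewrite !mem_filter => /andP[/eqP h _] /andP[/eqP h' _] h2; apply: ij_inj.
by move: h h' h2; case: (ij m) (ij m') => [? ?] [? ?] /= -> -> ->.
Qed.

Lemma big_column l : \sum_(j <- column l) b j `^ e =
  \sum_(m | (ij m).1 == (ij l).1) b (ij m).2 `^ e.
Proof. by rewrite big_map big_filter big_enum_cond. Qed.

Lemma column_lift l v : {subset v <= column l} ->
  exists w, iw ij w = nseq (size v) (ij l).1 /\ jw ij w = v.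
Proof.
case/subset_map_lift => w hw <-; exists w; split=> //.
rewrite size_map; apply: map_const_nseq => m /hw.
by rewrite mem_filter => /andP[/eqP].
Qed.

Lemma J1_lift u : {subset u <= enum (J1 ij)} -> exists w, iw ij w = u.
Proof.
move=> hu; have [|w _ hw] := @subset_map_lift _ _ (fun l => (ij l).1) (enum 'I_d) u.
  move=> i /hu; rewrite mem_enum inE => /set0Pn[l]; rewrite inE => /eqP<-.
  by apply: map_f; rewrite mem_enum.
by exists w.
Qed.

(** The vertical word [v] fills rows of the run, whose columns are already fixed by [u0], while the
    horizontal word [u] is read after the run. They are chosen independently, so their counts
    [y^(-e)] and [y^(-t)] multiply. *)
Lemma assouad_ge : ((t + e)%:E <= assouad_dim K)%E.
Proof.
apply/ereal_infP => _ [al [al0 [C C0 hC]] <-]; rewrite lee_fin.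
have [M M0 hM] := covers_cells a01 b01 a_sum b_sum.
have [bM /andP[_ bM1] hbM] := finite_upper_bound b01.
have bM0 : 0 < bM by apply: lt_le_trans (hbM j0); case/andP: (b01 j0).
have /andP[as0 as1] := a01 i1; have /andP[b00 b01'] := b01 j0.
have a00 : 0 < a i0 by case/andP: (a01 i0).
have M0' : 0 < M%:R :> R by rewrite ltr0n.
have D0 : 0 < M%:R * (C * (2 / a i1) `^ al).
  by rewrite !mulr_gt0 ?powR_gt0 ?divr_gt0.
apply: (@exponent_le _ bM _ al (t + e) _ D0); first by rewrite bM0.
(* [q >= T1] will give [rad <= dK]. *)
move=> T0; have [T1 hT1] : exists n, b j0 ^+ n <= a i1 * dK / 2.
  by apply: exprn_le_eps; rewrite ?divr_gt0 ?mulr_gt0 // (ltW b00).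
have [q [T [hq hT BA AB]]] := matching_scales (T0 + T1).+1 b00 ba0 (a01 i1).
exists T; first by apply: leq_trans hT; rewrite -addnS leq_addr.
set B := b j0 ^+ q in BA AB; set A := a i0 ^+ q * a i1 ^+ T in BA AB.
have B0 : 0 < B by rewrite exprn_gt0.
have A0 : 0 < A := lt_le_trans B0 BA.
have B1 : B <= 1 by rewrite exprn_ile1 // ltW.
(* As every row ratio is at most [bM], vertical words of relative scale [y] have at most [T] letters
   and fit into the run. *)
pose y := bM ^+ T; have y0 : 0 < y by rewrite exprn_gt0.
have y1 : y < 1 by rewrite exprn_ilt1 ?(ltW bM0) // -lt0n (leq_trans _ hT).
pose rho := B * y; have r0 : 0 < rho by rewrite mulr_gt0.
have rB : rho < B by rewrite gtr_pMr.
have rA : rho < A := lt_le_trans rB BA.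
have BT1 : B <= a i1 * dK / 2.
  apply: le_trans hT1; apply: ler_wiXn2l; rewrite ?(ltW b00) ?(ltW b01') //.
  by apply: leq_trans hq; rewrite -addSn leq_addl.
(* The rectangle over [(u0, v0)] has sides [A] and [B], both at most [B / a i1], so the ball
   contains all of its points in [K]. *)
pose rad := 2 * (B / a i1).
have Bas : B <= B / a i1 by rewrite ler_pdivlMr // ler_piMr // ltW.
have Aas : A <= B / a i1 by rewrite ler_pdivlMr // mulrC ltW.
have [aM /andP[aM0 aM1] haM] := finite_upper_bound a01.
have [N2 hN2] : exists n, aM ^+ n <= rho / A.
  by apply: exprn_le_eps; rewrite ?aM0 // divr_gt0.
pose L1 := stops b (column ls) T y.
pose L2 := stops a (enum (J1 ij)) N2 (rho / A).
have S1 : y `^ (- e) <= (size L1)%:R.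
  by apply: (size_stops_ge b01 (x := bM)) => //; rewrite big_column.
have S2 : y `^ (- t) <= (size L2)%:R.
  apply: (@le_trans _ _ ((rho / A) `^ (- t))); last first.
    by apply: (size_stops_ge a01 (x := aM)); rewrite ?divr_gt0 ?big_enum.
  rewrite !powRN lef_pV2 ?posrE ?powR_gt0 ?divr_gt0 //.
  apply: powR_le_l; rewrite ?divr_ge0 ?(ltW r0) ?(ltW A0) //.
  by rewrite ler_pdivrMr // mulrC ler_wpM2r // ltW.
pose u0 := nseq q i0 ++ nseq T i1; pose v0 := nseq q j0.
have wu0 : wt a u0 = A by rewrite wt_cat !wt_nseq.
have wv0 : wt b v0 = B by rewrite wt_nseq.
pose cells := [seq (u0 ++ u, v0 ++ v) | v <- L1, u <- L2].
have [q0 Kq] := K0.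
pose x := psiw a b ij (nseq q l0 ++ nseq T ls) q0.
have iwx : iw ij (nseq q l0 ++ nseq T ls) = u0 by rewrite /iw map_cat !map_nseq.
have jwx : jw ij (nseq q l0 ++ nseq T ls) = v0 ++ nseq T (ij ls).2.
  by rewrite /jw map_cat !map_nseq.
have xbox : box a b u0 v0 x.
  by apply: (box_prefix a01 b01 a_sum b_sum attrK Kq); rewrite ?iwx ?jwx ?prefix_prefix ?prefix_refl.
have cov n : covers rho (eball x rad `&` K) n -> (size L1)%:R * (size L2)%:R / M%:R <= n%:R :> R.
  move=> cn; rewrite ler_pdivrMr // -!natrM ler_nat.
  have <- : size cells = (size L1 * size L2)%N by rewrite size_allpairs.
  apply: (hM rho _ n cells) cn.
  - by rewrite r0 (le_trans (ltW rB)).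
  - apply: allpairs_uniq; rewrite ?uniq_stops ?uniq_column ?enum_uniq //.
    move=> [v u] [v' u'] _ _ /= [/eqP + /eqP].
    by rewrite !eqseq_cat // !eqxx /= => /eqP-> /eqP->.
  - move=> c /allpairsP[[v u] /= [vL uL ->]] /=; split.
    + by rewrite stopped_cat ?wu0 //; exact: stops_stopped uL.
    + rewrite stopped_cat ?wv0 // /rho mulrAC divff ?gt_eqF // mul1r.
      exact: stops_stopped vL.
    have [w1 [iw1 jw1]] := column_lift (stops_all vL).
    have [w2 iw2] := J1_lift (stops_all uL).
    have sv := stops_size vL.
    (* After the letters realising [v] the run is completed with [ls], so that column [i1] is read
       exactly [T] times before [u] starts. *)
    pose z := nseq q l0 ++ w1 ++ nseq (T - size v) ls ++ w2.
    have iz : iw ij z = u0 ++ u.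
      rewrite /iw !map_cat !map_nseq -/(iw ij w1) -/(iw ij w2) iw1 iw2 /u0 -!catA.
      congr (_ ++ _); rewrite !catA; congr (_ ++ _).
      by rewrite cat_nseq /ncons -iterD subnKC.
    have jz : prefix (v0 ++ v) (jw ij z).
      rewrite /jw !map_cat !map_nseq -/(jw ij w1) jw1 catA.
      exact: prefix_prefix.
    have pz : box a b (u0 ++ u) (v0 ++ v) (psiw a b ij z q0).
      by apply: (box_prefix a01 b01 a_sum b_sum attrK Kq); rewrite ?iz ?prefix_refl.
    exists (psiw a b ij z q0) => //; split; last exact: psiw_K.
    have pz0 : box a b u0 v0 (psiw a b ij z q0).
      apply: (box_prefix a01 b01 a_sum b_sum attrK Kq); first by rewrite iz prefix_prefix.
      by apply: prefix_trans jz; exact: prefix_prefix.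
    rewrite /eball /= -lee_fin; apply: le_trans (diam_ub xbox pz0) _.
    by apply: box_diam => //; rewrite ?wu0 ?wv0.
have := hC x rho rad (psiw_K attrK _ Kq) r0.
have rR : rho < rad by rewrite /rad; move: rB Bas r0; lra.
have Rd : (rad%:E <= diam K)%E.
  apply: le_trans dKle; rewrite lee_fin /rad mulrA ler_pdivrMr //.
  by move: BT1; lra.
move=> /(_ rR Rd) up.
have low := covering_number_ge cov.
have := le_trans low up; rewrite lee_fin.
have -> : rad / rho = 2 / a i1 * y^-1.
  by rewrite /rad /rho; field; rewrite !gt_eqF.
rewrite powRM ?invr_ge0 ?divr_ge0 ?(ltW as0) ?(ltW y0) // powR_inv_l ?(ltW y0) // -powRN.
rewrite ler_pdivrMr // => h.
rewrite opprD powR_addr //.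
apply: (@le_trans _ _ ((size L1)%:R * (size L2)%:R)).
  by rewrite mulrC ler_pM ?powR_ge0.
by apply: le_trans h _; apply: eq_ler; ring.
Qed.

(* The ball is chosen in the interior of the rectangle over [u0], so that every
   word of a point in it starts with [u0] and runs T letters in one column. *)
Lemma lower_le (l1 l2 l3 l4 : 'I_d) : (ij l1).2 != (ij l2).2 -> (ij l3).1 != (ij l4).1 ->
  (lower_dim K <= (t + e)%:E)%E.
Proof.
move=> l12 l34; apply/ereal_supP => _ [al [al0 [C C0 hC]] <-]; rewrite lee_fin.
have [cm cm01 [cma cmb]] := ratio_bounds a01 b01; have /andP[cm0 cm1] := cm01.
have [bM /andP[_ bM1] hbM] := finite_upper_bound b01.
have bM0 : 0 < bM by apply: lt_le_trans (hbM j0); case/andP: (b01 j0).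
have /andP[as0 as1] := a01 i1; have /andP[b00 b01'] := b01 j0.
have /andP[a00 a01'] := a01 i0.
have a_ge0 i : 0 <= a i by case/andP: (a01 i) => /ltW.
have a_le1 i : a i <= 1 by case/andP: (a01 i) => _ /ltW.
have s0 : 0 < s%:R :> R by rewrite ltr0n (leq_ltn_trans _ (ltn_ord j0)).
pose D1 := s%:R * s%:R * (cm ^+ 2) `^ (- (t + e)).
pose D2 := C * (cm ^+ 4 / 4) `^ al.
have cm20 : 0 < cm ^+ 2 by rewrite exprn_gt0.
have cm40 : 0 < cm ^+ 4 by rewrite exprn_gt0.
have D10 : 0 < D1 by rewrite !mulr_gt0 ?powR_gt0.
have D20 : 0 < D2 by rewrite !mulr_gt0 ?powR_gt0 // divr_gt0.
have D0 : 0 < D1 / D2 by rewrite divr_gt0.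
apply: (@exponent_le _ bM _ (t + e) al _ D0); first by rewrite bM0.
move=> T0; have [T1 hT1] : exists n, b j0 ^+ n <= dK.
  by apply: exprn_le_eps; rewrite // (ltW b00).
have [T2 hT2] : exists n, bM ^+ n <= cm ^+ 4 / 8.
  by apply: exprn_le_eps; rewrite ?divr_gt0 // (ltW bM0).
have [q [T [hq hT BA AB]]] := matching_scales (T0 + T1 + T2) b00 ba0 (a01 i1).
exists T; first by apply: leq_trans hT; rewrite -addnA leq_addr.
set B := b j0 ^+ q in BA AB; set A := a i0 ^+ q * a i1 ^+ T in BA AB.
have B0 : 0 < B by rewrite exprn_gt0.
have A0 : 0 < A := lt_le_trans B0 BA.
have B1 : B <= 1 by rewrite exprn_ile1 // ltW.
pose y := bM ^+ T; have y0 : 0 < y by rewrite exprn_gt0.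
have y4 : y <= cm ^+ 4 / 8.
  apply: le_trans hT2; apply: ler_wiXn2l; rewrite ?(ltW bM0) ?(ltW bM1) //.
  by apply: leq_trans hT; rewrite leq_addl.
have BdK : B <= dK.
  apply: le_trans hT1; apply: ler_wiXn2l; rewrite ?(ltW b00) ?(ltW b01') //.
  by apply: leq_trans hq; rewrite addnAC leq_addl.
have cm42 : cm ^+ 4 <= cm ^+ 2 by apply: ler_wiXn2l; rewrite ?(ltW cm0).
have cm21 : cm ^+ 2 <= 1 by rewrite exprn_ile1 // ltW.
have ycm2 : y <= cm ^+ 2 by move: y4 cm42 cm40; lra.
have y1 : y <= 1 := le_trans ycm2 cm21.
pose A' := A * (a (ij l1).1 * a (ij l2).1).
(* Letters [l1], [l2] with different rows, placed right after [v0], keep the centre off the top and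
   bottom of the rectangle; their columns become part of [u0]. Letters [l3], [l4] with different
   columns, placed after the run, keep it off the sides. *)
pose u0 := nseq q i0 ++ [:: (ij l1).1; (ij l2).1] ++ nseq T i1; pose v0 := nseq q j0.
have wu0 : wt a u0 = A' by rewrite !wt_cat !wt_cons !wt_nseq wt_nil /A' /A; ring.
have wv0 : wt b v0 = B by rewrite wt_nseq.
have A'0 : 0 < A' by rewrite -wu0 wt_gt0.
have A'B : cm ^+ 2 * B <= A'.
  rewrite /A' mulrC ler_pM ?(ltW B0) ?(ltW cm20) // expr2 ler_pM ?(ltW cm0) //.
have A'le : A' * cm <= B.
  apply: le_trans (ltW AB); rewrite mulrC; apply: ler_pM; rewrite ?(ltW cm0) ?(ltW A'0) //.
  by rewrite /A' ler_piMr ?(ltW A0) // mulr_ile1.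
pose rho := 2 * (B * y); have r0 : 0 < rho by rewrite !mulr_gt0.
(* The centre has margin [cm ^+ 2 * A'] horizontally and [cm ^+ 2 * B] vertically, both at least
   [cm ^+ 4 * B]. *)
pose rad := cm ^+ 4 * B / 2.
have half_lt : rad < cm ^+ 4 * B.
  by rewrite /rad ltr_pdivrMr // ltr_pMr ?mulr_gt0 // ltr1n.
have rR : rho < rad.
  have -> : rho = B * (2 * y) by rewrite /rho; ring.
  have -> : rad = B * (cm ^+ 4 / 2) by rewrite /rad; ring.
  by rewrite ltr_pM2l //; move: y4 cm40; lra.
have Rd : (rad%:E <= diam K)%E.
  apply: le_trans dKle; rewrite lee_fin; apply: le_trans BdK; rewrite /rad.
  have : cm ^+ 4 * B <= B by rewrite ler_piMl ?(ltW B0) // (le_trans cm42).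
  by move: B0; lra.
have [q0 Kq] := K0.
pose x := psiw a b ij (nseq q l0 ++ [:: l1; l2] ++ nseq T ls ++ [:: l3; l4]) q0.
have x1 : pos a u0 + rad < x.1 < pos a u0 + wt a u0 - rad.
  have -> : x = psiw a b ij (nseq q l0 ++ [:: l1; l2] ++ nseq T ls) (psiw a b ij [:: l3; l4] q0).
    by rewrite -psiw_cat -!catA.
  rewrite psiw1; have -> : iw ij (nseq q l0 ++ [:: l1; l2] ++ nseq T ls) = u0.
    by rewrite /iw !map_cat !map_nseq.
  have /andP[ins _] := box_psiw a01 b01 a_sum b_sum attrK [:: l3; l4] Kq.
  have kk := inside_two_letters a01 a_sum cm01 cma l34 ins.
  rewrite wu0; apply: scaled_margin kk => //.
  have h : cm ^+ 2 * (cm ^+ 2 * B) <= cm ^+ 2 * A' by rewrite ler_pM2l.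
  by apply: lt_le_trans h; rewrite mulrA -exprD; exact: half_lt.
have x2 : pos b v0 + rad < x.2 < pos b v0 + wt b v0 - rad.
  rewrite /x psiw_cat psiw2 [jw ij (nseq q l0)]map_nseq -/v0 wv0.
  have /andP[_ ins] : box a b [::] [:: (ij l1).2; (ij l2).2]
      (psiw a b ij ([:: l1; l2] ++ nseq T ls ++ [:: l3; l4]) q0).
    by apply: (box_prefix a01 b01 a_sum b_sum attrK Kq); rewrite //= ?prefix0s ?eqxx ?prefix0s.
  have kk := inside_two_letters b01 b_sum cm01 cmb l12 ins.
  apply: scaled_margin kk => //.
  by apply: lt_le_trans half_lt _; rewrite ler_pM2r.
have By0 : 0 < B * y by rewrite mulr_gt0.
have [N3 hN3] := small_words ij a01 b01 By0.
pose N := (size u0 + N3)%N.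
pose L1 := stops b (column ls) T y.
pose L2 := stops a (enum (J1 ij)) N (B * y / A').
(* At the positions of [l1] and [l2] only the columns are forced on a point of the ball; the free
   rows cost the factor [s * s] in [D1]. *)
pose Lp : seq (seq 'I_s) := [seq [:: ja; jb] | ja <- enum 'I_s, jb <- enum 'I_s].
pose cells := [seq (u0 ++ u, v0 ++ v) | v <- [seq p ++ v | p <- Lp, v <- L1], u <- L2].
have cov : covers rho (eball x rad `&` K) (size cells).
  apply: (covers_seq (f := fun c => box a b c.1 c.2)).
    move=> c /allpairsP[[v u] /= [/allpairsP[[p v'] /= [_ vL ->]] uL ->]] /=.
    apply: box_diam => //.
      have := stopped_wt a01 (stops_stopped uL); rewrite wt_cat wu0.
      by rewrite ler_pdivlMr // mulrC.
    have := stopped_wt b01 (stops_stopped vL); rewrite !wt_cat wv0 => h.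
    rewrite ler_pM2l // -[leRHS]mul1r ler_pM ?wt_le1 //; exact/ltW/wt_gt0.
  move=> p [bp Kp]; have [z sz [q' Kq' pE]] := K_code attrK N Kp.
  have [p1 p2] : `|x.1 - p.1| <= rad /\ `|x.2 - p.2| <= rad.
    by split; apply: le_trans bp; [exact: edist_ge1|exact: edist_ge2].
  have := box_psiw a01 b01 a_sum b_sum attrK z Kq'; rewrite -pE => /andP[ia ib].
  have su0 : size u0 = (q + (2 + T))%N by rewrite !size_cat /= !size_nseq.
  have zu : take (size u0) (iw ij z) = u0.
    symmetry; apply: (interior_unique a01 a_sum (x := p.1)).
    - by rewrite size_takel // size_map sz leq_addr.
    - exact: interior_margin p1 x1.
    - by apply: (inside_prefix a01 a_sum _ ia); exact: prefix_take.
  have zv : take (size v0) (jw ij z) = v0.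
    symmetry; apply: (interior_unique b01 b_sum (x := p.2)).
    - by rewrite size_takel // size_map sz /N su0 size_nseq -!addnA leq_addr.
    - exact: interior_margin p2 x2.
    - by apply: (inside_prefix b01 b_sum _ ib); exact: prefix_take.
  pose z2 := take 2 (drop q z); pose z3 := take T (drop 2 (drop q z)).
  pose z4 := drop (size u0) z.
  have Ez : z = take q z ++ z2 ++ z3 ++ z4.
    rewrite /z4 su0 addnC -drop_drop addnC -drop_drop /z3 /z2.
    by rewrite !cat_take_drop.
  have Eiz : iw ij z = u0 ++ iw ij z4.
    by rewrite -{1}(cat_take_drop (size u0) (iw ij z)) zu /iw map_drop.
  have iz3 : iw ij z3 = nseq T i1.
    have -> : iw ij z3 = drop 2 (drop q (take (size u0) (iw ij z))).
      by rewrite su0 /z3 /iw map_take !map_drop !take_drop (addnC q) (addnC 2).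
    by rewrite zu /u0 drop_size_cat ?size_nseq //= drop0.
  have jz3 : {subset jw ij z3 <= column ls}.
    move=> j /mapP[l lz ->]; apply: map_f; rewrite mem_filter mem_enum andbT.
    have : (ij l).1 \in iw ij z3 by apply: map_f.
    by rewrite iz3 mem_nseq => /andP[_].
  have sz3 : size z3 = T by rewrite -(size_map (fun l => (ij l).1) z3) -/(iw ij z3) iz3 size_nseq.
  (* Hence the vertical word stops inside the run, where all letters lie in the column of [ls]. *)
  have wz3 : wt b (jw ij z3) <= y.
    apply: le_trans (wt_le_expr b01 (fun j _ => hbM j)) _.
    by rewrite size_map sz3.
  have [|wa wb] := hN3 z; first by rewrite sz leq_addl.
  have wz4 : wt a (iw ij z4) <= B * y / A'.
    by rewrite ler_pdivlMr // mulrC -wu0 -wt_cat -Eiz.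
  have Ejz : jw ij z = v0 ++ jw ij z2 ++ jw ij z3 ++ jw ij z4.
    rewrite {1}Ez /jw !map_cat map_take -zv size_nseq.
    by [].
  have sz2 : size z2 = 2%N.
    rewrite size_takel // size_drop sz /N su0 -addnA addKn -addnA leq_addr //.
  exists (u0 ++ cut a (B * y / A') (iw ij z4), v0 ++ jw ij z2 ++ cut b y (jw ij z3)).
    apply/allpairsP; exists (jw ij z2 ++ cut b y (jw ij z3), cut a (B * y / A') (iw ij z4)).
    split=> //=.
      apply/allpairsP; exists (jw ij z2, cut b y (jw ij z3)); split=> //=.
        case: z2 sz2 {Ez Ejz} => [|la [|lb [|]]] //= _.
        by apply/allpairsP; exists ((ij la).2, (ij lb).2); rewrite !mem_enum.
      apply: mem_stops; first exact: cut_stopped.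
        by move=> j /(mem_prefix (cut_prefix _ _ _)) /jz3.
      by rewrite -sz3 -(size_map (fun l => (ij l).2) z3); apply/size_prefix/cut_prefix.
    apply: mem_stops; first exact: cut_stopped.
      move=> i /(mem_prefix (cut_prefix _ _ _)) /mapP[l _ ->].
      by rewrite mem_enum inE; apply/set0Pn; exists l; rewrite inE.
    apply: leq_trans (size_prefix (cut_prefix _ _ _)) _.
    by rewrite size_map size_drop sz leq_subr.
  rewrite pE /=; apply: (box_prefix a01 b01 a_sum b_sum attrK Kq').
    by rewrite Eiz prefix_catr // eqxx cut_prefix.
  by rewrite Ejz prefix_catr // prefix_catr // !eqxx /= prefix_catl // cut_prefix.
have cnt : (size cells)%:R <= D1 * y `^ (- (t + e)).
  rewrite /cells !size_allpairs size_enum_ord !natrM.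
  have w0 : 0 < cm ^+ 2 * y by rewrite mulr_gt0.
  have c1 : (size L1)%:R <= (cm ^+ 2 * y) `^ (- e).
    apply: le_trans (size_stops_le b01 _ cm01 cmb e0 _ _) _; rewrite ?y0 ?big_column ?e_eq //.
    rewrite !powRN lef_pV2 ?posrE ?powR_gt0 ?mulr_gt0 //.
    apply: powR_le_l; rewrite ?(ltW w0) // ler_pM2r // expr2 ler_piMl ?(ltW cm0) //.
  have c2 : (size L2)%:R <= (cm ^+ 2 * y) `^ (- t).
    have w1 : 0 < B * y / A' <= 1.
      rewrite divr_gt0 //= ler_pdivrMr // mul1r; apply: le_trans A'B.
      by rewrite mulrC ler_pM2r.
    apply: le_trans (size_stops_le a01 _ cm01 cma t0 w1 _) _; first by rewrite big_enum t_eq.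
    have /andP[w10 _] := w1.
    rewrite !powRN lef_pV2 ?posrE ?powR_gt0 //; last exact: mulr_gt0.
    apply: powR_le_l; rewrite ?(ltW w0) // expr2 -mulrA ler_pM2l //.
    by rewrite ler_pdivlMr // mulrAC (mulrC cm) ler_pM2r.
  apply: (@le_trans _ _ (s%:R * s%:R * ((cm ^+ 2 * y) `^ (- e) * (cm ^+ 2 * y) `^ (- t)))).
    by rewrite -mulrA ler_pM2l ?mulr_gt0 // ler_pM.
  rewrite -powR_addr // -opprD (addrC e) powRM ?(ltW cm20) ?(ltW y0) //.
  by rewrite /D1 mulrA.
have := hC x rho rad (psiw_K attrK _ Kq) r0 rR Rd.
move=> /le_trans /(_ (covering_number_le cov)); rewrite lee_fin => /le_trans /(_ cnt).
have -> : rad / rho = cm ^+ 4 / 4 * y^-1.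
  by rewrite /rad /rho; field; rewrite !gt_eqF.
rewrite powRM ?invr_ge0 ?divr_ge0 ?(ltW cm40) ?(ltW y0) // powR_inv_l ?(ltW y0) // -powRN.
rewrite mulrA -/D2 => h.
by rewrite -(ler_pM2l D20) mulrA (mulrCA D2) divff ?gt_eqF // mulr1.
Qed.

End SpecialCells.

(** * General inequalities between dimensions *)

Section GeneralDimensions.
Context {R : realType}.
Implicit Types (E F : set (R * R)) (h t al rho de C D : R).

(** The slack 1 avoids showing that the infimum is attained; it is absorbed into constants later. *)
Lemma covering_number_attained rho E y : (covering_number rho E <= y%:E)%E ->
  exists2 n, covers rho E n & n%:R <= y + 1.
Proof.
move=> h; apply: contrapT => H.
have : ((y + 1)%:E <= covering_number rho E)%E.
  apply: covering_number_ge => n cn; rewrite leNgt; apply/negP => hn.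
  by apply: H; exists n => //; exact: ltW.
by move=> /le_trans /(_ h); rewrite lee_fin; lra.
Qed.

Lemma hausdorff_content_le h de rho E n : 0 <= h -> 0 < rho <= de -> covers rho E n ->
  (hausdorff_content h de E <= (n%:R * rho `^ h)%:E)%E.
Proof.
move=> h0 /andP[r0 rde] [U [hU EU]].
(* The finite cover is padded with empty sets, which weigh 0 for every exponent. *)
pose W k := if insub k is Some i then U (i : 'I_n) else set0.
have W0 : diam_pow h set0 = 0%E :> \bar R by rewrite /diam_pow eqxx.
apply: (@le_trans _ _ (\sum_(0 <= k <oo) diam_pow h (W k))%E).
  apply: ereal_inf_lbound; exists W => //; split=> [k|p /EU[i _ Ui]].
    rewrite /W; case: insubP => [i _ _|_].
      by apply: le_trans (hU i) _; rewrite lee_fin.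
    by apply: diam_le => //; exact: ltW (lt_le_trans r0 rde).
  by exists i => //; rewrite /W valK.
rewrite (nneseries_split 0 n) ?add0n => [|k _]; last exact: diam_pow_ge0.
rewrite (@eseries0 _ _ n) ?adde0; last first.
  by move=> k nk _; rewrite /W insubF // ltnNge nk.
rewrite big_mkord; apply: (@le_trans _ _ (\sum_(k < n) (rho `^ h)%:E)%E); last first.
  by rewrite sumEFin sumr_const card_ord mulr_natl.
apply: lee_sum => k _; rewrite /W valK.
have [->|/set0P U0] := eqVneq (U k) set0; first by rewrite W0 lee_fin powR_ge0.
rewrite (diam_powE h (hU k) U0) lee_fin; apply: powR_le_l => //.
  by apply/fine_ge0/diam_ge0.
by rewrite -lee_fin -(diam_fin_num (hU k)).
Qed.

Lemma hausdorff_content_ge0 h de E : (0 <= hausdorff_content h de E)%E.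
Proof.
apply/ereal_infP => _ [U _ <-]; apply: nneseries_ge0 => k _ _; exact: diam_pow_ge0.
Qed.

(** At radius [diam E] the ball contains all of [E], so an Assouad exponent [al] bounds the covering
    numbers of [E] itself, and the measure of exponent [al + ep] vanishes. *)
Lemma hausdorff_dim_le_assouad E : E !=set0 -> (0 < diam E)%E -> (diam E < +oo)%E ->
  (hausdorff_dim E <= assouad_dim E)%E.
Proof.
move=> [x Ex] d0 doo; apply/ereal_infP => _ [al [al0 [C C0 hC]] <-].
apply/lee_addgt0Pr => ep ep0; rewrite -EFinD.
have dE : diam E = (fine (diam E))%:E.
  by rewrite fineK // fin_numE -ltey doo andbT gt_eqF // (lt_trans _ d0) // ltNyr.
set D := fine (diam E) in dE.
have D0 : 0 < D by rewrite -lte_fin -dE.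
have eE : eball x D `&` E = E.
  apply/seteqP; split=> [y []|y Ey] //; split=> //.
  by rewrite /eball /= -lee_fin -dE; exact: diam_ub.
apply: ereal_inf_lbound; exists (al + ep) => //; split; first by rewrite addr_ge0 // ltW.
apply/le_anti/andP; split; last first.
  by apply: le_trans (hausdorff_content_ge0 (al + ep) 1 E) _; apply: ereal_sup_ubound; exists 1 => //=; exact: ltr01.
apply/ereal_supP => _ [de de0 <-]; apply/lee_addgt0Pr => e e0; rewrite add0e.
pose C1 := C * D `^ al + 1; have C10 : 0 < C1 by rewrite ltr_pwDr // mulr_ge0 ?powR_ge0 ?(ltW C0).
pose rho := Num.min (Num.min de (D / 2)) (Num.min 1 ((e / C1) `^ ep^-1)).
have x0 : 0 < e / C1 by rewrite divr_gt0.
have r0 : 0 < rho by rewrite !lt_min de0 divr_gt0 // ltr01 powR_gt0.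
have rde : rho <= de by rewrite /rho !ge_min lexx.
have rD : rho < D.
  by apply: (@le_lt_trans _ _ (D / 2)); [rewrite /rho !ge_min lexx orbT | lra].
have r1 : rho <= 1 by rewrite /rho !ge_min lexx !orbT.
have re : rho `^ ep <= e / C1.
  rewrite -[leRHS](@powR_rootK _ _ ep) ?gt_eqF ?(ltW x0) //.
  by apply: powR_le_l; rewrite ?(ltW ep0) ?(ltW r0) // /rho !ge_min lexx !orbT.
have := hC x rho D Ex r0 rD; rewrite dE lexx eE => /(_ isT) /covering_number_attained[n cn hn].
have rr : 0 < rho <= de by rewrite r0.
apply: le_trans (hausdorff_content_le _ rr cn) _; first by rewrite addr_ge0 // ltW.
rewrite lee_fin; apply: (@le_trans _ _ (C1 * rho `^ ep)); last first.
  by rewrite -ler_pdivlMl // mulrC.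
rewrite powR_addr // mulrA ler_wpM2r ?powR_ge0 //.
apply: (@le_trans _ _ ((C * (D / rho) `^ al + 1) * rho `^ al)).
  by rewrite ler_wpM2r ?powR_ge0.
rewrite powR_div ?(ltW D0) ?(ltW r0) // mulrDl mul1r lerD //; last first.
  by apply: powR_le1; rewrite // (ltW r0).
by rewrite -mulrA divfK // gt_eqF // powR_gt0.
Qed.

Lemma assouad_dim_ge0 E : (0 <= assouad_dim E)%E.
Proof. by apply/ereal_infP => _ [t [t0 _] <-]; rewrite lee_fin. Qed.

Lemma hausdorff_contentU h de E F : (hausdorff_content h de (E `|` F) <=
  hausdorff_content h de E + hausdorff_content h de F)%E.
Proof.
apply/lee_addgt0Pr => e e0.
have e20 : 0 < e / 2 by rewrite divr_gt0.
have [fE|] := boolP (hausdorff_content h de E \is a fin_num); last first.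
  rewrite fin_numE negb_and !negbK => /orP[/eqP E0|/eqP ->].
    by have := hausdorff_content_ge0 h de E; rewrite E0.
  rewrite addye ?addye ?leey //.
  by apply: contraTneq (hausdorff_content_ge0 h de F) => ->.
have [fF|] := boolP (hausdorff_content h de F \is a fin_num); last first.
  rewrite fin_numE negb_and !negbK => /orP[/eqP E0|/eqP ->].
    by have := hausdorff_content_ge0 h de F; rewrite E0.
  rewrite addey ?addye ?leey //.
  by apply: contraTneq (hausdorff_content_ge0 h de E) => ->.
have [_ [U [hU cU] <-] ltU] := lb_ereal_inf_adherent e20 fE.
have [_ [V [hV cV] <-] ltV] := lb_ereal_inf_adherent e20 fF.
(* The two covers are interleaved, even indices for [E] and odd ones for [F]. *)
pose W k := if odd k then V k./2 else U k./2.
apply: (@le_trans _ _ (\sum_(0 <= k <oo) diam_pow h (W k))%E).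
  apply: ereal_inf_lbound; exists W => //; split=> [k|p [/cU|/cV] [k _ ?]].
  - by rewrite /W; case: ifP.
  - by exists k.*2 => //; rewrite /W odd_double doubleK.
  - by exists k.*2.+1 => //; rewrite /W /= odd_double /= uphalf_double.
apply: (@le_trans _ _ (\sum_(0 <= k <oo) diam_pow h (U k) + \sum_(0 <= k <oo) diam_pow h (V k))%E); last first.
  have -> : e%:E = ((e / 2)%:E + (e / 2)%:E)%E by rewrite -EFinD -splitr.
  by rewrite addeACA leeD // ltW.
apply: lime_le; first by apply: is_cvg_nneseries => k _ _; exact: diam_pow_ge0.
apply: nearW => n.
apply: (@le_trans _ _ (\sum_(0 <= k < n.*2) diam_pow h (W k))%E).
  rewrite -addnn (big_cat_nat (leq0n n) (leq_addr n n)) /= leeDl //.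
  by apply: sume_ge0 => k _; exact: diam_pow_ge0.
have -> : (\sum_(0 <= k < n.*2) diam_pow h (W k) =
    \sum_(0 <= k < n) diam_pow h (U k) + \sum_(0 <= k < n) diam_pow h (V k))%E.
  elim: n => [|n IH]; first by rewrite !big_geq // adde0.
  rewrite doubleS !big_nat_recr //= IH /W /= odd_double /= doubleK uphalf_double.
  by rewrite -addeA addeACA.
by apply: leeD; apply: nneseries_lim_ge => k _ _; exact: diam_pow_ge0.
Qed.

Lemma hausdorff_measureU h E F : (hausdorff_measure h (E `|` F) <=
  hausdorff_measure h E + hausdorff_measure h F)%E.
Proof.
apply/ereal_supP => _ [de de0 <-]; apply: le_trans (hausdorff_contentU h de E F) _.
by apply: leeD; apply: ereal_sup_ubound; exists de.
Qed.

Lemma hausdorff_content_sub h de E F : E `<=` F ->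
  (hausdorff_content h de E <= hausdorff_content h de F)%E.
Proof.
move=> EF; apply/ereal_infP => _ [U [hU cU] <-]; apply: ereal_inf_lbound.
by exists U => //; split=> //; exact: subset_trans cU.
Qed.

Lemma hausdorff_measure_sub h E F : E `<=` F ->
  (hausdorff_measure h E <= hausdorff_measure h F)%E.
Proof.
move=> EF; apply/ereal_supP => _ [de de0 <-].
apply: le_trans (hausdorff_content_sub h de EF) _.
by apply: ereal_sup_ubound; exists de.
Qed.

Lemma hausdorff_measure_set0 h : hausdorff_measure h set0 = 0%E :> \bar R.
Proof.
apply/le_anti/andP; split.
  apply/ereal_supP => _ [de de0 <-].
  apply: (@le_trans _ _ (\sum_(0 <= k <oo) diam_pow h (@set0 (R * R)))%E).
    apply: ereal_inf_lbound; exists (fun=> set0) => //; split=> // k.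
    by apply: diam_le => //; exact: ltW.
  by rewrite eseries0 // => k _ _; rewrite /diam_pow eqxx.
apply: le_trans (hausdorff_content_ge0 h 1 set0) _.
by apply: ereal_sup_ubound; exists 1 => //=; exact: ltr01.
Qed.

Lemma hausdorff_measure_bigcup h n (U : 'I_n -> set (R * R)) (y : \bar R) :
  (forall i, (hausdorff_measure h (U i) <= y)%E) ->
  (hausdorff_measure h (\bigcup_i U i) <= n%:R%:E * y)%E.
Proof.
elim: n U => [|n IH] U hU.
  have -> : \bigcup_i U i = set0 by apply/seteqP; split=> // p [[]].
  by rewrite hausdorff_measure_set0 mul0e.
have y0 : (0 <= y)%E.
  apply: le_trans (hU ord0); apply: le_trans (hausdorff_content_ge0 h 1 (U ord0)) _.
  by apply: ereal_sup_ubound; exists 1 => //=; exact: ltr01.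
have -> : \bigcup_i U i = (\bigcup_i U (lift ord0 i)) `|` U ord0.
  apply/seteqP; split=> p.
    move=> [i _ Ui]; case: (unliftP ord0 i) Ui => [j ->|->] Uj; last by right.
    by left; exists j.
  by move=> [[i _ Ui]|Ui]; [exists (lift ord0 i)|exists ord0].
apply: le_trans (hausdorff_measureU _ _ _) _.
rewrite -natr1 EFinD ge0_muleDl // mul1e leeD //.
by apply: IH.
Qed.

(** A covering set of diameter at most [rho] that meets [E] lies, within [E], in a ball of radius
    [rho] about one of its points, so its measure is at most [c * rho^h]. A ball of radius [rad] has
    measure at least [rad^h / c] and thus needs at least [(rad / rho)^h / c^2] such sets. *)
Lemma ahlfors_lower E : ahlfors_regular E -> (hausdorff_dim E <= lower_dim E)%E.
Proof.
move=> [h hE [c c0 hc]]; rewrite hE.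
have h0 : 0 <= h by rewrite -lee_fin -hE hausdorff_dim_ge0.
apply: ereal_sup_ubound; exists h => //; split=> //.
exists (c^-1 / c) => [|x rho rad Ex r0 rR Rd]; first by rewrite divr_gt0 // invr_gt0.
have rad0 := lt_trans r0 rR.
have rd : (rho%:E <= diam E)%E by apply: le_trans Rd; rewrite lee_fin ltW.
apply: covering_number_ge => n [U [hU EU]].
have [low _] := hc x rad Ex rad0 Rd.
have up : (hausdorff_measure h (eball x rad `&` E) <= n%:R%:E * (c * rho `^ h)%:E)%E.
  apply: (@le_trans _ _ (hausdorff_measure h (\bigcup_i (U i `&` E)))).
    by apply: hausdorff_measure_sub => p [bp Ep]; have [i _ Ui] := EU p (conj bp Ep); exists i.
  apply: hausdorff_measure_bigcup => i.
  have [[y [Uy Ey]]|ne] := pselect (U i `&` E !=set0).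
    have [_ u] := hc y rho Ey r0 rd; apply: le_trans u; apply: hausdorff_measure_sub.
    move=> p [Up Ep]; split=> //; rewrite /eball /= -lee_fin.
    by apply: le_trans (diam_ub Uy Up) (hU i).
  have -> : U i `&` E = set0 by apply/seteqP; split=> // p UE; case: ne; exists p.
  by rewrite hausdorff_measure_set0 lee_fin mulr_ge0 ?powR_ge0 ?(ltW c0).
have := le_trans low up; rewrite -EFinM lee_fin => h1.
rewrite powR_div ?(ltW r0) ?(ltW rad0) //.
rewrite -(ler_pM2r (mulr_gt0 c0 (powR_gt0 h r0))); apply: le_trans h1.
by apply: eq_ler; field; rewrite !gt_eqF ?powR_gt0.
Qed.

End GeneralDimensions.

(** * Box dimension from covering numbers *)

Section BoxDimension.
Context {R : realType}.
Implicit Types (E : set (R * R)) (C D rho e : R).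

Local Notation boxq E rho :=
  (lne (covering_number rho E) * ((- ln rho)^-1)%:E)%E.

Let lne_fin (y : R) : 0 < y -> lne y%:E = (ln y)%:E.
Proof. by move=> y0; rewrite /lne leNgt y0. Qed.

Lemma covering_number_ge0 rho E : (0 <= covering_number rho E)%E.
Proof. by apply: covering_number_ge => n _. Qed.

Let in0y (x : \bar R) : (0 <= x)%E -> x \in `[0%E, +oo%E].
Proof. by move=> x0; rewrite in_itv /= x0 leey. Qed.

Let ln_powN rho t : 0 < rho -> ln (rho `^ (- t)) = t * - ln rho.
Proof. by move=> r0; rewrite ln_powR mulNr mulrN. Qed.

Lemma boxq_le E C D rho : 0 < C -> 0 < rho < 1 ->
  (covering_number rho E <= (C * rho `^ (- D))%:E)%E ->
  (boxq E rho <= (D + ln C / - ln rho)%:E)%E.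
Proof.
move=> C0 /andP[r0 r1] h.
have y0 : 0 < C * rho `^ (- D) by rewrite mulr_gt0 ?powR_gt0.
have L0 : 0 < - ln rho by rewrite oppr_gt0 ln_lt0 // r0.
have : (lne (covering_number rho E) <= lne (C * rho `^ (- D))%:E)%E.
  by rewrite lee_lne // in0y ?covering_number_ge0 // lee_fin ltW.
rewrite lne_fin // => h1.
have i0 : (0 <= ((- ln rho)^-1)%:E)%E by rewrite lee_fin invr_ge0 ltW.
apply: le_trans (lee_wpmul2r i0 h1) _; rewrite -EFinM lee_fin.
rewrite lnM ?posrE ?powR_gt0 // ln_powN // mulrDl mulfK ?gt_eqF //.
by rewrite addrC.
Qed.

Lemma boxq_ge E C D rho : 0 < C -> 0 < rho < 1 ->
  ((C * rho `^ (- D))%:E <= covering_number rho E)%E ->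
  ((D + ln C / - ln rho)%:E <= boxq E rho)%E.
Proof.
move=> C0 /andP[r0 r1] h.
have y0 : 0 < C * rho `^ (- D) by rewrite mulr_gt0 ?powR_gt0.
have L0 : 0 < - ln rho by rewrite oppr_gt0 ln_lt0 // r0.
have : (lne (C * rho `^ (- D))%:E <= lne (covering_number rho E))%E.
  by rewrite lee_lne // in0y ?covering_number_ge0 // lee_fin ltW.
rewrite lne_fin // => h1.
have i0 : (0 <= ((- ln rho)^-1)%:E)%E by rewrite lee_fin invr_ge0 ltW.
apply: le_trans (lee_wpmul2r i0 h1); rewrite -EFinM lee_fin.
rewrite lnM ?posrE ?powR_gt0 // ln_powN // mulrDl mulfK ?gt_eqF //.
by rewrite addrC.
Qed.

Let near_log C e de : 0 < e -> 0 < de ->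
  \forall rho \near (0 : R)^'+, [/\ 0 < rho < 1, rho <= de & `|ln C / - ln rho| <= e].
Proof.
move=> e0 de0; pose L := `|ln C| / e + 1.
have L0 : 0 < L by rewrite ltr_wpDl // divr_ge0 // ltW.
near=> rho.
have r0 : 0 < rho by near: rho; exact: nbhs_right_gt.
have r1 : rho < expR (- L) by near: rho; apply: nbhs_right_lt; exact: expR_gt0.
have r2 : rho < de by near: rho; exact: nbhs_right_lt.
have l1 : L < - ln rho.
  by rewrite ltrNr -(expRK (- L)) ltr_ln ?posrE ?expR_gt0.
have l0 : 0 < - ln rho by apply: lt_trans l1.
split; last 1 first.
- rewrite normrM normfV (gtr0_norm l0) ler_pdivrMr //.
  rewrite -ler_pdivrMl // mulrC; apply: le_trans (ltW l1).
  by rewrite /L lerDl.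
- by rewrite r0 (lt_trans r1) // -[ltRHS]expR0 ltr_expR oppr_lt0.
- exact: ltW.
Unshelve. all: by end_near. Qed.

Lemma box_dim_le E D (y : \bar R) C : 0 < C ->
  (forall rho, 0 < rho <= 1 -> exists2 n, covers rho E n & n%:R <= C * rho `^ (- D)) ->
  box_dim_is E y -> (y <= D%:E)%E.
Proof.
move=> C0 hC hy; apply/lee_addgt0Pr => e e0.
apply: cvge_to_le hy _; have := near_log C e0 ltr01; apply: filterS => rho [r01 r1 re].
have /andP[r0 _] := r01.
have [|n cn hn] := hC rho; first by rewrite r0.
have : (covering_number rho E <= (C * rho `^ (- D))%:E)%E.
  by apply: le_trans (covering_number_le cn) _; rewrite lee_fin.
move=> /(boxq_le C0 r01) /le_trans; apply; rewrite -EFinD lee_fin lerD2l.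
by apply: le_trans re; exact: ler_norm.
Qed.

(** Assouad exponents near [A] bound the covering numbers from above. For exponents below [A] the
    Hausdorff content at some scale is positive, and [hausdorff_content_le] turns this into a lower
    bound. *)
Lemma box_dim_assouad E (A : R) : E !=set0 -> (0 < diam E)%E -> (diam E < +oo)%E ->
  assouad_dim E = A%:E -> hausdorff_dim E = A%:E -> box_dim_is E A%:E.
Proof.
move=> [x Ex] d0 doo hA hH.
have dE : diam E = (fine (diam E))%:E.
  by rewrite fineK // fin_numE -ltey doo andbT gt_eqF // (lt_trans _ d0) // ltNyr.
set D := fine (diam E) in dE.
have D0 : 0 < D by rewrite -lte_fin -dE.
have eE : eball x D `&` E = E.
  apply/seteqP; split=> [y []|y Ey] //; split=> //.
  by rewrite /eball /= -lee_fin -dE; exact: diam_ub.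
have A0 : 0 <= A by rewrite -lee_fin -hA assouad_dim_ge0.
have up e : 0 < e -> \forall rho \near (0 : R)^'+, (boxq E rho <= (A + e)%:E)%E.
  move=> e0; have e20 : 0 < e / 2 by rewrite divr_gt0.
  have fA : assouad_dim E \is a fin_num by rewrite hA.
  have [_ [al [al0 [C C0 hC]] <-]] := lb_ereal_inf_adherent e20 fA.
  rewrite -/(assouad_dim E) hA -EFinD lte_fin => alA.
  have C10 : 0 < C * D `^ al by rewrite mulr_gt0 ?powR_gt0.
  have D20 : 0 < D / 2 by exact: divr_gt0.
  have := near_log (C * D `^ al) e20 D20; apply: filterS => rho [r01 rD re]; have /andP[r0 _] := r01.
  have rD' : rho < D by apply: le_lt_trans rD _; rewrite ltr_pdivrMr // ltr_pMr // ltr1n.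
  have := hC x rho D Ex r0 rD'; rewrite dE lexx eE => /(_ isT).
  rewrite powR_div ?(ltW D0) ?(ltW r0) // mulrA -powRN => /(boxq_le C10 r01) /le_trans; apply.
  by rewrite lee_fin; move: re alA; rewrite ler_norml => /andP[_]; lra.
have low e : 0 < e -> \forall rho \near (0 : R)^'+, ((A - e)%:E <= boxq E rho)%E.
  move=> e0; have e20 : 0 < e / 2 by rewrite divr_gt0.
  (* Only nonnegative exponents enter [hausdorff_dim]; when [A - e / 2 <= 0], it suffices that a
     nonempty set needs at least one covering set. *)
  have [t0|t0] := leP (A - e / 2) 0.
    have := near_log 1 e20 ltr01; apply: filterS => rho [r01 _ re].
    have n1 : ((1 * rho `^ (- 0))%:E <= covering_number rho E)%E.
      rewrite oppr0 powRr0 mulr1; apply: covering_number_ge => -[|n] //.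
        by move=> [U [_ /(_ x Ex) [[]]]].
      by move=> _; rewrite ler1n.
    have := boxq_ge ltr01 r01 n1; rewrite ln1 mul0r addr0; apply: le_trans.
    by rewrite lee_fin; lra.
  have ht : hausdorff_measure (A - e / 2) E <> 0%E.
    move=> h; have : (hausdorff_dim E <= (A - e / 2)%:E)%E.
      by apply: ereal_inf_lbound; exists (A - e / 2) => //; split=> //; exact: ltW.
    by rewrite hH lee_fin; lra.
  have [de de0 hde] : exists2 de : R, 0 < de & (0 < hausdorff_content (A - e / 2) de E)%E.
    apply: contrapT => H; apply: ht; apply/le_anti/andP; split.
      apply/ereal_supP => _ [de de0 <-]; rewrite leNgt; apply/negP => h.
      by apply: H; exists de.
    apply: le_trans (hausdorff_content_ge0 (A - e / 2) 1 E) _.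
    by apply: ereal_sup_ubound; exists 1 => //=; exact: ltr01.
  have [c c0 hc] : exists2 c : R, 0 < c & (c%:E <= hausdorff_content (A - e / 2) de E)%E.
    case: (hausdorff_content _ _ _) hde => [c| |] //; last by exists 1; rewrite ?leey.
    by rewrite lte_fin => c0; exists c.
  have := near_log c e20 de0; apply: filterS => rho [r01 rde re]; have /andP[r0 _] := r01.
  have cn : ((c * rho `^ (- (A - e / 2)))%:E <= covering_number rho E)%E.
    apply: covering_number_ge => n cn; rewrite powRN ler_pdivrMr ?powR_gt0 //.
    rewrite -lee_fin; apply: le_trans hc _; apply: hausdorff_content_le cn; first exact: ltW.
    by rewrite r0.
  apply: le_trans (boxq_ge c0 r01 cn); rewrite lee_fin.
  by move: re; rewrite ler_norml => /andP[]; lra.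
apply/fine_cvgP; split.
  have := low 1 ltr01; have := up 1 ltr01; apply: filterS2 => rho h1 h2.
  rewrite fin_numE; apply/andP; split.
    by apply: contraTneq h2 => ->.
  by apply: contraTneq h1 => ->.
apply/cvgrPdist_le => e e0; have := low e e0; have := up e e0; apply: filterS2 => rho.
rewrite /=; case: (_ * _)%E => [y| |] //; rewrite !lee_fin /= => h1 h2.
by rewrite ler_norml; apply/andP; split; lra.
Qed.

End BoxDimension.

(** * The four exponents *)

Section Topology.
Context {R : realType}.

Lemma compact_swp (E : set (R * R)) : compact E -> compact (swp E).
Proof.
move=> cE; have -> : swp E = (@unstable.swap R R) @` E.
  apply/seteqP; split=> [p Ep|_ [p Ep <-]].
    by exists (p.2, p.1) => //=; case: (p).
  by rewrite /swp /=; case: p Ep.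
by apply: continuous_compact => //; apply: continuous_subspaceT; exact: swap_continuous.
Qed.

Lemma closed_eball (x : R * R) rad : closed (eball x rad).
Proof.
have cont : continuous (fun y : R * R => edist x y).
  move=> y; apply: (@continuous_comp _ _ _
    (fun y : R * R => (x.1 - y.1) ^+ 2 + (x.2 - y.2) ^+ 2) Num.sqrt); last exact: sqrt_continuous.
  apply: cvgD; under eq_fun do rewrite expr2.
    by apply: cvgM; apply: cvgB; [exact: cvg_cst|exact: cvg_fst|exact: cvg_cst|exact: cvg_fst].
  by apply: cvgM; apply: cvgB; [exact: cvg_cst|exact: cvg_snd|exact: cvg_cst|exact: cvg_snd].
have -> : eball x rad = (fun y => edist x y) @^-1` [set u | u <= rad] by [].
by apply: closed_comp; [move=> y _; exact: cont | exact: closed_le].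
Qed.

End Topology.

(** * Reflection of the carpet *)

Section SwapCarpet.
Context {R : realType} {r s d : nat}.
Variables (a : 'I_r -> R) (b : 'I_s -> R) (ij : 'I_d -> 'I_r * 'I_s) (K : set (R * R)).
Local Notation ji := (swap_ij ij).

Lemma psiw_swap w (p : R * R) :
  psiw b a ji w (p.2, p.1) = ((psiw a b ij w p).2, (psiw a b ij w p).1).
Proof. by elim: w => //= l w ->. Qed.

Lemma attractor_swp : attractor a b ij K -> attractor b a ji (swp K).
Proof.
move=> [[p Kp] cK EK]; split; first by exists (p.2, p.1); rewrite /swp /=; case: p Kp.
  exact: compact_swp.
apply/seteqP; split=> [[q1 q2]|_ [l _ [q Kq <-]]].
  rewrite /swp /= {1}EK => -[l _ [q Kq qE]].
  exists l => //; exists (q.2, q.1); first by rewrite /swp /=; case: q Kq {qE}.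
  by have := psiw_swap [:: l] q; rewrite /psiw [foldr _ _ _ in RHS]/= qE.
have -> : psi b a ji l q = psiw b a ji [:: l] ((q.2, q.1).2, (q.2, q.1).1) by case: q {Kq}.
rewrite psiw_swap; set p' := psiw _ _ _ _ _; suff : K p' by case: p'.
rewrite EK; by exists l => //; exists (q.2, q.1).
Qed.

End SwapCarpet.

Section Exponents.
Context {R : realType} {r s d : nat}.
Variables (a : 'I_r -> R) (b : 'I_s -> R) (ij : 'I_d -> 'I_r * 'I_s).
Hypothesis a01 : forall i, 0 < a i < 1.
Hypothesis b01 : forall j, 0 < b j < 1.
Hypothesis d0 : (0 < d)%N.

Let lb := Ordinal d0.
Local Notation S1 := (S1 b ij).
Local Notation lo := (inf (range S1)).
Local Notation hi := (sup (range S1)).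

Lemma sum_fibI i (F : 'I_d -> R) :
  \sum_(m in fibI ij i) F m = \sum_(m | (ij m).1 == i) F m.
Proof. by apply: eq_bigl => m; rewrite inE. Qed.

Let fib_neq0 l : fibI ij (ij l).1 != finset.set0.
Proof. by apply/set0Pn; exists l; rewrite inE. Qed.

Let bl01 l : 0 < b (ij l).2 < 1. Proof. by []. Qed.

Lemma S1_eq l : \sum_(m in fibI ij (ij l).1) b (ij m).2 `^ S1 l = 1.
Proof. exact: (moran_xget (fib_neq0 l) bl01). Qed.

Lemma S1_col l m : (ij m).1 = (ij l).1 -> S1 m = S1 l.
Proof. by rewrite /S1 => ->. Qed.

Lemma S1_col_eq l : \sum_(m | (ij m).1 == (ij l).1) b (ij m).2 `^ S1 m = 1.
Proof.
rewrite -(S1_eq l) sum_fibI; apply: eq_bigr => m /eqP ml.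
by rewrite (S1_col ml).
Qed.

Lemma S1_ge0 l : 0 <= S1 l.
Proof. exact: (moran_ge0 (fib_neq0 l) bl01 (S1_eq l)). Qed.

Lemma J1_neq0 : J1 ij != finset.set0.
Proof. by apply/set0Pn; exists (ij lb).1; rewrite inE. Qed.

Lemma t1_moran : moran1 a ij (t1 a ij).
Proof.
have E := moran_xget J1_neq0 a01; split=> //.
exact: (moran_ge0 J1_neq0 a01 E).
Qed.

Lemma S1_max : exists2 l, S1 l = hi & forall m, S1 m <= S1 l.
Proof.
case: (@arg_maxP _ _ _ lb xpredT S1 isT) => l _ hl; exists l => [|m]; last exact: hl.
apply/le_anti/andP; split.
  apply: ub_le_sup; last by exists l.
  by exists (S1 l) => _ [m _ <-]; exact: hl.
apply: ge_sup; first by exists (S1 l), l.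
by move=> _ [m _ <-]; exact: hl.
Qed.

Lemma S1_min : exists2 l, S1 l = lo & forall m, S1 l <= S1 m.
Proof.
case: (@arg_minP _ _ _ lb xpredT S1 isT) => l _ hl; exists l => [|m]; last exact: hl.
apply/le_anti/andP; split.
  apply: lb_le_inf; first by exists (S1 l), l.
  by move=> _ [m _ <-]; exact: hl.
apply: ge_inf; last by exists l.
by exists (S1 l) => _ [m _ <-]; exact: hl.
Qed.

Lemma lo_le l : lo <= S1 l.
Proof. by have [m <- h] := S1_min. Qed.

Lemma le_hi l : S1 l <= hi.
Proof. by have [m <- h] := S1_max. Qed.

Lemma lo_ge0 : 0 <= lo.
Proof. by have [m <- _] := S1_min; exact: S1_ge0. Qed.

Lemma hi_ge0 : 0 <= hi.
Proof. by have [m <- _] := S1_max; exact: S1_ge0. Qed.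

Lemma lo_le_hi : lo <= hi.
Proof. exact: le_trans (lo_le lb) (le_hi lb). Qed.

(** By uniqueness of Moran exponents a common [t] must be [S1 l] for every [l]. The fibre condition
    thus becomes an equality of exponents, the form used in the final comparison. *)
Lemma uvfP : uniform_vertical_fibres b ij <-> lo = hi.
Proof.
split=> [[t t0 ht]|E].
  have St l : S1 l = t.
    apply: (sum_powR_inj (fib_neq0 l) bl01); rewrite S1_eq ht //.
    by rewrite inE fib_neq0.
  have [l <- _] := S1_min; have [m <- _] := S1_max; by rewrite !St.
have Slo l : S1 l = lo by apply/le_anti; rewrite lo_le andbT E le_hi.
exists lo; first exact: lo_ge0.
move=> i; rewrite inE => /set0Pn[l]; rewrite inE => /eqP <-.
by rewrite -(Slo l) S1_eq.
Qed.

Lemma uvf_const : uniform_vertical_fibres b ij -> forall l, S1 l = lo.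
Proof. by move=> /uvfP E l; apply/le_anti; rewrite lo_le andbT E le_hi. Qed.

Lemma local_exponent_hi al : t1 a ij + hi <= al -> local_exponent a b ij al.
Proof.
move=> h; exists (t1 a ij), hi; split=> //; first exact: t1_moran.
  exact: hi_ge0.
move=> i; case: (pickP (fun l => (ij l).1 == i)) => [l /eqP <-|E]; last first.
  by rewrite big_pred0.
rewrite -sum_fibI; apply: (moran_le bl01 (S1_eq l)); exact: le_hi.
Qed.

(** If [S1] is not constant, the weighted sum [X] at exponent [hi] is strictly below 1, which leaves
    room to lower the exponent. *)
Lemma global_exponent_lt : ~ uniform_vertical_fibres b ij ->
  exists2 al, al < t1 a ij + hi & global_exponent a b ij al.
Proof.
move=> nu; have [l0 l0E hmin] := S1_min.
have lohi : S1 l0 < hi.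
  rewrite lt_neqAle le_hi andbT; apply/eqP => E; apply: nu; apply/uvfP.
  by rewrite -l0E.
have [t10 t1E] := t1_moran.
have [cm /andP[cm0 _] [cma cmb]] := ratio_bounds a01 b01.
have cm1 : cm < 1 by apply: le_lt_trans (cmb (ij lb).2) _; case/andP: (b01 (ij lb).2).
have b_gt0 l : 0 < b (ij l).2 by case/andP: (bl01 l).
have a_gt0 l : 0 < a (ij l).1 by case/andP: (a01 (ij l).1).
pose X := \sum_l a (ij l).1 `^ t1 a ij * b (ij l).2 `^ hi.
have X0 : 0 < X.
  rewrite /X (bigD1 lb) //=; apply: ltr_pwDl; first by rewrite mulr_gt0 ?powR_gt0.
  by apply: sumr_ge0 => l _; rewrite mulr_ge0 ?powR_ge0.
have X1 : X < 1.
  rewrite -(sum_colw t1E S1_col_eq) /X (bigD1 l0) //= [ltRHS](bigD1 l0) //=.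
  apply: ltr_leD; first by rewrite /colw ltr_pM2l ?powR_gt0 // powR_lt1_mono.
  apply: ler_sum => l _; rewrite /colw ler_wpM2l ?powR_ge0 //.
  by apply: powR_le1_mono; [case/andP: (bl01 l) => -> /ltW | exact: le_hi].
pose ep := ln X / ln cm.
have ep0 : 0 < ep.
  by rewrite /ep nmulr_rgt0 ?invr_lt0 ln_lt0 // ?X0 ?cm0.
have cmX : cm `^ ep = X by rewrite /ep powR_of_base // cm0.
(* Lowering the exponent by at most [ep] multiplies each term by at most [1 / X], as [cm^ep = X].
   The maximum with [S1 l0] keeps [sg] nonnegative and still below [hi]. *)
pose sg := Num.max (hi - ep) (S1 l0).
have sghi : sg < hi by rewrite gt_max lohi andbT gtrBl.
exists (t1 a ij + sg); first by rewrite ltrD2l.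
exists (t1 a ij), sg; split=> //.
  by rewrite le_max S1_ge0 orbT.
rewrite -(@ler_pM2r _ X) // mul1r big_distrl /=; apply: ler_sum => l _.
rewrite -mulrA ler_wpM2l ?powR_ge0 //.
have -> : b (ij l).2 `^ hi = b (ij l).2 `^ sg * b (ij l).2 `^ (hi - sg).
  by rewrite -powR_addr // addrC subrK.
rewrite ler_wpM2l ?powR_ge0 // -cmX.
apply: (@le_trans _ _ (cm `^ (hi - sg))); last first.
  apply: powR_le_l; rewrite ?subr_ge0 ?(ltW sghi) ?(ltW cm0) //; exact: cmb.
apply: powR_le1_mono; first by rewrite cm0 ltW.
by rewrite lerBlDl -lerBlDr le_max lexx.
Qed.

End Exponents.

Definition const_exponent (R : realType) (r s d : nat) (a : 'I_r -> R) (b : 'I_s -> R)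
    (ij : 'I_d -> 'I_r * 'I_s) (h : R) :=
  exists t e, [/\ moran1 a ij t, 0 <= e, t + e = h &
    forall l, \sum_(m | (ij m).1 == (ij l).1) b (ij m).2 `^ e = 1].

Section Carpet.
Context {R : realType} {r s d : nat}.
Variables (a : 'I_r -> R) (b : 'I_s -> R) (ij : 'I_d -> 'I_r * 'I_s) (K : set (R * R)).
Hypothesis a01 : forall i, 0 < a i < 1.
Hypothesis b01 : forall j, 0 < b j < 1.
Hypothesis a_sum : \sum_(i < r) a i = 1.
Hypothesis b_sum : \sum_(j < s) b j = 1.
Hypothesis ij_inj : injective ij.
Hypothesis attrK : attractor a b ij K.
Local Notation ji := (swap_ij ij).
Local Notation t1 := (t1 a ij).
Local Notation lo := (inf (range (S1 b ij))).
Local Notation hi := (sup (range (S1 b ij))).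

(** If all letters share a column, two points coded to the same depth have the same horizontal word,
    so their abscissae differ by an arbitrarily small contraction. *)
Lemma distinct_columns : ~ (exists c, forall p, K p -> p.1 = c) ->
  exists l l', (ij l).1 != (ij l').1.
Proof.
move=> nv; apply: contrapT => H; apply: nv.
have same l l' : (ij l).1 = (ij l').1.
  by apply/eqP/negPn/negP => h; apply: H; exists l, l'.
have [[q0 Kq] _ _] := attrK; exists q0.1 => p Kp.
apply/eqP; rewrite -subr_eq0 -normr_le0; apply/ler_addgt0Pr => e e0; rewrite add0r.
have [N hN] := small_words ij a01 b01 e0.
have [z sz [q Kq' ->]] := K_code attrK N Kp.
have [z' sz' [q' Kq'' ->]] := K_code attrK N Kq.
have E : iw ij z = iw ij z'.
  have : size z = size z' by rewrite sz sz'.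
  elim: z z' {sz sz'} => [|l z IH] [|l' z'] //= [h].
  by rewrite (same l l') (IH z').
have [|wa _] := hN z'; first by rewrite sz'.
rewrite !psiw1 E opprD addrACA subrr add0r -mulrBr normrM gtr0_norm ?wt_gt0 //.
apply: le_trans wa; rewrite ler_piMr ?(ltW (wt_gt0 a01 _)) //.
have [/andP[? ?] _] := K_unit a01 b01 a_sum b_sum attrK Kq'.
have [/andP[? ?] _] := K_unit a01 b01 a_sum b_sum attrK Kq''.
by rewrite ler_norml; apply/andP; split; lra.
Qed.

Lemma diam_K_gt0 : ~ (exists c, forall p, K p -> p.1 = c) ->
  exists2 dK : R, 0 < dK & (dK%:E <= diam K)%E.
Proof.
move=> nv; have [[q0 Kq] _ _] := attrK.
have [p [Kp pq]] : exists p, K p /\ p.1 != q0.1.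
  apply: contrapT => H; apply: nv; exists q0.1 => p Kp.
  by apply/eqP/negPn/negP => h; apply: H; exists p.
exists `|p.1 - q0.1|; first by rewrite normr_gt0 subr_eq0.
by apply: le_trans (diam_ub Kp Kq); rewrite lee_fin; exact: edist_ge1.
Qed.

(** A cell of scale [rho / 2] has diameter at most [rho], so the ball about one of its coded points
    contains the images of all words through that cell. *)
Lemma ball_measure_lower h : const_exponent a b ij h -> 0 < h ->
  exists2 c : R, 0 < c & forall rho z q, 0 < rho <= 2 -> K q ->
    wt a (iw ij z) <= rho / 2 -> wt b (jw ij z) <= rho / 2 ->
    (size (cut b (rho / 2) (jw ij z)) <= size (cut a (rho / 2) (iw ij z)))%N ->
    ((c * rho `^ h)%:E <= hausdorff_measure h (eball (psiw a b ij z q) rho `&` K))%E.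
Proof.
move=> [t [smin [[t0 tE] s0 <- sE]]] h0.
have [c c0 hc] := @local_mass_bound _ _ _ _ _ _ _ _ a01 b01 a_sum b_sum ij_inj attrK
  t smin (fun=> smin) t0 tE sE s0 (fun=> lexx _) (fun=> erefl) h0.
exists (c * 2^-1 `^ (t + smin)); first by rewrite mulr_gt0 ?powR_gt0 ?invr_gt0.
move=> rho z q /andP[r0 r2] Kq wa wb sz.
have r01 : 0 < rho / 2 <= 1 by apply/andP; split; lra.
apply: le_trans (hc (rho / 2) z q _ r01 Kq wa wb sz _ _).
- rewrite lee_fin -mulrA -powRM ?invr_ge0 ?(ltW r0) // (mulrC 2^-1) //.
- rewrite setIC; apply: compact_closedI; last exact: closed_eball.
  by case: attrK.
- move=> w hu hv; split; last exact: (psiw_K attrK).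
  rewrite /eball /= -lee_fin.
  have bz := box_prefix a01 b01 a_sum b_sum attrK Kq
    (cut_prefix a (rho / 2) (iw ij z)) (cut_prefix b (rho / 2) (jw ij z)).
  have bw := box_prefix a01 b01 a_sum b_sum attrK Kq hu hv.
  apply: le_trans (diam_ub bz bw) _.
  have -> : rho = 2 * (rho / 2) by field.
  apply: (box_diam a01); have -> : 2 * (rho / 2) / 2 = rho / 2 by field.
    exact/(stopped_wt a01)/cut_stopped.
  exact/(stopped_wt b01)/cut_stopped.
Qed.

Hypothesis d0 : (0 < d)%N.

Lemma hausdorff_ge_lo : ((t1 + lo)%:E <= hausdorff_dim K)%E.
Proof.
have [t0 tE] := t1_moran ij a01 d0.
exact: (hausdorff_dim_ge_col a01 b01 a_sum b_sum ij_inj attrK t0 tE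
  (S1_col_eq ij b01) (lo_ge0 ij b01 d0) (lo_le b ij d0)).
Qed.

Lemma hausdorff_gt_lo : ~ uniform_vertical_fibres b ij ->
  ((t1 + lo)%:E < hausdorff_dim K)%E.
Proof.
move=> nu; have [t0 tE] := t1_moran ij a01 d0.
have [|ga ga0] := hausdorff_dim_gt_col a01 b01 a_sum b_sum ij_inj attrK t0 tE
  (S1_col_eq ij b01) (lo_ge0 ij b01 d0) (lo_le b ij d0).
  have [l lE _] := S1_max b ij d0; exists l; rewrite lE lt_neqAle lo_le_hi // andbT.
  by apply/eqP => E; apply: nu; apply/(uvfP ij b01 d0).
by apply: lt_le_trans; rewrite lte_fin ltrDl.
Qed.

Variables (l1 l2 l3 l4 : 'I_d) (dK : R).
Hypothesis l12 : (ij l1).2 != (ij l2).2.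
Hypothesis l34 : (ij l3).1 != (ij l4).1.
Hypothesis dK0 : 0 < dK.
Hypothesis dKle : (dK%:E <= diam K)%E.

(** With two nonempty columns the sum at exponent 0 is at least 2. This makes the exponents
    [t1 + S1] positive. *)
Lemma t1_gt0 : 0 < t1.
Proof.
have [t0 tE] := t1_moran ij a01 d0; rewrite lt_neqAle t0 andbT; apply/eqP => t1E.
move: tE; rewrite -t1E (bigD1 (ij l3).1) /=; last by rewrite inE; apply/set0Pn; exists l3; rewrite inE.
rewrite (bigD1 (ij l4).1) /=; last first.
  by rewrite eq_sym l34 andbT inE; apply/set0Pn; exists l4; rewrite inE.
rewrite !powRr0; set x := \sum_(_ | _) _ => E.
have x0 : 0 <= x by apply: sumr_ge0 => i _; exact: powR_ge0.
by move: E x0; lra.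
Qed.

Lemma not_vertical_letter : ~~ vertical_type a b ij -> exists l, b (ij l).2 < a (ij l).1.
Proof.
by move=> /forallPn[l]; rewrite -ltNge => h; exists l.
Qed.

Lemma assouad_ge_hi : ~~ vertical_type a b ij -> ((t1 + hi)%:E <= assouad_dim K)%E.
Proof.
move=> /not_vertical_letter[l0 ba]; have [t0 tE] := t1_moran ij a01 d0.
have [l <- _] := S1_max b ij d0.
apply: (@assouad_ge _ _ _ _ _ _ _ _ a01 b01 a_sum b_sum ij_inj attrK _ _ dK l0 l ba dK0 dKle t0 tE).
  exact: S1_ge0.
by rewrite -sum_fibI S1_eq.
Qed.

Lemma lower_le_lo : ~~ vertical_type a b ij -> (lower_dim K <= (t1 + lo)%:E)%E.
Proof.
move=> /not_vertical_letter[l0 ba]; have [t0 tE] := t1_moran ij a01 d0.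
have [l <- _] := S1_min b ij d0.
apply: (@lower_le _ _ _ _ _ _ _ _ a01 b01 a_sum b_sum attrK _ _ dK l0 l ba dK0 dKle t0 tE _ _
  l1 l2 l3 l4 l12 l34).
  exact: S1_ge0.
by rewrite -sum_fibI S1_eq.
Qed.

Lemma global_exponent_le al al' : global_exponent a b ij al -> al <= al' ->
  global_exponent a b ij al'.
Proof.
by case=> t [sg [h1 h2 h3 h4]] le; exists t, sg; split=> //; exact: le_trans le.
Qed.

Hypothesis ab_neq : exists l, a (ij l).1 <> b (ij l).2.

Lemma assouad_le al : 0 <= al ->
  vertical_type a b ij \/ local_exponent a b ij al ->
  horizontal_type a b ij \/ local_exponent b a ji al ->
  (assouad_dim K <= al%:E)%E.
Proof.
move=> al0 H1 H2.
have [C C0 hC] := ball_covers a01 b01 a_sum b_sum ij_inj ab_neq attrK H1 H2.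
apply: ereal_inf_lbound; exists al => //; split=> //; exists C => // x rho rad Kx r0 rR Rd.
have [|n cn hn] := hC x rho rad r0 rR.
  by rewrite -lee_fin; apply: le_trans Rd (diam_K a01 b01 a_sum b_sum attrK).
by apply: le_trans (covering_number_le cn) _; rewrite lee_fin.
Qed.

Lemma box_le al (y : \bar R) :
  vertical_type a b ij \/ global_exponent a b ij al ->
  horizontal_type a b ij \/ global_exponent b a ji al ->
  box_dim_is K y -> (y <= al%:E)%E.
Proof.
move=> H1 H2; have [C C0 hC] := box_covers a01 b01 a_sum b_sum ij_inj ab_neq attrK H1 H2.
exact: box_dim_le C0 hC.
Qed.

(** In [C * (rho / ep)^h * ep^h] the covering scale [ep] cancels, so the bound survives arbitrarily
    fine covers. *)
Lemma measure_upper h : 0 <= h ->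
  vertical_type a b ij \/ local_exponent a b ij h ->
  horizontal_type a b ij \/ local_exponent b a ji h ->
  exists2 C : R, 0 < C & forall x rho, 0 < rho <= 2 ->
    (hausdorff_measure h (eball x rho `&` K) <= (C * rho `^ h)%:E)%E.
Proof.
move=> h0 H1 H2; have [C C0 hC] := ball_covers a01 b01 a_sum b_sum ij_inj ab_neq attrK H1 H2.
exists C => // x rho /andP[r0 r2]; apply/ereal_supP => _ [de de0 <-].
pose ep := Num.min de (rho / 2).
have ep0 : 0 < ep by rewrite lt_min de0 divr_gt0.
have epr : ep < rho by rewrite gt_min; apply/orP; right; lra.
have [n cn hn] := hC x ep rho ep0 epr r2.
have epd : 0 < ep <= de by rewrite ep0 ge_min lexx.
apply: le_trans (hausdorff_content_le h0 epd cn) _; rewrite lee_fin.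
apply: (@le_trans _ _ (C * (rho / ep) `^ h * ep `^ h)); first by rewrite ler_wpM2r ?powR_ge0.
by rewrite powR_div ?(ltW r0) ?(ltW ep0) // mulrA divfK // gt_eqF // powR_gt0.
Qed.

End Carpet.

Section Ahlfors.
Context {R : realType} {r s d : nat}.
Variables (a : 'I_r -> R) (b : 'I_s -> R) (ij : 'I_d -> 'I_r * 'I_s) (K : set (R * R)).
Hypothesis a01 : forall i, 0 < a i < 1.
Hypothesis b01 : forall j, 0 < b j < 1.
Hypothesis a_sum : \sum_(i < r) a i = 1.
Hypothesis b_sum : \sum_(j < s) b j = 1.
Hypothesis ij_inj : injective ij.
Hypothesis attrK : attractor a b ij K.
Hypothesis ab_neq : exists l, a (ij l).1 <> b (ij l).2.
Local Notation ji := (swap_ij ij).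

(** The upper bound comes from local exponents, the lower one from constant exponents. Which of the
    two lower bounds applies depends on the stopped word that is longer at the centre of the ball;
    one of them is obtained on the reflected carpet. *)
Lemma carpet_ahlfors h : 0 < h -> hausdorff_dim K = h%:E ->
  vertical_type a b ij \/ (local_exponent a b ij h /\ const_exponent a b ij h) ->
  horizontal_type a b ij \/ (local_exponent b a ji h /\ const_exponent b a ji h) ->
  ahlfors_regular K.
Proof.
move=> h0 hH H1 H2.
have [C C0 hC] : exists2 C : R, 0 < C & forall x rho, 0 < rho <= 2 ->
    (hausdorff_measure h (eball x rho `&` K) <= (C * rho `^ h)%:E)%E.
  apply: (measure_upper a01 b01 a_sum b_sum ij_inj attrK ab_neq (ltW h0)).
  - by case: H1 => [|[]]; [left|right].
  - by case: H2 => [|[]]; [left|right].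
have [c1 c10 hc1] : exists2 c : R, 0 < c & ~~ vertical_type a b ij ->
    forall rho z q, 0 < rho <= 2 -> K q ->
    wt a (iw ij z) <= rho / 2 -> wt b (jw ij z) <= rho / 2 ->
    (size (cut b (rho / 2) (jw ij z)) <= size (cut a (rho / 2) (iw ij z)))%N ->
    ((c * rho `^ h)%:E <= hausdorff_measure h (eball (psiw a b ij z q) rho `&` K))%E.
  case: H1 => [->|[_ H1]]; first by exists 1.
  by have [c c0 hc] := ball_measure_lower a01 b01 a_sum b_sum ij_inj attrK H1 h0; exists c.
have [c2 c20 hc2] : exists2 c : R, 0 < c & ~~ horizontal_type a b ij ->
    forall rho z q, 0 < rho <= 2 -> K q ->
    wt a (iw ij z) <= rho / 2 -> wt b (jw ij z) <= rho / 2 ->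
    (size (cut a (rho / 2) (iw ij z)) <= size (cut b (rho / 2) (jw ij z)))%N ->
    ((c * rho `^ h)%:E <= hausdorff_measure h (eball (psiw a b ij z q) rho `&` K))%E.
  case: H2 => [->|[_ H2]]; first by exists 1.
  have [c c0 hc] := ball_measure_lower b01 a01 b_sum a_sum (swap_ij_inj ij_inj)
    (attractor_swp attrK) H2 h0.
  exists c => // _ rho z q r01 Kq wa wb sz.
  have Kq' : swp K (q.2, q.1) by rewrite /swp /=; case: q Kq.
  have := hc rho z (q.2, q.1) r01 Kq' wb wa sz.
  by rewrite psiw_swap eball_swp hausdorff_measure_swp /= -surjective_pairing.
pose c := Num.max C (Num.max c1^-1 c2^-1).
have c0 : 0 < c by rewrite !lt_max C0.
have ci1 : c^-1 <= c1.
  by rewrite -[leRHS]invrK lef_pV2 ?posrE ?invr_gt0 // /c !le_max lexx orbT.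
have ci2 : c^-1 <= c2.
  by rewrite -[leRHS]invrK lef_pV2 ?posrE ?invr_gt0 // /c !le_max lexx !orbT.
exists h => //; exists c => // x rho Kx r0 rd.
have r02 : 0 < rho <= 2.
  by rewrite r0 -lee_fin; apply: le_trans rd (diam_K a01 b01 a_sum b_sum attrK).
split; last first.
  apply: le_trans (hC x rho r02) _; rewrite lee_fin ler_wpM2r ?powR_ge0 //.
  by rewrite /c le_max lexx.
have r20 : 0 < rho / 2 by rewrite divr_gt0.
have [N hN] := small_words ij a01 b01 r20.
have [z sz [q Kq ->]] := K_code attrK N Kx.
have [|wa wb] := hN z; first by rewrite sz.
have P1 : ~~ vertical_type a b ij ->
    (size (cut b (rho / 2) (jw ij z)) <= size (cut a (rho / 2) (iw ij z)))%N ->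
    ((c^-1 * rho `^ h)%:E <= hausdorff_measure h (eball (psiw a b ij z q) rho `&` K))%E.
  move=> nv le; apply: le_trans (hc1 nv rho z q r02 Kq wa wb le).
  by rewrite lee_fin ler_wpM2r ?powR_ge0.
have P2 : ~~ horizontal_type a b ij ->
    (size (cut a (rho / 2) (iw ij z)) <= size (cut b (rho / 2) (jw ij z)))%N ->
    ((c^-1 * rho `^ h)%:E <= hausdorff_measure h (eball (psiw a b ij z q) rho `&` K))%E.
  move=> nv le; apply: le_trans (hc2 nv rho z q r02 Kq wa wb le).
  by rewrite lee_fin ler_wpM2r ?powR_ge0.
have r0' : 0 < rho / 2 <= rho / 2 by rewrite r20 lexx.
case: (boolP (horizontal_type a b ij)) => [hor|hor].
  have ver : ~~ vertical_type a b ij.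
    apply/negP => /forallP ver; case: ab_neq => l; apply; apply/le_anti.
    by rewrite ver (forallP hor l).
  by apply: P1 => //; exact: horizontal_cut (forallP hor) r0'.
case: (boolP (vertical_type a b ij)) => [ver|ver].
  by apply: P2 => //; exact: (@horizontal_cut _ _ _ _ b a ji b01 a01 _ _ z (forallP ver) r0').
by case: (leqP (size (cut b (rho / 2) (jw ij z))) (size (cut a (rho / 2) (iw ij z))))
  => [le|/ltnW le]; [exact: P1|exact: P2].
Qed.

End Ahlfors.

(** * The equivalences *)

(* The arithmetic of the case distinctions, over abstract exponents: lo1, hi1
   (lo2, hi2) stand for t1 + min S1, t1 + max S1 (resp. t2, S2), and V, H for the
   vertical and horizontal types. *)
Section Classification.
Context {R : realType}.
Variables (V H : bool) (uvf uhf : Prop) (lo1 hi1 lo2 hi2 : R) (dimH dimA dimL : \bar R).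
Local Notation E1 := (if V then -1 else hi1).
Local Notation E2 := (if H then -1 else hi2).
Local Notation F1 := (if V then 3 else lo1).
Local Notation F2 := (if H then 3 else lo2).

Hypothesis not_both : ~~ (V && H).
Hypothesis lo1_gt0 : 0 < lo1.
Hypothesis lo2_gt0 : 0 < lo2.
Hypothesis lo_hi1 : lo1 <= hi1.
Hypothesis lo_hi2 : lo2 <= hi2.
Hypothesis uvfE : uvf <-> lo1 = hi1.
Hypothesis uhfE : uhf <-> lo2 = hi2.
Hypothesis dimA_ge1 : ~~ V -> (hi1%:E <= dimA)%E.
Hypothesis dimA_ge2 : ~~ H -> (hi2%:E <= dimA)%E.
Hypothesis dimL_le1 : ~~ V -> (dimL <= lo1%:E)%E.
Hypothesis dimL_le2 : ~~ H -> (dimL <= lo2%:E)%E.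
Hypothesis dimH_ge1 : (lo1%:E <= dimH)%E.
Hypothesis dimH_ge2 : (lo2%:E <= dimH)%E.
Hypothesis dimH_gt1 : ~ uvf -> (lo1%:E < dimH)%E.
Hypothesis dimH_gt2 : ~ uhf -> (lo2%:E < dimH)%E.
Hypothesis dimA_le : forall al, 0 <= al -> V \/ hi1 <= al -> H \/ hi2 <= al ->
  (dimA <= al%:E)%E.

Let ufA' := [/\ E2 < E1 -> uvf, E1 < E2 -> uhf & E1 = E2 -> uvf \/ uhf].

Let ufL' := [/\ H -> uvf, V -> uhf & ~~ H && ~~ V -> [/\ uvf, uhf & F1 = F2]].

Let hi1_gt0 : 0 < hi1 := lt_le_trans lo1_gt0 lo_hi1.
Let hi2_gt0 : 0 < hi2 := lt_le_trans lo2_gt0 lo_hi2.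

Lemma ufA_le : ufA' -> (dimA <= dimH)%E.
Proof.
move=> [c1 c2 c3].
have K1 : V = false -> uvf -> H \/ hi2 <= hi1 -> (dimA <= dimH)%E.
  move=> v /uvfE u h; apply: le_trans dimH_ge1; rewrite u.
  by apply: dimA_le => //; [exact: ltW | right].
have K2 : H = false -> uhf -> V \/ hi1 <= hi2 -> (dimA <= dimH)%E.
  move=> v /uhfE u h; apply: le_trans dimH_ge2; rewrite u.
  by apply: dimA_le => //; [exact: ltW | right].
(* The value [-1] lies below both [hi1] and [hi2], so in a pure type comparing [E1] with [E2] merely
   recovers the type. *)
have m1 : -1 < hi1 by apply: lt_trans hi1_gt0; exact: ltrN10.
have m2 : -1 < hi2 by apply: lt_trans hi2_gt0; exact: ltrN10.
case EV : V c1 c2 c3 => /=; case EH : H => /= c1 c2 c3.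
- by move: not_both; rewrite EV EH.
- by apply: K2 => //; [exact: c2 | left].
- by apply: K1 => //; [exact: c1 | left].
case: (ltgtP hi1 hi2) => h.
- by apply: K2 (c2 h) _ => //; right; exact: ltW.
- by apply: K1 (c1 h) _ => //; right; exact: ltW.
- by case: (c3 h) => u; [apply: K1 u _ | apply: K2 u _] => //; right; rewrite h.
Qed.

(** [D1] and [D2] play the exponents of [global_exponent_lt], and the last hypothesis the box
    dimension bound once that dimension equals [dimA]. If the fibres belonging to the larger of
    [E1], [E2] were not uniform, this bound would fall below [dimA]. *)
Lemma ufA_of_bound (D1 D2 : R) : D1 <= hi1 -> (~ uvf -> D1 < hi1) ->
  D2 <= hi2 -> (~ uhf -> D2 < hi2) ->
  (forall al, V \/ D1 <= al -> H \/ D2 <= al -> (dimA <= al%:E)%E) -> ufA'.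
Proof.
move=> D1le D1lt D2le D2lt bnd.
have m1 : -1 < hi1 by apply: lt_trans hi1_gt0; exact: ltrN10.
have m2 : -1 < hi2 by apply: lt_trans hi2_gt0; exact: ltrN10.
have K1 al : V = false -> (dimA <= al%:E)%E -> hi1 <= al.
  by move=> v h; rewrite -lee_fin; apply: le_trans (dimA_ge1 _) h; rewrite v.
have K2 al : H = false -> (dimA <= al%:E)%E -> hi2 <= al.
  by move=> v h; rewrite -lee_fin; apply: le_trans (dimA_ge2 _) h; rewrite v.
rewrite /ufA'; case EV : V bnd K1; case EH : H => bnd K1 /=.
- by move: not_both; rewrite EV EH.
- split=> [h|_|h]; [by move: h m2; lra | | by move: h m2; lra].
  apply: contrapT => /D2lt; rewrite ltNge => /negP; apply; apply: K2 => //.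
  by apply: bnd; [left | right].
- split=> [_|h|h]; [ | by move: h m1; lra | by move: h m1; lra].
  apply: contrapT => /D1lt; rewrite ltNge => /negP; apply; apply: K1 => //.
  by apply: bnd; [right | left].
have B : (dimA <= (Num.max D1 D2)%:E)%E by apply: bnd; right; rewrite le_max lexx ?orbT.
have {}K1 := K1 _ erefl B; have {}K2 := K2 _ EH B.
split=> h; apply: contrapT => u.
- have := D1lt u => lt1; move: K1; rewrite leNgt gt_max lt1 (le_lt_trans D2le h) //.
- have := D2lt u => lt1; move: K2; rewrite leNgt gt_max lt1 (le_lt_trans D1le h) //.
- have lt1 : D1 < hi1 by apply: D1lt => ?; apply: u; left.
  have lt2 : D2 < hi2 by apply: D2lt => ?; apply: u; right.
  by move: K1; rewrite leNgt gt_max lt1 h lt2.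
Qed.

Lemma dimL_le_dimH : (dimL <= dimH)%E.
Proof.
case: (boolP V) => v; last exact: le_trans (dimL_le1 v) dimH_ge1.
have h : ~~ H by move: not_both; rewrite v.
exact: le_trans (dimL_le2 h) dimH_ge2.
Qed.

(** Extracts the single exponent [h] at which the lower bound for [dimH], the upper bounds on counts
    and, in mixed type, both directions agree. *)
Lemma ufL_exponent : ufL' -> exists h, [/\ 0 < h, (h%:E <= dimH)%E,
  V \/ [/\ hi1 <= h, h = lo1 & uvf] & H \/ [/\ hi2 <= h, h = lo2 & uhf]].
Proof.
rewrite /ufL' => -[]; case EV : V not_both; case EH : H => //= _ c1 c2 c3.
- have u := c2 isT; exists lo2; split=> //; first by left.
  by right; split=> //; rewrite (uhfE.1 u).
- have u := c1 isT; exists lo1; split=> //; last by left.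
  by right; split=> //; rewrite (uvfE.1 u).
have [u1 u2 E] := c3 isT; exists lo1; split=> //; right; split=> //.
  by rewrite (uvfE.1 u1).
by rewrite E (uhfE.1 u2).
Qed.

Lemma ufL_of_bounds : (~~ V -> uvf) -> (~~ H -> uhf) ->
  (~~ V -> ~~ H -> lo1 = lo2) -> ufL'.
Proof.
move=> K1 K2 K3; split=> [h|v|/andP[h v]].
- by apply: K1; move: not_both; rewrite h andbT.
- by apply: K2; move: not_both; rewrite v.
- by split; [exact: K1|exact: K2|rewrite (negPf h) (negPf v) K3].
Qed.

Lemma ufL_of_hausdorff : dimL = dimH -> ufL'.
Proof.
move=> E; apply: ufL_of_bounds => [v|h|v h].
- apply: contrapT => /dimH_gt1; rewrite -E => /lt_le_trans /(_ (dimL_le1 v)).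
  by rewrite ltxx.
- apply: contrapT => /dimH_gt2; rewrite -E => /lt_le_trans /(_ (dimL_le2 h)).
  by rewrite ltxx.
apply/le_anti; rewrite -!lee_fin; apply/andP; split.
  by apply: le_trans (dimL_le2 h); rewrite E.
by apply: le_trans (dimL_le1 v); rewrite E.
Qed.

Lemma ufL_of_assouad : dimL = dimA -> ufL'.
Proof.
move=> E; have K1 : ~~ V -> hi1 <= lo1.
  by move=> v; rewrite -lee_fin; apply: le_trans (dimA_ge1 v) _; rewrite -E dimL_le1.
have K2 : ~~ H -> hi2 <= lo2.
  by move=> v; rewrite -lee_fin; apply: le_trans (dimA_ge2 v) _; rewrite -E dimL_le2.
apply: ufL_of_bounds => [v|h|v h].
- by apply/uvfE/le_anti; rewrite lo_hi1 K1.
- by apply/uhfE/le_anti; rewrite lo_hi2 K2.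
apply/le_anti; rewrite -!lee_fin; apply/andP; split.
  apply: le_trans (dimL_le2 h); rewrite E; apply: le_trans (dimA_ge1 v).
  by rewrite lee_fin.
apply: le_trans (dimL_le1 v); rewrite E; apply: le_trans (dimA_ge2 h).
by rewrite lee_fin.
Qed.

End Classification.

Section Main.
Context {R : realType} {r s d : nat}.
Variables (a : 'I_r -> R) (b : 'I_s -> R) (ij : 'I_d -> 'I_r * 'I_s) (K : set (R * R)).
Hypothesis a01 : forall i, 0 < a i < 1.
Hypothesis b01 : forall j, 0 < b j < 1.
Hypothesis a_sum : \sum_(i < r) a i = 1.
Hypothesis b_sum : \sum_(j < s) b j = 1.
Hypothesis ij_inj : injective ij.
Hypothesis attrK : attractor a b ij K.
Hypothesis ab_neq : exists l, a (ij l).1 <> b (ij l).2.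
Hypothesis K_not_vertical : ~ exists c, forall p, K p -> p.1 = c.
Hypothesis K_not_horizontal : ~ exists c, forall p, K p -> p.2 = c.

Local Notation ji := (swap_ij ij).
Local Notation V := (vertical_type a b ij).
Local Notation H := (horizontal_type a b ij).
Local Notation uvf := (uniform_vertical_fibres b ij).
Local Notation uhf := (uniform_horizontal_fibres a ij).
Local Notation dimH := (hausdorff_dim K).
Local Notation dimA := (assouad_dim K).
Local Notation dimL := (lower_dim K).
Local Notation lo1 := (t1 a ij + inf (range (S1 b ij))).
Local Notation hi1 := (t1 a ij + sup (range (S1 b ij))).
Local Notation lo2 := (t2 b ij + inf (range (S2 a ij))).
Local Notation hi2 := (t2 b ij + sup (range (S2 a ij))).

Let ji_inj : injective ji. Proof. exact: swap_ij_inj. Qed.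
Let attrK' : attractor b a ji (swp K). Proof. exact: attractor_swp. Qed.

Let d0 : (0 < d)%N. Proof. by case: ab_neq => l _; exact: leq_ltn_trans (ltn_ord l). Qed.

Let swp_not_vertical : ~ exists c, forall p, swp K p -> p.1 = c.
Proof.
move=> [c hc]; apply: K_not_horizontal; exists c => p Kp.
by apply: (hc (p.2, p.1)); rewrite /swp /=; case: p Kp.
Qed.

Let not_both : ~~ (V && H).
Proof.
apply/negP => /andP[/forallP v /forallP h]; case: ab_neq => l; apply.
by apply/le_anti; rewrite v h.
Qed.

Let data1 : [/\ (~~ V -> (hi1%:E <= dimA)%E), (~~ V -> (dimL <= lo1%:E)%E),
  (lo1%:E <= dimH)%E, (~ uvf -> (lo1%:E < dimH)%E) & 0 < t1 a ij].
Proof.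
have [l3 [l4 l34]] := distinct_columns a01 b01 a_sum b_sum attrK K_not_vertical.
have [l1 [l2 l12]] := distinct_columns b01 a01 b_sum a_sum attrK' swp_not_vertical.
have [dK dK0 dKle] := diam_K_gt0 attrK K_not_vertical.
split.
- exact: (assouad_ge_hi a01 b01 a_sum b_sum ij_inj attrK d0 dK0 dKle).
- exact: (lower_le_lo a01 b01 a_sum b_sum attrK d0 l12 l34 dK0 dKle).
- exact: (hausdorff_ge_lo a01 b01 a_sum b_sum ij_inj attrK d0).
- exact: (hausdorff_gt_lo a01 b01 a_sum b_sum ij_inj attrK d0).
- exact: (t1_gt0 a01 d0 l34).
Qed.

(** The column lemmas applied to the reflected carpet; [S2] and [t2] for [ij] are, by conversion,
    [S1] and [t1] for [swap_ij ij]. *)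
Let data2 : [/\ (~~ H -> (hi2%:E <= dimA)%E), (~~ H -> (dimL <= lo2%:E)%E),
  (lo2%:E <= dimH)%E, (~ uhf -> (lo2%:E < dimH)%E) & 0 < t2 b ij].
Proof.
have [l3 [l4 l34]] := distinct_columns a01 b01 a_sum b_sum attrK K_not_vertical.
have [l1 [l2 l12]] := distinct_columns b01 a01 b_sum a_sum attrK' swp_not_vertical.
have [dK dK0 dKle] := diam_K_gt0 attrK' swp_not_vertical.
rewrite -(assouad_dim_swp K) -(lower_dim_swp K) -(hausdorff_dim_swp K).
split.
- exact: (assouad_ge_hi b01 a01 b_sum a_sum ji_inj attrK' d0 dK0 dKle).
- exact: (lower_le_lo b01 a01 b_sum a_sum attrK' d0 l34 l12 dK0 dKle).
- exact: (hausdorff_ge_lo b01 a01 b_sum a_sum ji_inj attrK' d0).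
- exact: (hausdorff_gt_lo b01 a01 b_sum a_sum ji_inj attrK' d0).
- exact: (t1_gt0 b01 d0 l12).
Qed.

Let uvfE : uvf <-> lo1 = hi1.
Proof.
split=> [/(uvfP _ b01 d0) ->//|E]; apply/(uvfP _ b01 d0); exact: addrI E.
Qed.

Let uhfE : uhf <-> lo2 = hi2.
Proof.
split=> [/(@uvfP _ _ _ _ a ji a01 d0) h|E]; first by rewrite [inf _]h.
by apply/(@uvfP _ _ _ _ a ji a01 d0); exact: addrI E.
Qed.

Let lo_hi1 : lo1 <= hi1.
Proof. by rewrite lerD2l; exact: lo_le_hi. Qed.

Let lo_hi2 : lo2 <= hi2.
Proof. by rewrite lerD2l; exact: (@lo_le_hi _ _ _ _ a ji). Qed.

Let lo1_gt0 : 0 < lo1.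
Proof. by case: data1 => _ _ _ _ h; rewrite ltr_pwDl // (lo_ge0 ij b01 d0). Qed.

Let lo2_gt0 : 0 < lo2.
Proof. by case: data2 => _ _ _ _ h; rewrite ltr_pwDl // (@lo_ge0 _ _ _ _ a ji a01 d0). Qed.

Let local1 al : hi1 <= al -> local_exponent a b ij al.
Proof. exact: local_exponent_hi. Qed.

Let local2 al : hi2 <= al -> local_exponent b a ji al.
Proof. exact: (@local_exponent_hi _ _ _ _ b a ji b01 a01 d0). Qed.

Let const1 : uvf -> const_exponent a b ij lo1.
Proof.
move=> u; exists (t1 a ij), (inf (range (S1 b ij))); split=> //.
- exact: t1_moran.
- exact: lo_ge0.
- by move=> l; rewrite -[in LHS](uvf_const b01 d0 u l) -sum_fibI S1_eq.
Qed.

Let const2 : uhf -> const_exponent b a ji lo2.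
Proof.
move=> u; exists (t2 b ij), (inf (range (S2 a ij))); split=> //.
- exact: (@t1_moran _ _ _ _ b ji b01 d0).
- exact: (@lo_ge0 _ _ _ _ a ji a01 d0).
- move=> l; rewrite -[in LHS](@uvf_const _ _ _ _ a ji a01 d0 u l) -sum_fibI.
  by rewrite S1_eq.
Qed.

Let dimA_le al : 0 <= al -> V \/ hi1 <= al -> H \/ hi2 <= al -> (dimA <= al%:E)%E.
Proof.
move=> al0 h1 h2; apply: (assouad_le a01 b01 a_sum b_sum ij_inj attrK ab_neq al0).
- by case: h1 => [|/local1]; [left|right].
- by case: h2 => [|/local2]; [left|right].
Qed.

Let K_diam : K !=set0 /\ ((0 < diam K)%E /\ (diam K < +oo)%E).
Proof.
split; first by case: attrK.
have [dK dK0 dKle] := diam_K_gt0 attrK K_not_vertical; split.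
  by apply: lt_le_trans dKle; rewrite lte_fin.
by apply: le_lt_trans (diam_K a01 b01 a_sum b_sum attrK) _; rewrite ltry.
Qed.

Let dimH_le_dimA : (dimH <= dimA)%E.
Proof. by case: K_diam => ? [? ?]; exact: hausdorff_dim_le_assouad. Qed.

Lemma ufA_hausdorff : ufA a b ij -> dimH = dimA.
Proof.
move=> h; apply/le_anti; rewrite dimH_le_dimA /=.
have [_ _ H1 _ _] := data1; have [_ _ H2 _ _] := data2.
exact: (ufA_le not_both lo1_gt0 lo2_gt0 lo_hi1 lo_hi2 uvfE uhfE H1 H2 dimA_le h).
Qed.

Lemma hausdorff_box : dimH = dimA -> box_dim_is K dimA.
Proof.
have [K0 [dK0 dKoo]] := K_diam.
(* Only finiteness of [dimA] is at stake; the sum dominates both exponents, whatever the type. *)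
have hi0 : 0 < hi1 + hi2.
  exact: addr_gt0 (lt_le_trans lo1_gt0 lo_hi1) (lt_le_trans lo2_gt0 lo_hi2).
have up : (dimA <= (hi1 + hi2)%:E)%E.
  by apply: dimA_le; [exact: ltW hi0
    | right; rewrite lerDl; exact: le_trans (ltW lo2_gt0) lo_hi2
    | right; rewrite lerDr; exact: le_trans (ltW lo1_gt0) lo_hi1].
move: up (assouad_dim_ge0 K); case E : dimA => [A| |].
- by move=> _ _ hE; exact: box_dim_assouad.
- by rewrite leye_eq.
- by [].
Qed.

Lemma box_ufA : box_dim_is K dimA -> ufA a b ij.
Proof.
move=> hbox; have [A1 _ _ _ _] := data1; have [A2 _ _ _ _] := data2.
have [D1 [D1le D1lt G1]] : exists D, [/\ D <= hi1, ~ uvf -> D < hi1 & global_exponent a b ij D].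
  have [u|u] := pselect uvf.
    exists hi1; split; [exact: lexx | by case/(_ u) | exact: local_global (local1 (lexx _))].
  have [D DD ?] := global_exponent_lt a01 b01 d0 u.
  by exists D; split; [exact: ltW DD | move=> _; exact: DD | ].
have [D2 [D2le D2lt G2]] : exists D, [/\ D <= hi2, ~ uhf -> D < hi2 & global_exponent b a ji D].
  have [u|u] := pselect uhf.
    exists hi2; split; [exact: lexx | by case/(_ u) | exact: local_global (local2 (lexx _))].
  have [D DD ?] := @global_exponent_lt _ _ _ _ b a ji b01 a01 d0 u.
  by exists D; split; [exact: ltW DD | move=> _; exact: DD | ].
apply: (ufA_of_bound not_both lo1_gt0 lo2_gt0 lo_hi1 lo_hi2 A1 A2 D1le D1lt D2le D2lt).
move=> al h1 h2; apply: (box_le a01 b01 a_sum b_sum ij_inj attrK ab_neq _ _ hbox).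
- by case: h1 => [?|h]; [left|right; exact: global_exponent_le G1 h].
- by case: h2 => [?|h]; [left|right; exact: global_exponent_le G2 h].
Qed.

Let dimL_dimH : (dimL <= dimH)%E.
Proof.
have [_ L1 H1 _ _] := data1; have [_ L2 H2 _ _] := data2.
exact: (dimL_le_dimH not_both L1 L2 H1 H2).
Qed.

(** Everything is squeezed to [h]: [dimA <= h <= dimH <= dimA]. Regularity at exponent [h] then
    gives [dimH <= dimL]. *)
Lemma ufL_dims : ufL a b ij -> [/\ dimL = dimH, dimL = dimA & ahlfors_regular K].
Proof.
have [_ _ H1 _ _] := data1; have [_ _ H2 _ _] := data2.
move=> /(ufL_exponent not_both lo1_gt0 lo2_gt0 uvfE uhfE H1 H2)[h [h0 hH V1 V2]].
have hA : (dimA <= h%:E)%E.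
  apply: dimA_le (ltW h0) _ _; first by case: V1 => [|[]]; [left|right].
  by case: V2 => [|[]]; [left|right].
have eH : dimH = h%:E by apply/le_anti; rewrite hH (le_trans dimH_le_dimA hA).
have eA : dimA = h%:E by apply/le_anti; rewrite hA -eH dimH_le_dimA.
have reg : ahlfors_regular K.
  apply: (carpet_ahlfors a01 b01 a_sum b_sum ij_inj attrK ab_neq h0 eH).
  - case: V1 => [|[h1 h2 u]]; [by left|right; split; first exact: local1].
    by rewrite h2; exact: const1.
  - case: V2 => [|[h1 h2 u]]; [by left|right; split; first exact: local2].
    by rewrite h2; exact: const2.
have eL : dimL = dimH by apply/le_anti; rewrite dimL_dimH (ahlfors_lower reg).
by split=> //; rewrite eL eH eA.
Qed.

Lemma lower_hausdorff_ufL : dimL = dimH -> ufL a b ij.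
Proof.
have [_ L1 H1 s1 _] := data1; have [_ L2 H2 s2 _] := data2.
exact: (ufL_of_hausdorff not_both L1 L2 H1 H2 s1 s2).
Qed.

Lemma lower_assouad_ufL : dimL = dimA -> ufL a b ij.
Proof.
have [A1 L1 _ _ _] := data1; have [A2 L2 _ _ _] := data2.
exact: (ufL_of_assouad not_both lo_hi1 lo_hi2 uvfE uhfE A1 A2 L1 L2).
Qed.

Lemma ahlfors_ufL : ahlfors_regular K -> ufL a b ij.
Proof.
move=> reg; apply: lower_hausdorff_ufL; apply/le_anti.
by rewrite dimL_dimH (ahlfors_lower reg).
Qed.

End Main.

Theorem theorem1p3 (R : realType) (r s d : nat)
    (a : 'I_r -> R) (b : 'I_s -> R) (ij : 'I_d -> 'I_r * 'I_s)
    (K : set (R * R))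
    (r_ge2 : (2 <= r)%N) (s_ge2 : (2 <= s)%N) (d_ge2 : (2 <= d)%N)
    (d_le : (d <= r * s)%N)
    (a01 : forall i, 0 < a i < 1) (b01 : forall j, 0 < b j < 1)
    (a_sum : \sum_(i < r) a i = 1) (b_sum : \sum_(j < s) b j = 1)
    (ij_inj : injective ij)
    (K_attractor : attractor a b ij K)
    (ab_neq : exists l, a (ij l).1 <> b (ij l).2)
    (K_not_vertical : ~ exists c, forall p, K p -> p.1 = c)
    (K_not_horizontal : ~ exists c, forall p, K p -> p.2 = c) :
  [<-> ufA a b ij;
       box_dim_is K (assouad_dim K);
       hausdorff_dim K = assouad_dim K] /\
  [<-> ufL a b ij;
       lower_dim K = hausdorff_dim K;
       lower_dim K = assouad_dim K;
       ahlfors_regular K].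
Proof.
have ufA_H := ufA_hausdorff a01 b01 a_sum b_sum ij_inj K_attractor ab_neq
  K_not_vertical K_not_horizontal.
have H_B := hausdorff_box a01 b01 a_sum b_sum ij_inj K_attractor ab_neq
  K_not_vertical K_not_horizontal.
have B_ufA := box_ufA a01 b01 a_sum b_sum ij_inj K_attractor ab_neq
  K_not_vertical K_not_horizontal.
have ufL_all := ufL_dims a01 b01 a_sum b_sum ij_inj K_attractor ab_neq
  K_not_vertical K_not_horizontal.
have LH_ufL := lower_hausdorff_ufL a01 b01 a_sum b_sum ij_inj K_attractor ab_neq
  K_not_vertical K_not_horizontal.
have LA_ufL := lower_assouad_ufL a01 b01 a_sum b_sum ij_inj K_attractor ab_neq
  K_not_vertical K_not_horizontal.
have reg_ufL := ahlfors_ufL a01 b01 a_sum b_sum ij_inj K_attractor ab_neq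
  K_not_vertical K_not_horizontal.
split; tfae.
- by move=> /ufA_H /H_B.
- by move=> /B_ufA /ufA_H.
- by move=> /H_B /B_ufA.
- by case/ufL_all.
- by move=> /LH_ufL /ufL_all[].
- by move=> /LA_ufL /ufL_all[].
- exact: reg_ufL.
Qed.
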